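(* Let $h$ be a convex normal integrand on $\mathbb{R}^n\times\Omega$ such that $\phi(0)$ is finite and $Eh$ is proper on $L^\infty$, where $\phi(z)=\inf_{x\in\mathcal N}Eh(x+z)$ for $z\in L^\infty$. Let $\mathcal A:=\operatorname{aff}(\operatorname{dom}Eh\cap L^\infty)$. Assume: (1) for every $z\in\operatorname{dom}Eh\cap L^\infty$ and every $t=0,\ldots,T$ there exists $\hat z\in\operatorname{dom}Eh\cap L^\infty$ such that $E_tz^t=\hat z^t$; (2) there exists $\rho\in\mathbb{R}$ such that for every $z\in\mathcal A$ there exists $x\in\mathcal A\cap\mathcal N^\infty$ with $\|x-z\|\le\rho\|{}^az-z\|$; (3) $Eh$ is strongly continuous at a point of $\mathcal N^\infty$ relative to $\mathcal A$, i.e. there is $\bar x\in\mathcal A\cap\mathcal N^\infty$ at which $Eh$ is finite and at which the restriction of $Eh$ to $\mathcal A$ is continuous with respect to the $L^\infty$-norm. Then a shadow price of information exists, i.e. there is $v\in L^1$ such that $\phi(z)\ge\phi(0)+E(z\cdot v)$ for all $z\in L^\infty$.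
   Context: $(\Omega,\mathcal F,P)$ is a probability space with a filtration $(\mathcal F_t)_{t=0}^T$ (sub-$\sigma$-algebras of $\mathcal F$; $\mathcal F_T$ need not equal $\mathcal F$), and $n=n_0+\cdots+n_T$. $L^p:=L^p(\Omega,\mathcal F,P;\mathbb{R}^n)$ for $p\in\{0,1,\infty\}$; $\|\cdot\|$ is the $L^\infty$-norm. $\mathcal N=\{(x_t)_{t=0}^T \mid x_t\in L^0(\Omega,\mathcal F_t,P;\mathbb{R}^{n_t})\}$ and $\mathcal N^\infty:=\mathcal N\cap L^\infty$. For $x=(x_0,\ldots,x_T)$, $x^t:=(x_0,\ldots,x_t)$. $E_t$ is the (componentwise) conditional expectation with respect to $\mathcal F_t$, and ${}^ax$ is the adapted projection of $x\in L^\infty$: $({}^ax)_t=E_tx_t$. A normal integrand is a function $h:\mathbb{R}^n\times\Omega\to[-\infty,\infty]$ such that $\omega\mapsto\{(\xi,\alpha)\mid h(\xi,\omega)\le\alpha\}$ is a closed-valued $\mathcal F$-measurable set-valued mapping; it is convex if $h(\cdot,\omega)$ is convex for every $\omega$. For $x\in L^0$, $Eh(x)$ is the expectation of $\omega\mapsto h(x(\omega),\omega)$, where the expectation of a measurable function is defined as $+\infty$ unless its positive part is integrable. $\operatorname{dom}Eh=\{x\mid Eh(x)<\infty\}$. ''$Eh$ is proper on $L^\infty$'' means that $Eh>-\infty$ on $L^\infty$ and $Eh(z)<\infty$ for some $z\in L^\infty$. $\operatorname{aff}$ denotes the (algebraic) affine hull. *)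

(* Defs.v *)
From HB Require Import structures.
From mathcomp Require Import all_boot all_order all_algebra.
From mathcomp Require Import all_classical all_reals all_analysis.
From mathcomp Require Import measurable_realfun.

Set Implicit Arguments.
Unset Strict Implicit.
Unset Printing Implicit Defensive.

Import Order.TTheory GRing.Theory Num.Theory.
Import numFieldNormedType.Exports.

Local Open Scope classical_set_scope.
Local Open Scope ring_scope.

(* Elements of L^p are represented by functions: all sets of random vectors
   below are sets of functions, and equalities between random vectors are
   required to hold P-almost everywhere only. *)

Definition L0 (R : realType) (d : measure_display) (Omega : measurableType d)
    (k : nat) : set (Omega -> 'rV[R]_k) :=
  [set x | forall i, measurable_fun [set: Omega] (fun w => x w ord0 i)].
Arguments L0 R {d} Omega k.

Definition Lpnorm (R : realType) (d : measure_display)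
    (Omega : measurableType d) (P : probability Omega R) (k : nat)
    (p : \bar R) (x : Omega -> 'rV[R]_k) : \bar R :=
  Lnorm P p (fun w => `|x w|%:E).

Definition Lp (R : realType) (d : measure_display)
    (Omega : measurableType d) (P : probability Omega R) (k : nat)
    (p : \bar R) : set (Omega -> 'rV[R]_k) :=
  [set x | L0 R Omega k x /\ (Lpnorm P p x < +oo)%E].

Notation L1 P k := (@Lp _ _ _ P k 1%E).
Notation Linfty P k := (@Lp _ _ _ P k +oo%E).

Definition filtration (d : measure_display) (Omega : measurableType d)
    (T : nat) (F : 'I_T.+1 -> set (set Omega)) : Prop :=
  [/\ forall t, sigma_algebra [set: Omega] (F t),
      forall t, F t `<=` measurable &
      forall s t : 'I_T.+1, (s <= t)%N -> F s `<=` F t].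

Definition is_cond_exp (R : realType) (d : measure_display)
    (Omega : measurableType d) (P : probability Omega R)
    (G : set (set Omega)) (f g : Omega -> R) : Prop :=
  [/\ measurable_fun [set: g_sigma_algebraType G] g,
      P.-integrable [set: Omega] (EFin \o g) &
      forall A, G A ->
        (\int[P]_(w in A) (g w)%:E = \int[P]_(w in A) (f w)%:E)%E].

(* An arbitrary version of E[f | G]; [cond_expP] shows that the choice is not
   vacuous. *)
Definition cond_exp (R : realType) (d : measure_display)
    (Omega : measurableType d) (P : probability Omega R)
    (G : set (set Omega)) (f : Omega -> R) : Omega -> R :=
  xget (cst 0) [set g | is_cond_exp P G f g].

Lemma cond_expP (R : realType) (d : measure_display)
    (Omega : measurableType d) (P : probability Omega R)
    (G : set (set Omega)) (f : Omega -> R) :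
  sigma_algebra [set: Omega] G -> G `<=` measurable ->
  P.-integrable [set: Omega] (EFin \o f) ->
  is_cond_exp P G f (cond_exp P G f).
Proof.
move=> sG Gm fi.
suff : exists g, is_cond_exp P G f g.
  by move=> gP; exact: (@xgetPex _ (cst 0) [set g | is_cond_exp P G f g] gP).
have mG : <<s G >> = G by exact: sigma_algebra_id.
pose T' : measurableType _ := g_sigma_algebraType G.
pose phi : Omega -> T' := idfun.
have mphi : measurable_fun [set: Omega] phi.
  move=> _ A mA; rewrite setTI; apply: Gm.
  suff : <<s G >> A by rewrite mG.
  exact: mA.
pose phi' : {mfun Omega >-> T'} := mfun_Sub (mem_set mphi).
pose mu : probability T' R := distribution P phi'.
pose nu0 : {charge set Omega -> \bar R} := induced_charge fi.
have mphi' : measurable_fun [set: Omega] phi' by [].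
pose nu : {charge set T' -> \bar R} :=
    measure_function_pushforward__canonical__charge_Charge nu0 mphi'.
have numu : nu `<< mu.
  apply: (@dominates_pushforward _ _ _ _ _ P nu0) => //.
  apply/null_content_dominatesP => A mA PA0.
  rewrite /= /induced_charge; apply: null_set_integral => //.
  exact: measurable_funS (measurable_int P fi).
pose g : T' -> \bar R := Radon_Nikodym nu mu.
have rni : mu.-integrable [set: T'] g := Radon_Nikodym_integrable numu.
have rnf x : g x \is a fin_num := Radon_Nikodym_fin_num x numu.
have mg : measurable_fun [set: T'] g := measurable_int mu rni.
have gE : EFin \o (fine \o g) = g by apply/funext => x /=; rewrite fineK.
have gi : P.-integrable [set: Omega] (g \o phi').
  apply/integrableP; split; first exact: measurableT_comp.
  move/integrableP : rni => [_]; rewrite ge0_integral_pushforward//.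
  exact: measurableT_comp.
exists (fine \o g); split.
- exact: measurableT_comp.
- by rewrite gE.
- move=> A GA.
  have mA : measurable (A : set T') by rewrite /measurable/= mG.
  rewrite -[RHS]/(nu A) (Radon_Nikodym_integral numu mA).
  rewrite (@integral_pushforward _ _ _ _ _ _ mphi' P A g)//.
    by apply: eq_integral => x _ /=; rewrite fineK.
  apply: integrableS gi => //.
  exact: Gm.
Qed.

Definition vcond_exp (R : realType) (d : measure_display)
    (Omega : measurableType d) (P : probability Omega R)
    (G : set (set Omega)) (k : nat) (x : Omega -> 'rV[R]_k) :
    Omega -> 'rV[R]_k :=
  fun w => \row_i cond_exp P G (fun w' => x w' ord0 i) w.

(* R^n with n = n_0 + ... + n_T is 'rV[R]_(\sum_(t < T.+1) n_ t); the block
   x_t of x is [submxrow x t], and \mxrow_t reassembles the blocks. *)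

Definition component (R : realType) (Omega : Type) (T : nat)
    (n_ : 'I_T.+1 -> nat) (x : Omega -> 'rV[R]_(\sum_(t < T.+1) n_ t))
    (t : 'I_T.+1) : Omega -> 'rV[R]_(n_ t) :=
  fun w => submxrow (x w) t.

Definition adapted (R : realType) (d : measure_display)
    (Omega : measurableType d) (T : nat) (n_ : 'I_T.+1 -> nat)
    (F : 'I_T.+1 -> set (set Omega)) :
    set (Omega -> 'rV[R]_(\sum_(t < T.+1) n_ t)) :=
  [set x | forall t,
     L0 R (g_sigma_algebraType (F t)) (n_ t) (component x t)].
Arguments adapted R {d Omega T} n_ F.

Definition adapted_proj (R : realType) (d : measure_display)
    (Omega : measurableType d) (P : probability Omega R) (T : nat)
    (n_ : 'I_T.+1 -> nat) (F : 'I_T.+1 -> set (set Omega))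
    (x : Omega -> 'rV[R]_(\sum_(t < T.+1) n_ t)) :
    Omega -> 'rV[R]_(\sum_(t < T.+1) n_ t) :=
  fun w => \mxrow_(t < T.+1) vcond_exp P (F t) (component x t) w.

Definition epigraph (R : realType) (k : nat) (g : 'rV[R]_k -> \bar R) :
    set ('rV[R]_k * R^o) :=
  [set p | (g p.1 <= (p.2)%:E)%E].

Definition measurable_multifunction (d : measure_display)
    (Omega : measurableType d) (E : topologicalType) (S : Omega -> set E) :
    Prop :=
  forall O : set E, open O -> measurable [set w | S w `&` O !=set0].

Definition normal_integrand (R : realType) (d : measure_display)
    (Omega : measurableType d) (k : nat) (h : 'rV[R]_k -> Omega -> \bar R) :
    Prop :=
  (forall w, closed (epigraph (h^~ w))) /\
  measurable_multifunction (fun w => epigraph (h^~ w)).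

(* Convexity of an extended-real-valued function is convexity of its
   epigraph. *)
Definition convex_normal_integrand (R : realType) (d : measure_display)
    (Omega : measurableType d) (k : nat) (h : 'rV[R]_k -> Omega -> \bar R) :
    Prop :=
  normal_integrand h /\
  forall w, @convex_set R ('rV[R]_k * R^o)%type (epigraph (h^~ w)).

(* The library integral of a function whose positive and negative parts both
   have infinite integral is -oo; here it has to be +oo. *)
Definition Eext (R : realType) (d : measure_display)
    (Omega : measurableType d) (P : probability Omega R)
    (f : Omega -> \bar R) : \bar R :=
  (if \int[P]_w (f^\+ w) < +oo then \int[P]_w (f w) else +oo)%E.

Definition Eint (R : realType) (d : measure_display)
    (Omega : measurableType d) (P : probability Omega R) (k : nat)
    (h : 'rV[R]_k -> Omega -> \bar R) (x : Omega -> 'rV[R]_k) : \bar R :=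
  Eext P (fun w => h (x w) w).

Definition domE (R : realType) (d : measure_display)
    (Omega : measurableType d) (P : probability Omega R) (k : nat)
    (h : 'rV[R]_k -> Omega -> \bar R) : set (Omega -> 'rV[R]_k) :=
  [set x | L0 R Omega k x /\ (Eint P h x < +oo)%E].

Definition proper_on (R : realType) (V : Type) (f : V -> \bar R) (S : set V) :
    Prop :=
  (forall z, S z -> (-oo < f z)%E) /\ exists2 z, S z & (f z < +oo)%E.

Definition aff (R : realType) (V : lmodType R) (S : set V) : set V :=
  [set v | exists (m : nat) (a : 'I_m -> R) (z : 'I_m -> V),
     [/\ forall i, S (z i), \sum_i a i = 1 & v = \sum_i a i *: z i]].

Definition Linfty_nbhs (R : realType) (d : measure_display)
    (Omega : measurableType d) (P : probability Omega R) (k : nat)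
    (x : Omega -> 'rV[R]_k) : set_system (Omega -> 'rV[R]_k) :=
  filter_from [set e : R | 0 < e]
    (fun e => [set y | (Lpnorm P +oo (y - x)%R < e%:E)%E]).

Definition continuous_rel_at (R : realType) (d : measure_display)
    (Omega : measurableType d) (P : probability Omega R) (k : nat)
    (f : (Omega -> 'rV[R]_k) -> \bar R) (A : set (Omega -> 'rV[R]_k))
    (x : Omega -> 'rV[R]_k) : Prop :=
  f y @[y --> within A (Linfty_nbhs P x)] --> f x.

Definition value_function (R : realType) (d : measure_display)
    (Omega : measurableType d) (P : probability Omega R) (T : nat)
    (n_ : 'I_T.+1 -> nat) (F : 'I_T.+1 -> set (set Omega))
    (h : 'rV[R]_(\sum_(t < T.+1) n_ t) -> Omega -> \bar R)
    (z : Omega -> 'rV[R]_(\sum_(t < T.+1) n_ t)) : \bar R :=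
  ereal_inf [set Eint P h (x + z) | x in adapted R n_ F].

Definition dotmul (R : realType) (k : nat) (u v : 'rV[R]_k) : R :=
  \sum_i u ord0 i * v ord0 i.

Definition shadow_price (R : realType) (d : measure_display)
    (Omega : measurableType d) (P : probability Omega R) (T : nat)
    (n_ : 'I_T.+1 -> nat) (F : 'I_T.+1 -> set (set Omega))
    (h : 'rV[R]_(\sum_(t < T.+1) n_ t) -> Omega -> \bar R)
    (v : Omega -> 'rV[R]_(\sum_(t < T.+1) n_ t)) : Prop :=
  L1 P _ v /\
  forall z, Linfty P _ z ->
    (value_function P F h 0%R + 'E_P[(fun w => dotmul (z w) (v w))]
       <= value_function P F h z)%E.

(* Main.v *)
(* Let [c] be the optimal value. By (3) and convexity the optimal value is bounded
   below near the origin relative to the affine hull, and by (2) this persists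
   modulo all of N^oo; the Hahn-Banach theorem thus gives a bounded linear
   functional [l] on L^oo that vanishes on N^oo and satisfies [c + l <= Eh]. Its
   components are turned into elements of L^1 one stage at a time, starting from
   the last: the Yosida-Hewitt decomposition [l = v + ls] and the decomposability
   of L^oo give [Eh z >= c + E(z.v) + ls z'] for all [z], [z'] in the domain, and
   (1) allows [z'] to be taken with [z'^t = E_t z^t]. In the resulting functional
   the singular part acts on the stage-[t] component only through [E_t z_t], where
   it agrees with [- E(E_t z_t . v_t)] because [l] vanishes on N^oo. Finally, the
   inequality [Eh z >= c + E(z.v)] passes from L^oo to unbounded adapted strategies
   by truncation, since [E(x.v) = 0] for adapted [x] as soon as [(x.v)^+] is
   integrable. *)
Require Import Defs.
From HB Require Import structures.
From mathcomp Require Import all_boot all_order all_algebra.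
From mathcomp Require Import all_classical all_reals all_analysis.
From mathcomp Require Import measurable_realfun ess_sup_inf lra ring.

Set Implicit Arguments.
Unset Strict Implicit.
Unset Printing Implicit Defensive.

Import Order.TTheory GRing.Theory Num.Theory.
Import numFieldNormedType.Exports.

Local Open Scope classical_set_scope.
Local Open Scope ring_scope.

(** The singular part of [l] cannot simply be dropped: [l] vanishes on N^oo, but its countably
    additive part alone need not, so [E(x.v) = 0] would be lost. Each stage therefore trades the
    singular part for a correction: the density [v'_t] becomes [v'_t - E_t v'_t], which is
    orthogonal to the bounded F_t-measurable functions. The backward order is dictated by (1), which
    controls the components up to [t] simultaneously and says nothing about later ones; these must
    already be represented by densities when stage [t] is treated. The constant
    [K = C (M - c) / eps] of the Hahn-Banach step has [C = 2 |rho|], where the factor 2 is the price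
    of replacing the distance from the adapted projection by the distance from N^oo, and [M] is the
    upper bound that (3) gives on a ball of radius [eps]. Random vectors are functions rather than
    classes, so L^oo is handled as a set, functionals are controlled by almost sure bounds, and the
    singular part is described by its smallness on large sets rather than as an element of a dual
    space. *)

(** * Hahn-Banach theorem for a sublinear functional on a linear set *)

Section hahn_banach.
Context (R : realType) (V : lmodType R) (W : set V).
Hypothesis WD : forall x y, W x -> W y -> W (x + y).
Hypothesis WZ : forall a x, W x -> W (a *: x).

(** Relative to a set [W], because L^oo is a set of functions here and not a type. The inequality
    for positive scalars is one-sided; the scalar [a^-1] gives the reverse one. *)
Definition sublinear_on (p : V -> R) :=
  (forall a x, 0 < a -> W x -> p (a *: x) <= a * p x) /\
  (forall x y, W x -> W y -> p (x + y) <= p x + p y).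

Definition linear_on (l : V -> R) :=
  forall a x y, W x -> W y -> l (a *: x + y) = a * l x + l y.

Let WN x : W x -> W (- x).
Proof. by move=> Wx; rewrite -scaleN1r; exact: WZ. Qed.

Lemma sublinear_on_ge_oppr p x : sublinear_on p -> W x -> - p (- x) <= p x.
Proof.
move=> [_ pD] Wx; rewrite lerNl -subr_ge0 opprK.
have W0 : W 0 by rewrite -(scale0r x); exact: WZ.
have p0 : 0 <= p 0 by have := pD _ _ W0 W0; rewrite addr0; lra.
by have := pD _ _ (WN Wx) Wx; rewrite addNr; lra.
Qed.

Lemma linear_on_additive p : sublinear_on p ->
  (forall x y, W x -> W y -> p x + p y <= p (x + y)) -> linear_on p.
Proof.
move=> [pZ pD] pD'.
have pDE x y : W x -> W y -> p (x + y) = p x + p y.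
  by move=> Wx Wy; apply/eqP; rewrite eq_le pD//= pD'.
have pZE a x : 0 < a -> W x -> p (a *: x) = a * p x.
  move=> a0 Wx; apply/eqP; rewrite eq_le pZ//=.
  have := @pZ a^-1 (a *: x); rewrite invr_gt0 a0 scalerA mulVf ?gt_eqF// scale1r.
  by move=> /(_ isT (WZ a Wx)); rewrite ler_pdivlMl.
move=> a x y Wx Wy; rewrite pDE//; last exact: WZ.
congr (_ + _).
have W0 : W 0 by rewrite -(scale0r x); exact: WZ.
have p0 : p 0 = 0 by have := pDE _ _ W0 W0; rewrite addr0; lra.
have [a0|a0|->] := ltgtP a 0; [|exact: pZE|by rewrite scale0r mul0r].
have Na0 : 0 < - a by rewrite oppr_gt0.
have := pDE _ _ (WZ a Wx) (WZ (- a) Wx).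
rewrite (pZE _ _ Na0 Wx) scaleNr subrr p0; lra.
Qed.

(* A pointwise minimal sublinear functional [q] is linear, because
   [q_y x = inf_(t > 0) (q (x + t y) - t q y)] is sublinear and below [q]. *)
Theorem hahn_banach_sublinear (p : V -> R) : sublinear_on p ->
  exists2 l, linear_on l & forall x, W x -> l x <= p x.
Proof.
move=> sp.
pose T := {q : V -> R | sublinear_on q /\ forall x, W x -> q x <= p x}.
(* Reversed pointwise order: maximal elements for [le] are minimal functionals. A chain is bounded
   by its pointwise infimum, which is finite by [lbT]. *)
pose le (q q' : T) := `[< forall x, W x -> sval q' x <= sval q x >].
pose p0 : T := exist _ p (conj sp (fun x _ => lexx _)).
have lbT (q : T) x : W x -> - p (- x) <= sval q x.
  move=> Wx; have [sq qp] := svalP q.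
  apply: le_trans (sublinear_on_ge_oppr sq Wx); rewrite lerN2; apply: qp.
  exact: WN.
have [t|r s t /asboolP rs /asboolP st|A Atot|q qmin] := @ZL_preorder T p0 le.
- by apply/asboolP.
- by apply/asboolP => x Wx; exact: le_trans (st x Wx) (rs x Wx).
- have [[q0 Aq0]|A0] := pselect (A !=set0); last first.
    by exists p0 => s As; exfalso; apply: A0; exists s.
  pose t x := inf [set sval q x | q in A].
  have hi x : W x -> has_inf [set sval q x | q in A].
    move=> Wx; split; first by exists (sval q0 x); exists q0.
    by exists (- p (- x)) => _ [q _ <-]; exact: lbT.
  have tle (q : T) x : A q -> W x -> t x <= sval q x.
    move=> Aq Wx; apply: ge_inf; last by exists q.
    by have [] := hi x Wx.
  have let_ x b : W x -> (forall q : T, A q -> b <= sval q x) -> b <= t x.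
    move=> Wx bq; apply: lb_le_inf; first by have [] := hi x Wx.
    by move=> _ [q Aq <-]; exact: bq.
  have st : sublinear_on t.
    split=> [a x a0 Wx|x y Wx Wy].
      rewrite -ler_pdivrMl//; apply: (let_ _ _) => // q Aq; rewrite ler_pdivrMl//.
      apply: le_trans (tle q _ Aq (WZ _ Wx)) _.
      by have [[qZ _] _] := svalP q; exact: qZ.
    rewrite -lerBlDr; apply: (let_ _ _) => // q Aq; rewrite lerBlDr -lerBlDl.
    apply: (let_ _ _) => // q' Aq'; rewrite lerBlDl.
    (* Of two members of the chain the smaller one serves for both arguments. *)
    have [/asboolP qq'|/asboolP qq'] := Atot _ _ Aq Aq'.
      apply: le_trans (tle q' _ Aq' (WD Wx Wy)) _.
      apply: (@le_trans _ _ (sval q' x + sval q' y)).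
        by have [[_ qD] _] := svalP q'; exact: qD.
      by rewrite lerD2r qq'.
    apply: le_trans (tle q _ Aq (WD Wx Wy)) _.
    apply: (@le_trans _ _ (sval q x + sval q y)).
      by have [[_ qD] _] := svalP q; exact: qD.
    by rewrite lerD2l qq'.
  have tp x : W x -> t x <= p x.
    move=> Wx; apply: le_trans (tle q0 _ Aq0 Wx) _.
    by have [_] := svalP q0; exact.
  exists (exist _ t (conj st tp)) => s As; apply/asboolP => x Wx /=.
  exact: tle.
exists (sval q); last by have [_] := svalP q.
have sq : sublinear_on (sval q) by have [] := svalP q.
have [qZ qD] := sq.
apply: (linear_on_additive sq) => x y Wx Wy.
have lbq t z : 0 < t -> W z ->
    - sval q (- z) <= sval q (z + t *: y) - t * sval q y.
  move=> t0 Wz; have := qD _ _ (WD Wz (WZ t Wy)) (WN Wz).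
  rewrite addrAC subrr add0r.
  have := qZ t^-1 (t *: y); rewrite invr_gt0 t0 scalerA mulVf ?gt_eqF// scale1r.
  by move=> /(_ isT (WZ t Wy)); rewrite ler_pdivlMl//; lra.
pose S z := [set sval q (z + t *: y) - t * sval q y | t in [set t | 0 < t]].
pose qy z := inf (S z).
have hi z : W z -> has_inf (S z).
  move=> Wz; split; first by exists (sval q (z + 1 *: y) - 1 * sval q y);
    exists 1 => //=.
  by exists (- sval q (- z)) => _ [t /= t0 <-]; exact: lbq.
have qyle t z : 0 < t -> W z -> qy z <= sval q (z + t *: y) - t * sval q y.
  move=> t0 Wz; apply: ge_inf; last by exists t.
  by have [] := hi z Wz.
have leqy z b : W z ->
    (forall t, 0 < t -> b <= sval q (z + t *: y) - t * sval q y) -> b <= qy z.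
  move=> Wz bq; apply: lb_le_inf; first by have [] := hi z Wz.
  by move=> _ [t t0 <-]; exact: bq.
have sqy : sublinear_on qy.
  split=> [a z a0 Wz|z z' Wz Wz'].
    rewrite -ler_pdivrMl//; apply: (leqy _ _) => // t t0; rewrite ler_pdivrMl//.
    apply: le_trans (qyle (a * t) _ (mulr_gt0 a0 t0) (WZ a Wz)) _.
    rewrite -scalerA -scalerDr mulrBr mulrA lerD2r.
    by apply: qZ => //; apply: WD => //; exact: WZ.
  rewrite -lerBlDr; apply: (leqy _ _) => // t t0; rewrite lerBlDr -lerBlDl.
  apply: (leqy _ _) => // t' t'0; rewrite lerBlDl.
  apply: le_trans (qyle (t + t') _ (addr_gt0 t0 t'0) (WD Wz Wz')) _.
  rewrite scalerDl addrACA mulrDl opprD [leRHS]addrACA lerD2r.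
  by apply: qD => //; apply: WD => //; exact: WZ.
have qyq z : W z -> qy z <= sval q z.
  move=> Wz; apply: le_trans (qyle 1 z ltr01 Wz) _.
  by rewrite scale1r mul1r lerBlDr; exact: qD.
have qyp z : W z -> qy z <= p z.
  by move=> Wz; apply: le_trans (qyq z Wz) _; have [_] := svalP q; exact.
(* Minimality gives [q x <= qy x]; the value [t = 1] in the infimum turns this into superadditivity
   of [q]. *)
have /asboolP/(_ x Wx)/= := qmin (exist _ qy (conj sqy qyp)) (introT (asboolP _) qyq).
move=> /le_trans /(_ (qyle 1 x ltr01 Wx)).
by rewrite scale1r mul1r lerBrDr.
Qed.

End hahn_banach.

(** * Maximum norm and rational approximation of row vectors *)

Section row_vectors.
Context (R : realType) (k : nat).
Implicit Types x : 'rV[R]_k.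

Lemma rV_norm_leP x M : 0 <= M ->
  `|x| <= M <-> forall i, `|x ord0 i| <= M.
Proof.
move=> M0; rewrite {1}/Num.norm /= mx_normrE; split=> [/bigmax_leP[_ xM] i|xM].
  exact: (xM (ord0, i)).
by apply/bigmax_leP; split => // -[i j] _ /=; rewrite (ord1 i).
Qed.

Lemma rV_coord_le_norm x i : `|x ord0 i| <= `|x|.
Proof. by move: i; apply/rV_norm_leP. Qed.

Lemma rV_ballP x y e : ball x e y <-> 0 < e /\ forall i, `|x ord0 i - y ord0 i| < e.
Proof.
split=> [[e0 xy]|[e0 xy]]; first by split => // i; exact: xy.
by split => // i j; rewrite (ord1 i); exact: xy.
Qed.

Lemma rat_rV_dense x e : 0 < e -> exists c : 'rV[rat]_k,
  forall i, `|ratr (c ord0 i) - x ord0 i| < e.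
Proof.
move=> e0.
have /choice[c cP] i : exists q : rat, `|ratr q - x ord0 i| < e.
  have [q] := @rat_in_itvoo R (x ord0 i - e) (x ord0 i + e) ltac:(lra).
  by rewrite in_itv/= => /andP[q1 q2]; exists q; rewrite ltr_norml; lra.
by exists (\row_i c i) => i; rewrite mxE.
Qed.

End row_vectors.

(** * Measurability of compositions with a normal integrand *)

Section normal_integrand_measurable.
Context (R : realType) (d : measure_display) (Omega : measurableType d) (k : nat).
Variable h : 'rV[R]_k -> Omega -> \bar R.

(** The epigraph being closed, it contains [(x w, r)] as soon as it meets arbitrarily small balls
    around that point. Rational centers close to [x w] reduce this to countably many conditions,
    each of which asks the epigraph to meet a fixed open ball. *)
Lemma measurable_sublevel_comp (x : Omega -> 'rV[R]_k) (r : R) :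
  normal_integrand h -> L0 R Omega k x ->
  measurable [set w | (h (x w) w <= r%:E)%E].
Proof.
move=> [hc hm] mx.
pose e (n : nat) : R := n.+1%:R^-1.
pose q (c : 'rV[rat]_k) : 'rV[R]_k * R^o := (map_mx ratr c, r).
pose B (n : nat) (c : 'rV[rat]_k) := \bigcap_(i in [set: 'I_k])
   [set w | `|ratr (c ord0 i) - x w ord0 i| < e n].
pose C (n : nat) (c : 'rV[rat]_k) :=
  [set w | epigraph (h^~ w) `&` ball (q c) (e n) !=set0].
suff -> : [set w | (h (x w) w <= r%:E)%E] =
    \bigcap_n \bigcup_(c : 'rV[rat]_k) (B n c `&` C n c).
  apply: bigcapT_measurable => n; apply: countable_bigcupT_measurable => // c.
  apply: measurableI; last exact/hm/ball_open.
  apply: fin_bigcap_measurable => // i _.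
  have mf : measurable_fun setT
      (fun w => `|ratr (c ord0 i) - x w ord0 i| < e n).
    apply: measurable_fun_ltr => //.
    by apply: measurableT_comp => //; exact: measurable_funB.
  rewrite (_ : [set w | _] =
      setT `&` (fun w => `|ratr (c ord0 i) - x w ord0 i| < e n) @^-1` [set true]).
    exact: mf.
  by rewrite setTI; apply/seteqP; split => w.
apply/seteqP; split => [w /= hw n _|w hw /=].
  have [c cP] := rat_rV_dense (x w) (e := e n) ltac:(by rewrite /e invr_gt0).
  exists c => //; split; first by move=> i _; exact: cP.
  have : (epigraph (h^~ w) `&` ball (q c) (e n)) (x w, r : R^o);
    last by exists (x w, r : R^o).
  split => //; split => /=; last by apply: ballxx; rewrite invr_gt0.
  by apply/rV_ballP; split => [|i]; [rewrite /e invr_gt0|rewrite mxE].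
have : closure (epigraph (h^~ w)) (x w, r : R^o); last first.
  by rewrite -(closure_id _).1//; exact: hc.
move=> A /nbhs_ballP[a /= a0 aA].
have [n na] : exists n, e n < a / 2.
  have a2 : 0 < a / 2 by rewrite divr_gt0.
  have /= [n _ /(_ n (leqnn n))] := near_infty_natSinv_lt (PosNum a2).
  by exists n.
have [c _ [cB [y [hy cy]]]] := hw n I.
exists y; split => //; apply: aA.
rewrite (splitr a); apply: (@ball_triangle _ _ (q c)).
  apply: ball_sym; split => /=; last by apply: ballxx; lra.
  apply/rV_ballP; split => [|i]; first lra.
  by rewrite mxE; apply: lt_trans na; exact: cB.
exact: le_ball (ltW na) _ cy.
Qed.

Lemma measurable_fun_normal_integrand (x : Omega -> 'rV[R]_k) :
  normal_integrand h -> L0 R Omega k x ->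
  measurable_fun [set: Omega] (fun w => h (x w) w).
Proof.
move=> hn mx; apply: (measurability _ (ErealGenOInfty.measurableE R)).
move=> _ [_ [r ->] <-]; rewrite setTI.
rewrite [X in measurable X](_ : _ = ~` [set w | (h (x w) w <= r%:E)%E]).
  by apply: measurableC; exact: measurable_sublevel_comp.
apply/seteqP; split => w /=; rewrite in_itv/= andbT ltNge; first by move/negP.
by move/negP.
Qed.

End normal_integrand_measurable.

(** * Integrals of real functions: exhaustion and absolute continuity *)

Section real_integrals.
Context (R : realType) (d : measure_display) (Omega : measurableType d).
Variable P : probability Omega R.
Implicit Types (f g : Omega -> R) (B C : set Omega).

Local Notation intg f := (P.-integrable [set: Omega] (EFin \o f)).
Local Notation EE f := (\int[P]_w (f w)).

Lemma intg_measurable f : intg f -> measurable_fun setT f.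
Proof. by move=> /measurable_int/measurable_EFinP. Qed.

Lemma intgD f g : intg f -> intg g -> intg (fun w => f w + g w).
Proof. by move=> f1 g1; exact: (integrableD measurableT f1 g1). Qed.

Lemma intgB f g : intg f -> intg g -> intg (fun w => f w - g w).
Proof. by move=> f1 g1; exact: (integrableB measurableT f1 g1). Qed.

Lemma intgZ c f : intg f -> intg (fun w => c * f w).
Proof. by move=> f1; exact: (integrableZl measurableT c f1). Qed.

Lemma intg_sum I (s : seq I) (F : I -> Omega -> R) :
  (forall i, intg (F i)) -> intg (fun w => \sum_(i <- s) F i w).
Proof.
move=> Fi; rewrite (_ : EFin \o _ = fun w => (\sum_(i <- s) (F i w)%:E)%E).
  by apply: integrable_sum => // i _; exact: Fi.
by apply/funext => w /=; rewrite sumEFin.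
Qed.

Lemma intg_cst c : intg (fun=> c).
Proof. exact: (@finite_measure_integrable_cst _ _ _ P setT c measurableT). Qed.

Lemma intg_le_ae f g : measurable_fun setT f ->
  (\forall w \ae P, `|f w| <= g w) -> intg g -> intg f.
Proof.
move=> mf fg /integrableP[mg ig]; apply/integrableP; split.
  exact/measurable_EFinP.
apply: le_lt_trans ig; apply: ae_ge0_le_integral => //.
- exact/measurableT_comp/measurable_EFinP.
- exact: measurableT_comp.
by apply: filterS fg => w fg _ /=; rewrite lee_fin (le_trans fg)// ler_norm.
Qed.

Lemma intgM_bounded f g M : measurable_fun setT f ->
  (\forall w \ae P, `|f w| <= M) -> intg g -> intg (fun w => f w * g w).
Proof.
move=> mf fM ig; have mg := intg_measurable ig.
apply: (@intg_le_ae _ (fun w => M * `|g w|)).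
- exact: measurable_funM.
- by apply: filterS fM => w fM; rewrite normrM ler_wpM2r.
- exact/intgZ/integrable_norm.
Qed.

Lemma intg_indic B f : measurable B -> intg f -> intg (fun w => \1_B w * f w).
Proof.
move=> mB; apply: (@intgM_bounded _ _ 1) => //.
by apply: nearW => w; rewrite indicE; case: (w \in B); rewrite ?normr1 ?normr0.
Qed.

Lemma EED f g : intg f -> intg g -> EE (fun w => f w + g w) = EE f + EE g.
Proof. by move=> f1 g1; rewrite RintegralD. Qed.

Lemma EEB f g : intg f -> intg g -> EE (fun w => f w - g w) = EE f - EE g.
Proof. by move=> f1 g1; rewrite RintegralB. Qed.

Lemma EEZ c f : intg f -> EE (fun w => c * f w) = c * EE f.
Proof. by move=> f1; rewrite RintegralZl. Qed.

Lemma EE0 : EE (fun=> 0) = 0.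
Proof. by rewrite Rintegral_cst ?mul0r. Qed.

Lemma EE_sum I (s : seq I) (F : I -> Omega -> R) :
  (forall i, intg (F i)) ->
  EE (fun w => \sum_(i <- s) F i w) = \sum_(i <- s) EE (F i).
Proof.
move=> Fi; elim: s => [|i s ih].
  by rewrite big_nil; under eq_Rintegral do rewrite big_nil; exact: EE0.
rewrite big_cons -ih; under eq_Rintegral do rewrite big_cons.
by rewrite EED//; exact: intg_sum.
Qed.

Lemma EE_eq_ae f g : measurable_fun setT f -> measurable_fun setT g ->
  (\forall w \ae P, f w = g w) -> EE f = EE g.
Proof.
move=> mf mg fg; congr fine; apply: ae_eq_integral => //; first exact/measurable_EFinP.
  exact/measurable_EFinP.
by apply: filterS fg => w fg _ /=; rewrite fg.
Qed.

Lemma EE_ge0 f : (forall w, 0 <= f w) -> 0 <= EE f.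
Proof. by move=> f0; exact: Rintegral_ge0. Qed.

Lemma EE_ge0_ae f : measurable_fun setT f ->
  (\forall w \ae P, 0 <= f w) -> 0 <= EE f.
Proof.
move=> mf f0; rewrite (@EE_eq_ae _ (fun w => `|f w|)) ?EE_ge0//.
  exact: measurableT_comp.
by apply: filterS f0 => w f0; rewrite ger0_norm.
Qed.

Lemma EE_le_ae f g : intg f -> intg g ->
  (\forall w \ae P, f w <= g w) -> EE f <= EE g.
Proof.
move=> f1 g1 fg; rewrite -subr_ge0 -EEB//; apply: EE_ge0_ae.
  by apply: measurable_funB; exact: intg_measurable.
by apply: filterS fg => w; rewrite subr_ge0.
Qed.

Lemma EE_norm_le f : intg f -> `|EE f| <= EE (fun w => `|f w|).
Proof. by move=> f1; exact: le_normr_Rintegral. Qed.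

Lemma integral_EFinE f : intg f -> (\int[P]_w (f w)%:E)%E = (EE f)%:E.
Proof. by move=> f1; rewrite /Rintegral fineK//; exact: integrable_fin_num. Qed.

Lemma EE_indic_setC B f : measurable B -> intg f ->
  EE (fun w => \1_(~` B) w * f w) = EE f - EE (fun w => \1_B w * f w).
Proof.
move=> mB fi; rewrite -EEB//; last exact: intg_indic.
apply: eq_Rintegral => w _; rewrite !indicE in_setC.
by case: (w \in B) => /=; rewrite ?mul1r ?mul0r ?subrr ?subr0.
Qed.

Lemma EE_indic_cst B : measurable B -> EE (\1_B) = fine (P B).
Proof. by move=> mB; rewrite /Rintegral integral_indic// setIT. Qed.

Section exhaustion.
Variable B : nat -> set Omega.
Hypothesis mB : forall n, measurable (B n).
Hypothesis ndB : forall m n, (m <= n)%N -> B m `<=` B n.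
Hypothesis exB : forall w, exists n, B n w.

Let indic_cvg f w : \1_(B n) w * f w @[n --> \oo] --> f w.
Proof.
have [N BN] := exB w; apply: cvg_near_cst; exists N => // n /= Nn.
by rewrite indicE mem_set ?mul1r//; exact: ndB BN.
Qed.

Lemma EE_exhaust f : intg f -> EE (fun w => \1_(B n) w * f w) @[n --> \oo] --> EE f.
Proof.
move=> fi; apply: (@fine_cvg _ _ \oo).
rewrite fineK; last exact: integrable_fin_num.
apply: (@dominated_cvg _ _ _ _ _ _ _ _ (fun w => `|f w|%:E)) => //.
- move=> n; apply/measurable_EFinP/measurable_funM => //.
  exact: intg_measurable.
- by move=> w _; apply: cvg_EFin; [exact: nearW|exact: indic_cvg].
- exact: integrable_norm.
- move=> n w _ /=; rewrite lee_fin normrM indicE.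
  by case: (w \in _); rewrite ?normr1 ?normr0 ?mul1r ?mul0r.
Qed.

(** Monotone convergence applied to [|f|]. This produces integrability where no integrable majorant
    is known in advance. *)
Lemma intg_exhaust f K : measurable_fun setT f ->
  (forall n, intg (fun w => \1_(B n) w * f w)) ->
  (forall n, EE (fun w => \1_(B n) w * `|f w|) <= K) -> intg f.
Proof.
move=> mf fi fK; apply/integrableP; split; first exact/measurable_EFinP.
have cvgf w : (\1_(B n) w * `|f w|)%:E @[n --> \oo] --> `|f w|%:E.
  by apply: cvg_EFin; [exact: nearW|exact: (@indic_cvg (fun w => `|f w|) w)].
have mg n : measurable_fun setT (fun w => (\1_(B n) w * `|f w|)%:E).
  by apply/measurable_EFinP/measurable_funM => //; exact: measurableT_comp.
have g0 n w : setT w -> (0 <= (\1_(B n) w * `|f w|)%:E)%E.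
  by move=> _; rewrite lee_fin mulr_ge0.
have ndg w : setT w ->
    {homo (fun n => (\1_(B n) w * `|f w|)%:E) : n m / (n <= m)%N >-> (n <= m)%E}.
  move=> _ m n mn; rewrite lee_fin ler_wpM2r// !indicE ler_nat.
  have [|] := boolP (w \in B m) => // /set_mem Bm.
  by rewrite mem_set//; exact: ndB Bm.
have cg : (\int[P]_w (\1_(B n) w * `|f w|)%:E)%E @[n --> \oo] -->
    (\int[P]_w `|f w|%:E)%E.
  have := @cvg_monotone_convergence _ _ _ P _ measurableT _ mg g0 ndg.
  congr (_ --> _); apply: eq_integral => w _.
  by apply: cvg_lim => //; exact: cvgf.
apply: (@le_lt_trans _ _ K%:E); last exact: ltry.
rewrite -(cvg_lim _ cg)//; apply: lime_le; first by apply/cvg_ex; eexists; exact: cg.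
apply: nearW => n; rewrite integral_EFinE ?lee_fin//.
have := fi n => /integrable_norm; apply: eq_integrable => // w _ /=.
by rewrite normrM ger0_norm.
Qed.

End exhaustion.

(** On [B n] the function is at most [n], and for a suitable [n] the integral of [|f|] off [B n] is
    at most [e / 2]; the integral over [C] is then at most [n.+1 * P C + e / 2]. The successor keeps
    the denominator of [r] positive. *)
Lemma EE_abs_continuous f e : intg f -> 0 < e ->
  exists2 r, 0 < r & forall C, measurable C -> fine (P C) <= r ->
    `|EE (fun w => \1_C w * f w)| <= e.
Proof.
move=> fi e0; have mf := intg_measurable fi.
pose B n := [set w | `|f w| <= n%:R].
have mB n : measurable (B n).
  rewrite -[B n]setTI; have -> : B n = (fun w => `|f w| <= n%:R) @^-1` [set true].
    by apply/seteqP; split => w.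
  by apply: measurable_fun_ler => //; exact: measurableT_comp.
have ndB m n : (m <= n)%N -> B m `<=` B n.
  by move=> mn w /= /le_trans; apply; rewrite ler_nat.
have exB w : exists n, B n w.
  by exists (Num.bound `|f w|); rewrite /B/= ltW// (le_lt_trans _ (archi_boundP _)).
have fn := integrable_norm fi.
have cB := @EE_exhaust B mB ndB exB _ fn.
have [n _ /(_ n (leqnn n)) /= Hn] := (cvgrPdist_le _ _).1 cB (e / 2) ltac:(lra).
have n1 : 0 < n.+1%:R :> R by [].
exists (e / 2 / n.+1%:R) => [|C mC PC]; first by rewrite !divr_gt0.
have iC := intg_indic mC fi.
apply: le_trans (EE_norm_le iC) _.
apply: (@le_trans _ _ (EE (fun w => n.+1%:R * \1_C w + \1_(~` B n) w * `|f w|))).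
  apply: EE_le_ae; first exact: integrable_norm iC.
    apply: intgD; last by apply: intg_indic => //; exact: measurableC.
    apply: intgZ; exact: (integrable_indic P mC).
  apply: nearW => w; rewrite normrM (ger0_norm (_ : 0 <= \1_C w))//.
  rewrite !indicE in_setC.
  have [/set_mem/= Bw|_] := boolP (w \in B n); rewrite /= ?mul0r ?mul1r ?addr0.
    rewrite mulrC ler_wpM2r// (le_trans Bw)// ler_nat//.
  case: (w \in C); rewrite ?mul1r ?mul0r ?mulr1 ?mulr0 ?add0r//.
  by rewrite lerDr.
rewrite EED; last 2 first.
- by apply: intgZ; exact: (integrable_indic P mC).
- by apply: intg_indic => //; exact: measurableC.
rewrite EEZ; last exact: (integrable_indic P mC).
rewrite EE_indic_cst// (splitr e) lerD//.
  by rewrite -ler_pdivlMl// mulrC.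
by rewrite EE_indic_setC//; apply: le_trans (ler_norm _) _.
Qed.

End real_integrals.

(** * Essentially bounded vectors and bounded functionals *)

Section Linfty_functions.
Context (R : realType) (d : measure_display) (Omega : measurableType d).
Variables (P : probability Omega R) (k : nat).
Implicit Types (x y z v : Omega -> 'rV[R]_k) (B : set Omega) (M : R).

Local Notation intg f := (P.-integrable [set: Omega] (EFin \o f)).
Local Notation EE f := (\int[P]_w (f w)).

Lemma Lpnorm_infty_leP x M :
  (Lpnorm P +oo x <= M%:E)%E <-> \forall w \ae P, `|x w| <= M.
Proof.
rewrite /Lpnorm unlock /=.
(* The norm with exponent +oo is the essential supremum on a space of positive mass, and 0
   otherwise. *)
rewrite ifT; last first.
  by rewrite (_ : _ setT = 1%E) ?lte01//; exact: probability_setT.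
split=> [/ess_supP|xM]; last apply/ess_supP.
  by apply: filterS => w /=; rewrite normr_id lee_fin.
by apply: filterS xM => w /=; rewrite normr_id lee_fin.
Qed.

Lemma LinftyP x :
  Linfty P k x <-> L0 R Omega k x /\ exists M, \forall w \ae P, `|x w| <= M.
Proof.
split=> -[mx xM]; split => //.
  exists (fine (Lpnorm P +oo x)); apply/Lpnorm_infty_leP; rewrite fineK//.
  by rewrite ge0_fin_numE//; exact: Lnorm_ge0.
case: xM => M /Lpnorm_infty_leP/le_lt_trans; apply; exact: ltry.
Qed.

Lemma L0_lin a x y : L0 R Omega k x -> L0 R Omega k y -> L0 R Omega k (a *: x + y).
Proof.
move=> mx my i; rewrite (_ : (fun w => _) = fun w => a * x w ord0 i + y w ord0 i).
  by apply: measurable_funD => //; exact: measurable_funM.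
by apply/funext => w; rewrite !fctE !mxE.
Qed.

Lemma L0D x y : L0 R Omega k x -> L0 R Omega k y -> L0 R Omega k (x + y).
Proof. by move=> mx my; rewrite -[x]scale1r; exact: L0_lin. Qed.

Lemma Linfty_lin a x y : Linfty P k x -> Linfty P k y -> Linfty P k (a *: x + y).
Proof.
move=> /LinftyP[mx [M xM]] /LinftyP[my [N yN]]; apply/LinftyP; split.
  exact: L0_lin.
exists (`|a| * M + N); apply: filterS2 xM yN => w xM yN; rewrite !fctE.
by apply: le_trans (ler_normD _ _) _; rewrite lerD// normrZ ler_wpM2l.
Qed.

Lemma Linfty0 : Linfty P k 0.
Proof.
apply/LinftyP; split.
  by move=> i; rewrite (_ : (fun w => _) = cst 0)//; apply/funext => w; rewrite mxE.
by exists 0; apply: nearW => w; rewrite normr0.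
Qed.

Lemma LinftyZ a x : Linfty P k x -> Linfty P k (a *: x).
Proof. by move=> xi; rewrite -[_ *: _]addr0; apply: Linfty_lin => //;
  exact: Linfty0. Qed.

Lemma LinftyD x y : Linfty P k x -> Linfty P k y -> Linfty P k (x + y).
Proof. by move=> xi yi; rewrite -[x]scale1r; exact: Linfty_lin. Qed.

Lemma LinftyB x y : Linfty P k x -> Linfty P k y -> Linfty P k (x - y).
Proof. by move=> xi yi; rewrite addrC -scaleN1r; exact: Linfty_lin. Qed.

Definition restr B x : Omega -> 'rV[R]_k := fun w => \1_B w *: x w.

Lemma restr_setC B x : restr B x + restr (~` B) x = x.
Proof.
apply/funext => w; rewrite /restr !fctE !indicE in_setC.
by case: (w \in B) => /=; rewrite ?scale1r ?scale0r ?add0r ?addr0.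
Qed.

Lemma norm_restr_le B x w : `|restr B x w| <= `|x w|.
Proof.
rewrite /restr normrZ indicE; case: (w \in B).
  by rewrite normr1 mul1r.
by rewrite normr0 mul0r.
Qed.

Lemma L0_restr B x : measurable B -> L0 R Omega k x -> L0 R Omega k (restr B x).
Proof.
move=> mB mx i.
rewrite (_ : (fun w => _) = fun w => \1_B w * x w ord0 i).
  exact: measurable_funM.
by apply/funext => w; rewrite /restr !mxE.
Qed.

Lemma Linfty_restr B x : measurable B -> Linfty P k x -> Linfty P k (restr B x).
Proof.
move=> mB /LinftyP[mx [M xM]]; apply/LinftyP; split; first exact: L0_restr.
exists M; apply: filterS xM => w; apply: le_trans; exact: norm_restr_le.
Qed.

Lemma measurable_rV_norm x : L0 R Omega k x -> measurable_fun setT (fun w => `|x w|).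
Proof.
move=> mx; rewrite (_ : (fun w => _) =
    fun w => \big[Num.max/0]_(ij : 'I_1 * 'I_k) `|x w ij.1 ij.2|); last first.
  by apply/funext => w; rewrite {1}/Num.norm /= mx_normrE.
elim: (index_enum _) => [|ij s ih].
  by rewrite (_ : (fun w => _) = cst 0)//; apply/funext => w; rewrite big_nil.
rewrite (_ : (fun w => _) = fun w => Num.max `|x w ij.1 ij.2|
    (\big[Num.max/0]_(j <- s) `|x w j.1 j.2|)); last first.
  by apply/funext => w; rewrite big_cons.
by apply: measurable_maxr => //; apply: measurableT_comp => //;
  rewrite (ord1 ij.1); exact: mx.
Qed.

Definition intg_vec v := forall i, intg (fun w => v w ord0 i).

Lemma intg_vec_L1 v : intg_vec v -> L1 P k v.
Proof.
move=> vi; have mv : L0 R Omega k v by move=> i; exact: intg_measurable.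
split => //; rewrite /Lpnorm Lnorm1.
have : intg (fun w => \sum_i `|v w ord0 i|).
  by apply: intg_sum => i; exact: integrable_norm (vi i).
move=> /integrableP[_]; apply: le_lt_trans; apply: ge0_le_integral => //.
- by apply: measurableT_comp => //; exact/measurable_EFinP/measurable_rV_norm.
- apply: measurableT_comp => //; apply/measurable_EFinP.
  by apply: measurable_sum => i; exact: measurableT_comp.
move=> w _ /=; rewrite normr_id lee_fin ger0_norm ?sumr_ge0//.
apply/rV_norm_leP => [|i]; first exact: sumr_ge0.
by rewrite (bigD1 i)//= lerDl sumr_ge0.
Qed.

Lemma dotmul_lin a x y v w :
  dotmul ((a *: x + y) w) (v w) = a * dotmul (x w) (v w) + dotmul (y w) (v w).
Proof.
rewrite /dotmul mulr_sumr -big_split; apply: eq_bigr => i _.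
by rewrite !fctE !mxE mulrDl mulrA.
Qed.

Lemma dotmul_restr B x v w : dotmul (restr B x w) (v w) = \1_B w * dotmul (x w) (v w).
Proof.
by rewrite /dotmul mulr_sumr; apply: eq_bigr => i _; rewrite /restr mxE mulrA.
Qed.

Lemma intg_dotmul z v : Linfty P k z -> intg_vec v ->
  intg (fun w => dotmul (z w) (v w)).
Proof.
move=> /LinftyP[mz [M zM]] vi; apply: intg_sum => i.
apply: (@intgM_bounded _ _ _ P _ _ M) => //.
by apply: filterS zM => w; apply: le_trans; exact: rV_coord_le_norm.
Qed.

Lemma EE_dotmul_lin v : intg_vec v ->
  linear_on (Linfty P k) (fun z => EE (fun w => dotmul (z w) (v w))).
Proof.
move=> vi a x y xi yi; under eq_Rintegral do rewrite dotmul_lin.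
by rewrite EED ?EEZ//; [exact: intg_dotmul|apply: intgZ|]; exact: intg_dotmul.
Qed.

(** Continuity is phrased with almost sure bounds [M], which keeps the extended-valued norm out of
    the estimates. As functions and not classes are acted upon, the case [M = 0] is also what makes
    [l] respect almost sure equality. *)
Definition bounded_functional (l : (Omega -> 'rV[R]_k) -> R) :=
  linear_on (Linfty P k) l /\
  exists2 K, 0 <= K & forall z M, Linfty P k z ->
    (\forall w \ae P, `|z w| <= M) -> `|l z| <= K * M.

(** The space has mass one, so the almost sure filter is proper and the bound holds at some
    point. *)
Lemma ae_bound_ge0 z M : (\forall w \ae P, `|z w| <= M) -> 0 <= M.
Proof.
move=> zM; have : (0 < P setT)%E by rewrite (probability_setT P) lte01.
move=> /ae_properfilter_algebraOfSetsType Pf.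
by have [w] := filter_ex zM; exact: le_trans.
Qed.

Lemma EE_dotmul_bounded v : intg_vec v ->
  bounded_functional (fun z => EE (fun w => dotmul (z w) (v w))).
Proof.
move=> vi; split; first exact: EE_dotmul_lin.
have iv : intg (fun w => \sum_i `|v w ord0 i|).
  by apply: intg_sum => i; exact: integrable_norm (vi i).
exists (EE (fun w => \sum_i `|v w ord0 i|)).
  by apply: EE_ge0 => w; exact: sumr_ge0.
move=> z M zi zM; have M0 := ae_bound_ge0 zM.
have idz := intg_dotmul zi vi.
apply: le_trans (EE_norm_le idz) _; rewrite mulrC -EEZ//.
apply: EE_le_ae; [exact: integrable_norm idz|exact: intgZ|].
apply: filterS zM => w zM; rewrite mulr_sumr.
apply: le_trans (ler_norm_sum _ _ _) _; apply: ler_sum => i _.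
by rewrite normrM ler_wpM2r// (le_trans (rV_coord_le_norm _ _)).
Qed.

Section bounded_functional_theory.
Variable l : (Omega -> 'rV[R]_k) -> R.
Hypothesis lb : bounded_functional l.

Lemma bfD x y : Linfty P k x -> Linfty P k y -> l (x + y) = l x + l y.
Proof. by move=> xi yi; rewrite -[in LHS](scale1r x) lb.1 // mul1r. Qed.

Lemma bf0 : l 0 = 0.
Proof. by have := bfD Linfty0 Linfty0; rewrite addr0; lra. Qed.

Lemma bfB x y : Linfty P k x -> Linfty P k y -> l (x - y) = l x - l y.
Proof.
by move=> xi yi; rewrite addrC -scaleN1r lb.1// mulN1r addrC.
Qed.

Lemma bf_eq_ae x y : Linfty P k x -> Linfty P k y ->
  (\forall w \ae P, x w = y w) -> l x = l y.
Proof.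
move=> xi yi xy; apply/eqP; rewrite -subr_eq0 -bfB// -normr_le0.
have [K K0 lK] := lb.2.
rewrite -(mulr0 K); apply: lK; first exact: LinftyB.
by apply: filterS xy => w xy; rewrite !fctE xy subrr normr0.
Qed.

End bounded_functional_theory.

Lemma bounded_functional_add l1 l2 : bounded_functional l1 ->
  bounded_functional l2 -> bounded_functional (fun z => l1 z + l2 z).
Proof.
move=> [l1l [K1 K10 l1K]] [l2l [K2 K20 l2K]]; split.
  by move=> a x y xi yi; rewrite l1l// l2l//; ring.
exists (K1 + K2) => [|z M zi zM]; first exact: addr_ge0.
apply: le_trans (ler_normD _ _) _.
by rewrite mulrDl lerD ?l1K ?l2K.
Qed.

Lemma bounded_functional_opp l1 : bounded_functional l1 ->
  bounded_functional (fun z => - l1 z).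
Proof.
move=> [l1l [K1 K10 l1K]]; split.
  by move=> a x y xi yi; rewrite l1l//; ring.
by exists K1 => // z M zi zM; rewrite normrN l1K.
Qed.

End Linfty_functions.

(** * Domain of the integral functional, its convexity and decomposability *)

Section integrands.
Context (R : realType) (d : measure_display) (Omega : measurableType d).
Variables (P : probability Omega R) (k : nat).
Variable h : 'rV[R]_k -> Omega -> \bar R.
Hypothesis hh : convex_normal_integrand h.
Hypothesis h_proper : proper_on (Eint P h) (Linfty P k).
Implicit Types (x y z : Omega -> 'rV[R]_k) (B : set Omega).

Local Notation intg f := (P.-integrable [set: Omega] (EFin \o f)).
Local Notation EE f := (\int[P]_w (f w)).
Local Notation hv z := (fun w => h (z w) w).
Local Notation D := (domE P h `&` Linfty P k).

(** [fine] sends infinite values to 0; for [z] in [D] they occur only on a null set, so [EE (hr z)]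
    is then the value of [Eint]. *)
Definition hr z : Omega -> R := fun w => fine (h (z w) w).

Lemma measurable_hv z : L0 R Omega k z -> measurable_fun setT (hv z).
Proof. by move=> mz; apply: measurable_fun_normal_integrand => //; exact: hh.1. Qed.

Lemma integral_real_ae (f : Omega -> \bar R) (g : Omega -> R) :
  measurable_fun setT f -> (\forall w \ae P, f w = (g w)%:E) -> intg g ->
  P.-integrable setT f /\ (\int[P]_w f w = (EE g)%:E)%E.
Proof.
move=> mf fg gi; have mg := measurable_int _ gi.
have fgi : ae_eq P setT f (EFin \o g) by apply: filterS fg => w + _.
split; last by rewrite -integral_EFinE//; exact: ae_eq_integral.
apply/integrableP; split => //; move/integrableP : gi => [_]; apply: le_lt_trans.
apply: ae_ge0_le_integral => //; [exact: measurableT_comp|exact: measurableT_comp|].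
by apply: filterS fg => w -> _.
Qed.

Lemma integrable_Eint z : P.-integrable setT (hv z) ->
  [/\ Eint P h z = (EE (hr z))%:E, intg (hr z) &
      \forall w \ae P, h (z w) w = (hr z w)%:E].
Proof.
move=> ih.
have hfin : \forall w \ae P, h (z w) w = (hr z w)%:E.
  by apply: filterS (integrable_ae measurableT ih) => w /(_ I) hf; rewrite fineK.
have mr : measurable_fun setT (hr z).
  by apply: measurableT_comp => //; exact: measurable_int ih.
have ir : intg (hr z).
  apply/integrableP; split; first exact/measurable_EFinP.
  move/integrableP : (ih) => [_]; apply: le_lt_trans.
  apply: ae_ge0_le_integral => //; first exact/measurableT_comp/measurable_EFinP.
    by apply: measurableT_comp => //; exact: measurable_int ih.
  by apply: filterS hfin => w -> _.
split => //; rewrite /Eint /Eext integral_funepos_lt_pinfty//.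
have [] := integral_real_ae (measurable_int _ ih) hfin ir.
by [].
Qed.

(** A value below +oo makes the positive part integrable by the convention in [Eext]; a negative
    part with infinite integral would then force the value -oo. *)
Lemma Eint_lty_integrable z : L0 R Omega k z ->
  (Eint P h z < +oo)%E -> (-oo < Eint P h z)%E -> P.-integrable setT (hv z).
Proof.
move=> mz; rewrite /Eint /Eext; case: ifPn => // pfin _.
have mh := measurable_hv mz.
rewrite integralE => nfin.
apply/integrableP; split => //.
rewrite (_ : (fun w => _) = (fun w => (hv z)^\+ w + (hv z)^\- w)%E); last first.
  by apply/funext => w; rewrite -[LHS]/((abse \o hv z) w) fune_abse.
rewrite ge0_integralD//; [|exact: measurable_funepos|exact: measurable_funeneg].
rewrite lte_add_pinfty// ltey; apply/negP => /eqP nE; move: nfin.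
by rewrite nE; case: (\int[P]_w _)%E pfin.
Qed.

Lemma D_integrable z : D z -> P.-integrable setT (hv z).
Proof.
by move=> [[mz zfin] zi]; apply: Eint_lty_integrable => //; exact: h_proper.1.
Qed.

Lemma integrable_D z : Linfty P k z -> P.-integrable setT (hv z) -> D z.
Proof.
move=> zi ih; split => //; split; first by have [] := (LinftyP P z).1 zi.
by have [-> _ _] := integrable_Eint ih; exact: ltry.
Qed.

Lemma D_Eint z : D z -> Eint P h z = (EE (hr z))%:E.
Proof. by move=> /D_integrable /integrable_Eint[]. Qed.

Lemma D_intg z : D z -> intg (hr z).
Proof. by move=> /D_integrable /integrable_Eint[]. Qed.

Lemma D_ae z : D z -> \forall w \ae P, h (z w) w = (hr z w)%:E.
Proof. by move=> /D_integrable /integrable_Eint[]. Qed.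

Lemma integrand_convex w (u u' : 'rV[R]_k) (r r' a : R) : 0 <= a <= 1 ->
  (h u w <= r%:E)%E -> (h u' w <= r'%:E)%E ->
  (h (a *: u + (1 - a) *: u') w <= (a * r + (1 - a) * r')%:E)%E.
Proof.
move=> /andP[a0 a1] ur ur'; have := hh.2 w.
move=> /(_ (u, r : R^o) (u', r' : R^o) (Itv01 a0 a1)).
by rewrite !inE; exact.
Qed.

(** Pointwise convexity bounds [h y] above by the integrable [g], so [Eint] is below +oo at [y];
    properness on L^oo excludes -oo, and integrability follows. *)
Lemma D_convex z z' a : D z -> D z' -> 0 <= a <= 1 ->
  D (a *: z + (1 - a) *: z') /\
  EE (hr (a *: z + (1 - a) *: z')) <= a * EE (hr z) + (1 - a) * EE (hr z').
Proof.
move=> Dz Dz' a01; set y := a *: z + _.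
have yi : Linfty P k y by apply: Linfty_lin Dz.2 _; exact: LinftyZ Dz'.2.
have my : measurable_fun setT (hv y) by apply/measurable_hv;
  have [] := (LinftyP P y).1 yi.
pose g w := a * hr z w + (1 - a) * hr z' w.
have gi : intg g by apply: intgD; apply: intgZ; exact: D_intg.
have yg : \forall w \ae P, (h (y w) w <= (g w)%:E)%E.
  apply: filterS2 (D_ae Dz) (D_ae Dz') => w zw z'w.
  by rewrite /y !fctE; apply: integrand_convex => //; rewrite ?zw ?z'w.
have pfin : (\int[P]_w ((hv y)^\+ w) < +oo)%E.
  move/integrableP : (gi) => [_]; apply: le_lt_trans.
  apply: ae_ge0_le_integral => //; first exact: measurable_funepos.
    by apply: measurableT_comp => //; exact: measurable_int gi.
  apply: filterS yg => w yg _; rewrite funeposE ge_max abse_ge0 andbT.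
  by apply: le_trans yg _; exact: lee_abs.
have iy : P.-integrable setT (hv y).
  apply: Eint_lty_integrable; [by have [] := (LinftyP P y).1 yi| |exact: h_proper.1].
  rewrite /Eint /Eext pfin integralE.
  have n0 : (0 <= \int[P]_w (hv y)^\- w)%E by exact: integral_ge0.
  move: pfin n0; case: (\int[P]_w (hv y)^\+ w)%E => [r| |];
    by case: (\int[P]_w (hv y)^\- w)%E => [s| |] //= _ _; rewrite -EFinB ltry.
have Dy := integrable_D yi iy; split => //.
rewrite -!EEZ; [|exact: D_intg|exact: D_intg].
rewrite -EED; [|by apply: intgZ; exact: D_intg|by apply: intgZ; exact: D_intg].
apply: EE_le_ae => //; first exact: D_intg.
by apply: filterS2 yg (D_ae Dy) => w + yE; rewrite yE lee_fin.
Qed.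

(** Pasting of [z] on [B] with [z'] off [B]. L^oo is stable under it, and as the integrand acts
    pointwise the expectation splits along [B]. *)
Definition mix B z z' : Omega -> 'rV[R]_k := restr B z + restr (~` B) z'.

Lemma hr_mix B z z' w :
  hr (mix B z z') w = \1_B w * hr z w + \1_(~` B) w * hr z' w.
Proof.
rewrite /hr /mix !fctE /restr !indicE in_setC.
by case: (w \in B) => /=;
  rewrite ?scale1r ?scale0r ?addr0 ?add0r ?mul1r ?mul0r ?addr0 ?add0r.
Qed.

Lemma hv_mix_ae B z z' :
  (\forall w \ae P, h (z w) w = (hr z w)%:E) ->
  (\forall w \ae P, h (z' w) w = (hr z' w)%:E) ->
  \forall w \ae P, h (mix B z z' w) w = (hr (mix B z z') w)%:E.
Proof.
apply: filterS2 => w zw z'w; rewrite /hr /mix !fctE /restr !indicE in_setC.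
by case: (w \in B) => /=; rewrite ?scale1r ?scale0r ?addr0 ?add0r ?zw ?z'w.
Qed.

(** Here [z] may be unbounded off [B], as needed when an unbounded strategy is cut down to a set on
    which it is bounded. *)
Lemma D_mix_gen B z z' : measurable B -> L0 R Omega k z -> D z' ->
  Linfty P k (restr B z) ->
  (\forall w \ae P, h (z w) w = (hr z w)%:E) ->
  intg (fun w => \1_B w * hr z w) ->
  D (mix B z z') /\
  EE (hr (mix B z z')) =
    EE (fun w => \1_B w * hr z w) + EE (fun w => \1_(~` B) w * hr z' w).
Proof.
move=> mB mz Dz' zi zae iz.
have iz' := intg_indic (measurableC mB) (D_intg Dz').
have mixi : Linfty P k (mix B z z').
  by apply: LinftyD zi _; apply: Linfty_restr Dz'.2; exact: measurableC.
have mixE : hr (mix B z z') = fun w => \1_B w * hr z w + \1_(~` B) w * hr z' w.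
  by apply/funext => w; exact: hr_mix.
have ih : P.-integrable setT (hv (mix B z z')).
  apply: (integral_real_ae _ (hv_mix_ae B zae (D_ae Dz')) _).1.
    by apply: measurable_hv; have [] := (LinftyP P _).1 mixi.
  by rewrite mixE; exact: intgD.
split; first exact: integrable_D.
by rewrite mixE EED.
Qed.

Lemma D_mix B z z' : measurable B -> D z -> D z' ->
  D (mix B z z') /\
  EE (hr (mix B z z')) =
    EE (fun w => \1_B w * hr z w) + EE (fun w => \1_(~` B) w * hr z' w).
Proof.
move=> mB Dz Dz'; apply: D_mix_gen => //.
- by have [] := (LinftyP P z).1 Dz.2.
- exact: Linfty_restr Dz.2.
- exact: D_ae.
- by apply: intg_indic => //; exact: D_intg.
Qed.

End integrands.

(** * Uniform approximation by step functions with equal steps *)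

Section uniform_approximation.
Context (R : realType).

(** The sum is the integer part of [y], written as the number of thresholds passed. *)
Lemma count_steps (m : nat) (y : R) : 0 <= y -> y <= m%:R ->
  \sum_(i < m) (i.+1%:R <= y)%R%:R <= y <= \sum_(i < m) (i.+1%:R <= y)%R%:R + 1.
Proof.
elim: m => [|m ih] y0 ym.
  by rewrite big_ord0 add0r y0 (le_trans ym).
rewrite big_ord_recr /=; have [yLm|mLy] := leP y m%:R.
  have -> : (m.+1%:R <= y) = false.
    by apply/negbTE; rewrite -ltNge (le_lt_trans yLm)// ltr_nat.
  by rewrite addr0; exact: ih.
have -> : \sum_(i < m) (i.+1%:R <= y)%R%:R = m%:R :> R.
  rewrite (eq_bigr (fun=> 1)) ?sumr_const ?card_ord// => i _.
  by rewrite (_ : _ <= y)// (le_trans _ (ltW mLy))// ler_nat.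
have [my|_] := boolP (m.+1%:R <= y).
  have -> : y = m.+1%:R by apply/eqP; rewrite eq_le ym.
  by rewrite -natr1 /= lexx lerDl ler01.
by rewrite addr0 ltW//= natr1.
Qed.

(** All steps have the same height [e], and their total height [e * m] stays close to the length
    [2 * M] of the range. A functional that is small on every indicator is thereby small on the step
    function, however fine the mesh. *)
Lemma uniform_step_approximation (d : measure_display) (T : measurableType d)
    (g : T -> R) (M e : R) : measurable_fun [set: T] g -> 0 <= M -> 0 < e ->
  exists (m : nat) (A : nat -> set T), [/\ forall i, measurable (A i),
    e * m%:R <= 2 * M + e & forall w, `|g w| <= M ->
    `|g w - (- M + e * \sum_(i < m) \1_(A i) w)| <= e].
Proof.
move=> mg M0 e0.
have Me : 0 <= 2 * M / e by apply: divr_ge0; [lra|exact: ltW].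
have /andP[tl tu] := truncn_itv Me.
exists (Num.truncn (2 * M / e)).+1, (fun i => [set w | i.+1%:R <= (g w + M) / e]).
split=> [i| |w gM].
- have mf : measurable_fun setT (fun w => i.+1%:R <= (g w + M) / e).
    apply: measurable_fun_ler => //; apply: measurable_funM => //.
    exact: measurable_funD.
  rewrite (_ : [set w | _] =
    setT `&` (fun w => i.+1%:R <= (g w + M) / e) @^-1` [set true]); first exact: mf.
  by rewrite setTI; apply/seteqP; split.
- rewrite -natr1 mulrDr mulr1 lerD2r mulrC.
  by rewrite -ler_pdivlMr.
move: gM; rewrite ler_norml => /andP[g1 g2].
set m := _.+1; set y := (g w + M) / e.
have y0 : 0 <= y by apply: divr_ge0; [lra|exact: ltW].
have ym : y <= m%:R.
  by apply: le_trans (ltW tu); apply: ler_wpM2r; [rewrite invr_ge0; exact: ltW|lra].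
have := count_steps y0 ym.
have -> : \sum_(i < m) (i.+1%:R <= y)%R%:R =
    \sum_(i < m) \1_[set w | i.+1%:R <= (g w + M) / e] w :> R.
  apply: eq_bigr => i _; rewrite indicE; congr (_%:R); congr nat_of_bool.
  by apply/idP/idP => [h|/set_mem//]; exact/mem_set.
set s := (X in X <= y <= _) => /andP[sy ys].
have -> : g w = e * y - M by rewrite /y mulrCA divff ?gt_eqF// mulr1 addrK.
rewrite opprD opprK addrA addrNK -mulrBr normrM (gtr0_norm e0) ger_pMr//.
by rewrite -/s in ys *; rewrite ler_norml; lra.
Qed.

End uniform_approximation.

(** * Conditional expectation: comparison, contraction, self-adjointness *)

Section conditional_expectation.
Context (R : realType) (d : measure_display) (Omega : measurableType d).
Variables (P : probability Omega R) (G : set (set Omega)).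
Hypothesis sG : sigma_algebra [set: Omega] G.
Hypothesis Gm : G `<=` measurable.
Implicit Types (f g u v : Omega -> R) (A B : set Omega).

Local Notation intg f := (P.-integrable [set: Omega] (EFin \o f)).
Local Notation EE f := (\int[P]_w (f w)).
Local Notation Gmeas f := (measurable_fun [set: g_sigma_algebraType G] f).
Local Notation ce := (cond_exp P G).

Lemma Gmeasurable_set A : measurable (A : set (g_sigma_algebraType G)) -> G A.
Proof. by move=> mA; rewrite -(sigma_algebra_id sG); exact: mA. Qed.

Lemma Gmeasurable_measurable f : Gmeas f -> measurable_fun [set: Omega] f.
Proof.
move=> mf _ B mB; have := mf measurableT B mB; rewrite !setTI => mfB.
exact/Gm/Gmeasurable_set.
Qed.

Lemma Gmeasurable_indic A : G A -> Gmeas (\1_A : Omega -> R).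
Proof.
move=> GA; apply: (@measurable_indic _ (g_sigma_algebraType G)).
exact: sub_sigma_algebra.
Qed.

Lemma integral_set_EE f A : measurable A -> intg f ->
  (\int[P]_(w in A) (f w)%:E = (EE (fun w => \1_A w * f w))%:E)%E.
Proof.
move=> mA fi; rewrite -integral_EFinE; last exact: intg_indic.
rewrite integral_mkcond; apply: eq_integral => w _.
rewrite patchE indicE; case: ifPn => _; first by rewrite mul1r.
by rewrite mul0r.
Qed.

Lemma EE_ge0_eq0 f : intg f -> (forall w, 0 <= f w) -> EE f = 0 ->
  \forall w \ae P, f w = 0.
Proof.
move=> fi f0 Ef.
have : (\int[P]_w `|(f w)%:E| = 0)%E.
  under eq_integral do rewrite gee0_abs ?lee_fin//.
  by rewrite integral_EFinE// Ef.
move=> /(ae_eq_integral_abs P measurableT (measurable_int _ fi)).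
by apply: filterS => w /(_ I)[].
Qed.

(** The set where [g' < g] belongs to [G], so over it [g - g'] integrates like [f - f'], that is, to
    at most 0; being positive there, it lives on a null set. *)
Lemma is_cond_exp_le f f' g g' : intg f -> intg f' ->
  is_cond_exp P G f g -> is_cond_exp P G f' g' ->
  (\forall w \ae P, f w <= f' w) -> \forall w \ae P, g w <= g' w.
Proof.
move=> fi f'i [mg gi gE] [mg' g'i g'E] ff'.
pose A := [set w | g' w < g w].
have GA : G A.
  apply: Gmeasurable_set.
  have mlt := measurable_fun_ltr mg' mg.
  rewrite (_ : A = setT `&` (fun w => g' w < g w) @^-1` [set true]); first exact: mlt.
  by rewrite setTI; apply/seteqP; split.
have mA := Gm GA.
have EA : EE (fun w => \1_A w * (g w - g' w)) <= 0.
  have := gE _ GA; have := g'E _ GA; rewrite !integral_set_EE// => -[E'] -[E].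
  under eq_Rintegral do rewrite mulrBr.
  rewrite EEB; [|exact: intg_indic|exact: intg_indic].
  rewrite E E' subr_le0; apply: EE_le_ae; [exact: intg_indic|exact: intg_indic|].
  by apply: filterS ff' => w ff'; rewrite ler_wpM2l.
have iA : intg (fun w => \1_A w * (g w - g' w)).
  by apply: intg_indic => //; exact: intgB.
have A0 w : 0 <= \1_A w * (g w - g' w).
  rewrite indicE; have [/set_mem Aw|_] := boolP (w \in A); last by rewrite mul0r.
  by rewrite mul1r subr_ge0 ltW.
have /(EE_ge0_eq0 iA A0) : EE (fun w => \1_A w * (g w - g' w)) = 0.
  by apply/eqP; rewrite eq_le EA EE_ge0.
apply: filterS => w; rewrite indicE; have [_|] := boolP (w \in A).
  by rewrite mul1r => /eqP; rewrite subr_eq0 => /eqP ->.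
by move=> + _; apply: contraR; rewrite -ltNge => gg; exact/mem_set.
Qed.

Lemma is_cond_exp_id f : Gmeas f -> intg f -> is_cond_exp P G f f.
Proof. by []. Qed.

Lemma is_cond_exp_lin a f f' g g' : intg f -> intg f' ->
  is_cond_exp P G f g -> is_cond_exp P G f' g' ->
  is_cond_exp P G (fun w => a * f w + f' w) (fun w => a * g w + g' w).
Proof.
move=> fi f'i [mg gi gE] [mg' g'i g'E]; split.
- by apply: measurable_funD => //; exact: measurable_funM.
- by apply: intgD => //; exact: intgZ.
move=> A GA; have mA := Gm GA.
have := gE _ GA; have := g'E _ GA; rewrite !integral_set_EE//; last 2 first.
- by apply: intgD => //; exact: intgZ.
- by apply: intgD => //; exact: intgZ.
have lin u u' : intg u -> intg u' -> EE (fun w => \1_A w * (a * u w + u' w)) =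
    a * EE (fun w => \1_A w * u w) + EE (fun w => \1_A w * u' w).
  move=> ui u'i; under eq_Rintegral do rewrite mulrDr mulrCA.
  by rewrite EED ?EEZ//; [exact: intg_indic|apply: intgZ|]; exact: intg_indic.
by rewrite !lin// => -[->] -[->].
Qed.

Let ceP f : intg f -> is_cond_exp P G f (ce f).
Proof. exact: cond_expP. Qed.

Lemma cond_exp_Gmeas f : intg f -> Gmeas (ce f).
Proof. by move=> /ceP[]. Qed.

Lemma cond_exp_intg f : intg f -> intg (ce f).
Proof. by move=> /ceP[]. Qed.

Lemma is_cond_exp_unique f g : intg f -> is_cond_exp P G f g ->
  \forall w \ae P, ce f w = g w.
Proof.
move=> fi fg.
have h0 : \forall w \ae P, f w <= f w by exact: nearW.
have h1 := is_cond_exp_le fi fi (ceP fi) fg h0.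
have h2 := is_cond_exp_le fi fi fg (ceP fi) h0.
by apply: filterS2 h1 h2 => w h1 h2; apply/eqP; rewrite eq_le h1.
Qed.

Lemma cond_exp_id f : Gmeas f -> intg f -> \forall w \ae P, ce f w = f w.
Proof. by move=> mf fi; exact: is_cond_exp_unique. Qed.

Lemma cond_exp_lin a f f' : intg f -> intg f' ->
  \forall w \ae P, ce (fun w => a * f w + f' w) w = a * ce f w + ce f' w.
Proof.
move=> fi f'i; apply: is_cond_exp_unique.
  by apply: intgD => //; exact: intgZ.
by apply: is_cond_exp_lin => //; exact: ceP.
Qed.

(** [f] lies between [g - M] and [g + M], which are their own conditional expectations. *)
Lemma cond_exp_close f g M : intg f -> Gmeas g -> intg g ->
  (\forall w \ae P, `|f w - g w| <= M) -> \forall w \ae P, `|ce f w - g w| <= M.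
Proof.
move=> fi mg gi fgM.
have h1 : \forall w \ae P, ce f w <= g w + M.
  apply: (is_cond_exp_le fi _ (ceP fi) (is_cond_exp_id _ _)).
  - by apply: intgD => //; exact: intg_cst.
  - exact: measurable_funD.
  - by apply: intgD => //; exact: intg_cst.
  - by apply: filterS fgM => w; rewrite ler_norml; lra.
have h2 : \forall w \ae P, g w - M <= ce f w.
  apply: (is_cond_exp_le _ fi (is_cond_exp_id _ _) (ceP fi)).
  - by apply: intgB => //; exact: intg_cst.
  - exact: measurable_funB.
  - by apply: intgB => //; exact: intg_cst.
  - by apply: filterS fgM => w; rewrite ler_norml; lra.
by apply: filterS2 h1 h2 => w h1 h2; rewrite ler_norml; lra.
Qed.

Lemma cond_exp_bounded f M : intg f ->
  (\forall w \ae P, `|f w| <= M) -> \forall w \ae P, `|ce f w| <= M.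
Proof.
move=> fi fM; have := @cond_exp_close f (cst 0) M fi (measurable_cst _) (intg_cst P 0).
under eq_near do rewrite subr0.
by move=> /(_ fM); under eq_near do rewrite subr0.
Qed.

(** [v - ce v] integrates to 0 over the sets of [G], hence against step functions over [G], and [g]
    is almost surely a uniform limit of these. *)
Lemma EE_pull_out g v M : Gmeas g -> (\forall w \ae P, `|g w| <= M) -> intg v ->
  EE (fun w => g w * v w) = EE (fun w => g w * ce v w).
Proof.
move=> mg gM vi; have cvi := cond_exp_intg vi.
have mg' := Gmeasurable_measurable mg.
pose u w := v w - ce v w.
have ui : intg u by exact: intgB.
have gu c f : measurable_fun setT f -> (\forall w \ae P, `|f w| <= c) ->
    intg (fun w => f w * u w) by move=> mf fc; exact: intgM_bounded fc ui.
suff : EE (fun w => g w * u w) = 0.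
  under eq_Rintegral do rewrite mulrBr.
  rewrite EEB; [|exact: intgM_bounded gM vi|exact: intgM_bounded gM cvi].
  by move/eqP; rewrite subr_eq0 => /eqP.
have M0 : 0 <= M.
  have : \forall w \ae P, `|(fun w => const_mx (g w) : 'rV[R]_1) w| <= M.
    apply: filterS gM => w gM; apply/rV_norm_leP; first exact: le_trans gM.
    by move=> i; rewrite mxE.
  exact: ae_bound_ge0.
have EA A : G A -> EE (fun w => \1_A w * u w) = 0.
  move=> GA; have mA := Gm GA; have [_ _ /(_ A GA)] := ceP vi.
  rewrite !integral_set_EE// => -[E].
  under eq_Rintegral do rewrite mulrBr.
  by rewrite EEB; [rewrite E subrr|exact: intg_indic|exact: intg_indic].
apply/eqP; rewrite -normr_le0; apply/ler_addgt0Pr => e e0; rewrite add0r.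
pose K := EE (fun w => `|u w|) + 1.
have K0 : 0 < K by rewrite ltr_wpDl// EE_ge0.
have eK : 0 < e / K by exact: divr_gt0.
have [m [A [mA _ gs]]] := uniform_step_approximation mg M0 eK.
set s := (fun w => - M + e / K * \sum_(i < m) \1_(A i) w) in gs.
have GA i : G (A i) by apply: Gmeasurable_set; exact: mA.
have iA i : intg (fun w => \1_(A i) w * u w) by apply: intg_indic => //; exact: Gm.
(* The constant [- M] is written with the indicator of the whole space, so that [EA] covers it as
   well. *)
have sE : (fun w => s w * u w) = fun w => (- M) * (\1_setT w * u w) +
    e / K * \sum_(i < m) \1_(A i) w * u w.
  apply/funext => w; rewrite /s mulrDl indicT mul1r; congr (_ + _).
  by rewrite -(mulrA (e / K)) mulr_suml.
have iT : intg (fun w => \1_setT w * u w) by exact: intg_indic.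
have isum : intg (fun w => \sum_(i < m) \1_(A i) w * u w) by exact: intg_sum.
have is_ : intg (fun w => s w * u w) by rewrite sE; apply: intgD; exact: intgZ.
have Es : EE (fun w => s w * u w) = 0.
  rewrite sE EED ?EEZ//; [|exact: intgZ|exact: intgZ].
  rewrite EA; last first.
    by have [G0 GC _] := sG; rewrite -(setD0 setT); exact: GC.
  by rewrite EE_sum// big1 ?mulr0 ?addr0// => i _; exact: EA.
have igu := gu M g mg' gM.
rewrite -[X in `|X|]subr0 -Es -EEB//.
apply: le_trans (EE_norm_le _) _; first exact: intgB.
apply: (@le_trans _ _ (EE (fun w => e / K * `|u w|))).
  apply: EE_le_ae; [apply: integrable_norm; exact: intgB
                   |apply: intgZ; exact: integrable_norm|].
  apply: filterS gM => w gM; rewrite -mulrBl normrM ler_wpM2r//.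
  exact: gs.
rewrite EEZ; last exact: integrable_norm.
by rewrite mulrAC ler_pdivrMr// ler_wpM2l ?ltW//; rewrite /K; lra.
Qed.

(** Both sides equal [EE (ce u * ce v)]. Pulling out [ce v] requires a bounded factor, so it is
    first truncated on the sets [B n] of [G]. *)
Lemma cond_exp_adjoint u v M : measurable_fun setT u ->
  (\forall w \ae P, `|u w| <= M) -> intg v ->
  EE (fun w => ce u w * v w) = EE (fun w => u w * ce v w).
Proof.
move=> mu uM vi.
have ui : intg u by apply: intg_le_ae (intg_cst P M).
have cui := cond_exp_intg ui; have cvi := cond_exp_intg vi.
have cuM := cond_exp_bounded ui uM.
have mcu := cond_exp_Gmeas ui; have mcv := cond_exp_Gmeas vi.
rewrite (EE_pull_out mcu cuM vi).
pose B (n : nat) := [set w | `|ce v w| <= n%:R].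
have GB n : G (B n).
  apply: Gmeasurable_set.
  have mlt : Gmeas (fun w => `|ce v w| <= n%:R).
    by apply: measurable_fun_ler => //; exact: measurableT_comp.
  rewrite (_ : B n = setT `&` (fun w => `|ce v w| <= n%:R) @^-1` [set true]).
    exact: mlt.
  by rewrite setTI; apply/seteqP; split.
have mB n : measurable (B n) by apply: Gm; exact: GB.
have ndB m n : (m <= n)%N -> B m `<=` B n.
  by move=> mn w /= /le_trans; apply; rewrite ler_nat.
have exB w : exists n, B n w.
  by exists (Num.bound `|ce v w|); rewrite /B/= ltW// (le_lt_trans _ (archi_boundP _)).
have mce := Gmeasurable_measurable mcu.
have c1 := @EE_exhaust _ _ _ P B mB ndB exB _ (intgM_bounded mce cuM cvi).
have c2 := @EE_exhaust _ _ _ P B mB ndB exB _ (intgM_bounded mu uM cvi).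
have c12 : (fun n => EE (fun w => \1_(B n) w * (ce u w * ce v w))) =
    (fun n => EE (fun w => \1_(B n) w * (u w * ce v w))); last first.
  rewrite c12 in c1.
  by rewrite -(cvg_lim (@Rhausdorff R) c1) -(cvg_lim (@Rhausdorff R) c2).
apply/funext => n; apply/esym.
have mg : Gmeas (fun w => \1_(B n) w * ce v w).
  by apply: measurable_funM => //; exact: Gmeasurable_indic.
have gM : \forall w \ae P, `|\1_(B n) w * ce v w| <= n%:R.
  apply: nearW => w; rewrite indicE; have [/set_mem Bw|_] := boolP (w \in B n).
    by rewrite mul1r.
  by rewrite mul0r normr0.
have := EE_pull_out mg gM ui.
under eq_Rintegral do rewrite -mulrA [_ * u _]mulrC.
under [in X in _ = X -> _]eq_Rintegral do rewrite -mulrA [_ * ce u _]mulrC.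
by [].
Qed.

End conditional_expectation.

(** * Largest countably additive minorant of a finite content *)

Section countably_additive_part.
Context (R : realType) (d : measure_display) (Omega : measurableType d).
Variable mu : {content set Omega -> \bar R}.
Local Open Scope ereal_scope.
Local Open Scope measure_scope.

Lemma mu_ext_le_content A : measurable A -> mu^* A <= mu A.
Proof.
move=> mA; apply: ereal_inf_lbound; exists (fun n => if n is 0%N then A else set0).
  split; first by case.
  by move=> w Aw; exists 0%N.
rewrite nneseries_recl//.
by rewrite [X in _ + X](eseries0 (N := 1%N)) ?adde0// => -[|n] // _ _; exact: measure0.
Qed.

(** Finite additivity splits every cover of [X] into covers of its two pieces, without loss. The
    outer measure is thus countably additive on the measurable sets, where it may lie strictly below
    [mu]. *)
Lemma content_caratheodory A : measurable A -> (mu^*).-caratheodory A.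
Proof.
move=> mA; apply: le_caratheodory_measurable => X.
apply: le_ereal_inf_tmp => _ [F [mF XF] <-].
have mFA i : measurable (F i `&` A) by exact: measurableI.
have mFNA i : measurable (F i `&` ~` A) by apply: measurableI => //; exact: measurableC.
have FE i : mu (F i) = mu (F i `&` A) + mu (F i `&` ~` A).
  rewrite -measureU//; first by rewrite -setIUr setUv setIT.
  by rewrite setIACA setICr setI0.
under eq_eseriesr do rewrite FE.
rewrite nneseriesD//.
apply: leeD; apply: ereal_inf_lbound.
  exists (fun i => F i `&` A) => //; split => // w [Xw Aw].
  by have [i _ Fw] := XF _ Xw; exists i.
exists (fun i => F i `&` ~` A) => //; split => // w [Xw Aw].
by have [i _ Fw] := XF _ Xw; exists i.
Qed.

(* The outer measure generated by a finite content is its largest countably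
   additive minorant; an almost optimal cover of the space gives sets on which
   the purely finitely additive remainder is small. *)
Lemma content_countably_additive_part : mu setT \is a fin_num ->
  exists ma : {finite_measure set Omega -> \bar R},
    (forall A, measurable A -> ma A <= mu A) /\
    forall e : R, (0 < e)%R -> exists B : nat -> set Omega,
      [/\ forall n, measurable (B n),
          forall m n, (m <= n)%N -> B m `<=` B n,
          forall w, exists n, B n w &
          forall n, mu (B n) <= ma (B n) + e%:E].
Proof.
move=> muT.
have sadd : semi_sigma_additive (mu^* : set Omega -> \bar R).
  move=> F mF tF mUF.
  apply: (@caratheodory_measure_sigma_additive _ _ (mu^*)) => //.
    by move=> i; exact: content_caratheodory.
  exact: content_caratheodory.
have fin : fin_num_fun (mu^* : set Omega -> \bar R).
  move=> A mA; rewrite ge0_fin_numE; last exact: outer_measure_ge0.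
  apply: (@le_lt_trans _ _ (mu setT)); last by rewrite -ge0_fin_numE.
  apply: le_trans (mu_ext_le_content measurableT); exact: le_outer_measure.
pose H1 := isMeasure.Build d Omega R (mu^* : set Omega -> \bar R)
  (outer_measure0 (mu^*)) (outer_measure_ge0 (mu^*)) sadd.
pose m1 := HB.pack_for (Measure.type Omega R) (mu^* : set Omega -> \bar R) H1.
have fin1 : fin_num_fun m1 by exact: fin.
pose H2 := isFinite.Build _ _ _ (Measure.sort m1) fin1.
have sf1 : sigma_finite setT m1.
  by apply: fin_num_fun_sigma_finite => //; rewrite measure0.
pose H3 := isSFinite.Build _ _ _ (Measure.sort m1) (sfinite_measure_sigma_finite sf1).
pose H4 := isSigmaFinite.Build _ _ _ (Measure.sort m1) sf1.
pose ma := HB.pack_for (FiniteMeasure.type Omega R) (Measure.sort m1) H2 H3 H4.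
exists ma; split=> [A mA|e e0]; first exact: mu_ext_le_content.
have infT : mu^* setT \is a fin_num by exact: fin.
(* An almost optimal cover [D] of the whole space; its finite unions are the sets [B n]. *)
have [_ [D [mD TD] <-] De] := lb_ereal_inf_adherent e0 infT.
have ge0 i : 0 <= mu (D i) by exact: measure_ge0.
pose B n := \big[setU/set0]_(i < n) D i.
have mB n : measurable (B n) by exact: bigsetU_measurable.
exists B; split => // [m n mn|w|n].
- exact: subset_bigsetU.
- have [n _ Dn] := TD w I; exists n.+1; rewrite /B -bigcup_mkord.
  by exists n => /=.
have mDB i : measurable (D i `&` B n) by exact: measurableI.
have mDNB i : measurable (D i `&` ~` B n) by apply: measurableI => //;
  exact: measurableC.
have DE i : mu (D i) = mu (D i `&` B n) + mu (D i `&` ~` B n).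
  rewrite -measureU//; first by rewrite -setIUr setUv setIT.
  by rewrite setIACA setICr setI0.
have Bsub : mu (B n) <= \sum_(i <oo) mu (D i `&` B n).
  apply: le_trans (nneseries_lim_ge n _) => //; rewrite big_mkord.
  apply: (@content_subadditive _ _ _ mu _ (fun i => D i `&` B n)) => // w Bw.
  have [i ni Di] : (\bigcup_(i < n) D i) w by rewrite bigcup_mkord.
  by rewrite -(bigcup_mkord _ (fun i => D i `&` B n)); exists i.
have Csub : mu^* (~` B n) <= \sum_(i <oo) mu (D i `&` ~` B n).
  apply: ereal_inf_lbound; exists (fun i => D i `&` ~` B n) => //; split => // w Bw.
  by have [i _ Di] := TD w I; exists i.
have TE : mu^* setT = mu^* (B n) + mu^* (~` B n).
  by have := content_caratheodory (mB n) setT; rewrite !setTI.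
have -> : ma (B n) = mu^* (B n) by [].
have finC : mu^* (~` B n) \is a fin_num by apply: fin; exact: measurableC.
(* After adding the finite outer measure of the complement of [B n], both terms on the left are
   bounded through the traces of the cover [D], whose total is within [e] of the outer measure of
   the space. *)
rewrite -(leeD2rE _ _ finC) addeAC -TE.
apply: le_trans (ltW De).
under eq_eseriesr do rewrite DE.
by rewrite nneseriesD//; exact: leeD.
Qed.

End countably_additive_part.

(** * Yosida-Hewitt decomposition of finitely additive set functions *)

Section yosida_hewitt_sets.
Context (R : realType) (d : measure_display) (Omega : measurableType d).
Variable P : probability Omega R.
Implicit Types (A B C : set Omega).

Local Notation intg f := (P.-integrable [set: Omega] (EFin \o f)).
Local Notation EE f := (\int[P]_w (f w)).

(** The set functions obtained by evaluating a functional on indicators; vanishing on null sets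
    reflects that the functional respects almost sure equality. *)
Definition fin_additive (m : set Omega -> R) :=
  (forall A B, measurable A -> measurable B -> A `&` B = set0 ->
     m (A `|` B) = m A + m B) /\
  (forall A, measurable A -> P A = 0%E -> m A = 0).

Lemma fin_additive0 m : fin_additive m -> m set0 = 0.
Proof.
move=> [mD _]; have := mD set0 set0 measurable0 measurable0 (setI0 _).
by rewrite setU0; lra.
Qed.

Lemma fin_additiveD m A C : fin_additive m -> measurable A -> measurable C ->
  C `<=` A -> m A = m C + m (A `\` C).
Proof.
move=> [mD _] mA mC CA; rewrite -mD//; [|exact: measurableD|by rewrite setDIK].
by rewrite setDUK.
Qed.

Lemma fin_additive_setIC m A C : fin_additive m -> measurable A -> measurable C ->
  m A = m (A `&` C) + m (A `&` ~` C).
Proof.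
move=> mD mA mC; rewrite (fin_additiveD mD mA (measurableI _ _ mA mC))//.
by congr (_ + m _); rewrite setDE setCI setIUr setICr set0U.
Qed.

Lemma fin_additive_indic v : intg v -> fin_additive (fun A => EE (fun w => \1_A w *
  v w)).
Proof.
move=> vi; split=> [A B mA mB AB0|A mA PA0].
  rewrite -EED; [|exact: intg_indic|exact: intg_indic].
  apply: eq_Rintegral => w _; rewrite -mulrDl; congr (_ * _).
  rewrite !indicE in_setU -natrD; congr (_%:R).
  have [/set_mem Aw|] := boolP (w \in A); have [/set_mem Bw|] := boolP (w \in B) => //.
  by have : (A `&` B) w by []; rewrite AB0.
rewrite (@EE_eq_ae _ _ _ P _ (fun=> 0)) ?EE0//.
  by apply: measurable_funM => //; exact: intg_measurable vi.
exists A; split => // w /=; rewrite indicE.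
by have [/set_mem//|_] := boolP (w \in A); rewrite mul0r.
Qed.

Lemma exhaust_small_compl (B : nat -> set Omega) e :
  (forall n, measurable (B n)) -> (forall m n, (m <= n)%N -> B m `<=` B n) ->
  (forall w, exists n, B n w) -> 0 < e ->
  exists n, fine (P (~` B n)) <= e.
Proof.
move=> mB ndB exB e0.
have c1 := @EE_exhaust _ _ _ P B mB ndB exB _ (intg_cst P 1).
have [n _ /(_ n (leqnn n)) /= Hn] := (cvgrPdist_le _ _).1 c1 e e0.
exists n; rewrite -EE_indic_cst; last exact: measurableC.
move: Hn; rewrite -EE_indic_setC//; last exact: intg_cst.
under eq_Rintegral do rewrite mulr1.
exact: le_trans (ler_norm _).
Qed.

(** [v] is the density of the largest countably additive minorant. The remainder is nonnegative,
    hence monotone, so its smallness on [B] passes to all measurable subsets of [B]. *)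
Lemma nonneg_fin_additive_decomposition m :
  fin_additive m -> (forall A, measurable A -> 0 <= m A) ->
  exists2 v, intg v & forall e, 0 < e ->
    exists B, [/\ measurable B, fine (P (~` B)) <= e &
      forall C, measurable C -> C `<=` B ->
        0 <= m C - EE (fun w => \1_C w * v w) <= e].
Proof.
move=> mfa m0.
(* A content has to be nonnegative on every set; off the measurable sets [m] is replaced by 0. *)
pose m' A : \bar R := (if pselect (measurable A) then m A else 0)%:E.
have m'E A : measurable A -> m' A = (m A)%:E.
  by rewrite /m'; case: pselect.
have m'0 A : (0 <= m' A)%E.
  by rewrite /m'; case: pselect => // mA; rewrite lee_fin m0.
have m'set0 : m' set0 = 0%E by rewrite m'E// fin_additive0.
have m'add : measure_function.semi_additive m'.
  apply/additive2P => // A B mA mB AB.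
  by rewrite !m'E//; [rewrite -EFinD mfa.1|exact: measurableU].
pose H := isContent.Build d Omega R m' m'0 m'add.
pose mu := HB.pack_for (Content.type Omega R) m' H.
have muT : mu setT \is a fin_num by rewrite /= m'E.
have [ma [mamu maB]] := content_countably_additive_part muT.
have maP : ma `<< P.
  apply/null_content_dominatesP => A mA PA0; apply/eqP.
  rewrite eq_le measure_ge0 andbT (le_trans (mamu A mA))//= m'E//.
  by rewrite mfa.2.
have [f [f0 ffin fi maE]] := radon_nikodym_sigma_finite maP.
have fE : EFin \o (fine \o f) = f by apply/funext => w /=; rewrite fineK.
have vi : intg (fine \o f) by rewrite fE.
exists (fine \o f) => // e e0.
have maEE A : measurable A -> ma A = (EE (fun w => \1_A w * fine (f w)))%:E.
  move=> mA; rewrite maE// -integral_set_EE//.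
  by apply: eq_integral => w _; rewrite fineK.
have [B [mB ndB exB Be]] := maB _ e0.
have [n Pn] := exhaust_small_compl mB ndB exB e0.
exists (B n); split => // C mC CB.
have dge0 A : measurable A -> 0 <= m A - EE (fun w => \1_A w * fine (f w)).
  by move=> mA; rewrite subr_ge0 -lee_fin -maEE// -m'E// mamu.
rewrite dge0//=.
have := Be n; rewrite /= m'E// maEE// -EFinD lee_fin.
rewrite (fin_additiveD mfa (mB n) mC CB).
rewrite (fin_additiveD (fin_additive_indic vi) (mB n) mC CB) /=.
have := dge0 (B n `\` C) (measurableD (mB n) mC).
set a := Rintegral _ _ _; set b := Rintegral _ _ _; lra.
Qed.

Section signed.
Variable nu : set Omega -> R.
Hypothesis nufa : fin_additive nu.
Variable K : R.
Hypothesis nuK : forall A, measurable A -> `|nu A| <= K.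

(** Upper part of the Jordan decomposition of [nu]; the bound [K] makes the supremum a genuine
    one. *)
Definition pos_variation A := sup [set nu C | C in [set C | measurable C /\ C `<=` A]].

Let hs A : has_sup [set nu C | C in [set C | measurable C /\ C `<=` A]].
Proof.
split; first by exists (nu set0); exists set0 => //; split => //; exact: sub0set.
by exists K => _ [C [mC _] <-]; exact: le_trans (ler_norm _) (nuK mC).
Qed.

Lemma pos_variation_ge A C : measurable C -> C `<=` A -> nu C <= pos_variation A.
Proof. by move=> mC CA; apply: ub_le_sup; [have [] := hs A|exists C]. Qed.

Lemma pos_variation_le A b : (forall C, measurable C -> C `<=` A -> nu C <= b) ->
  pos_variation A <= b.
Proof.
move=> bC; apply: ge_sup; first by have [] := hs A.
by move=> _ [C [mC CA] <-]; exact: bC.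
Qed.

Lemma fin_additive_pos_variation : fin_additive pos_variation.
Proof.
split=> [A B mA mB AB0|A mA PA0]; last first.
  apply/eqP; rewrite eq_le; apply/andP; split.
    apply: pos_variation_le => C mC CA; rewrite nufa.2//.
    by apply/eqP; rewrite -measure_le0 -PA0 le_measure ?inE.
  by rewrite -(fin_additive0 nufa) pos_variation_ge.
apply/eqP; rewrite eq_le; apply/andP; split.
  apply: pos_variation_le => C mC CAB.
  rewrite (fin_additive_setIC nufa mC mA) lerD// pos_variation_ge//.
  - exact: measurableI.
  - by apply: measurableI => //; exact: measurableC.
  - by move=> w [/CAB[]].
rewrite -lerBrDr; apply: pos_variation_le => C mC CA; rewrite lerBrDr -lerBrDl.
apply: pos_variation_le => C' mC' CB; rewrite lerBrDl.
rewrite -nufa.1//.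
  by apply: pos_variation_ge; [exact: measurableU|exact: setUSS].
by apply/seteqP; split => // w [/CA Aw /CB Bw]; have : (A `&` B) w by []; rewrite AB0.
Qed.

(** Both parts of the Jordan decomposition are treated with tolerance [e / 2], and the two good sets
    are intersected. *)
Lemma fin_additive_decomposition :
  exists2 v, intg v & forall e, 0 < e ->
    exists B, [/\ measurable B, fine (P (~` B)) <= e &
      forall C, measurable C -> C `<=` B ->
        `|nu C - EE (fun w => \1_C w * v w)| <= e].
Proof.
have p0 A : measurable A -> 0 <= pos_variation A.
  by move=> mA; rewrite -(fin_additive0 nufa) pos_variation_ge.
pose neg A := pos_variation A - nu A.
have nfa : fin_additive neg.
  have [pD p00] := fin_additive_pos_variation; have [nD n00] := nufa.
  split=> [A B mA mB AB0|A mA PA0]; rewrite /neg ?pD ?nD//; first by ring.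
  by rewrite p00 ?n00 ?subrr.
have n0 A : measurable A -> 0 <= neg A.
  by move=> mA; rewrite subr_ge0 pos_variation_ge.
have [v vi vB] := nonneg_fin_additive_decomposition fin_additive_pos_variation p0.
have [v' v'i v'B] := nonneg_fin_additive_decomposition nfa n0.
exists (fun w => v w - v' w) => [|e e0]; first exact: intgB.
have e2 : 0 < e / 2 by lra.
have [B [mB PB Be]] := vB _ e2; have [B' [mB' PB' Be']] := v'B _ e2.
exists (B `&` B'); split=> [||C mC CB]; first exact: measurableI.
  have PU : (P (~` (B `&` B')) <= P (~` B) + P (~` B'))%E.
    by rewrite setCI; apply: measureU2; exact: measurableC.
  have fB A : measurable A -> P A \is a fin_num by exact: fin_num_measure.
  apply: (@le_trans _ _ (fine (P (~` B)) + fine (P (~` B')))); last lra.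
  rewrite -fineD ?fB//; [|exact: measurableC|exact: measurableC].
  apply: fine_le => //; [|by rewrite fin_numD !fB//; exact: measurableC].
  by rewrite fB//; apply: measurableC; exact: measurableI.
have /andP[a1 a2] := Be C mC (subset_trans CB (@subIsetl _ _ _)).
have /andP[b1 b2] := Be' C mC (subset_trans CB (@subIsetr _ _ _)).
under eq_Rintegral do rewrite mulrBr.
rewrite EEB; [|exact: intg_indic|exact: intg_indic].
move: a1 a2 b1 b2; rewrite /neg; set a := Rintegral _ _ _;
  set b := Rintegral _ _ _ => a1 a2 b1 b2.
by rewrite ler_norml; lra.
Qed.

End signed.
End yosida_hewitt_sets.

(** * Yosida-Hewitt decomposition of functionals on L^oo *)

Section yosida_hewitt.
Context (R : realType) (d : measure_display) (Omega : measurableType d).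
Variables (P : probability Omega R) (k : nat).
Implicit Types (A B C : set Omega) (u v : Omega -> R) (M : R).

Local Notation intg f := (P.-integrable [set: Omega] (EFin \o f)).
Local Notation EE f := (\int[P]_w (f w)).

Definition axis (i : 'I_k) u : Omega -> 'rV[R]_k := fun w => u w *: delta_mx 0 i.

Lemma axis_lin i a u u' :
  axis i (fun w => a * u w + u' w) = a *: axis i u + axis i u'.
Proof. by apply/funext => w; rewrite /axis !fctE scalerDl scalerA. Qed.

Lemma norm_axis i u w : `|axis i u w| <= `|u w|.
Proof.
apply/rV_norm_leP => // j; rewrite !mxE eqxx /=.
by case: (j == i); rewrite ?mulr1 ?mulr0 ?normr0.
Qed.

Definition ess_bounded u :=
  measurable_fun setT u /\ exists M, \forall w \ae P, `|u w| <= M.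

Lemma Linfty_axis i u : ess_bounded u -> Linfty P k (axis i u).
Proof.
move=> [mu [M uM]]; apply/LinftyP; split.
  move=> j; rewrite (_ : (fun w => _) = fun w => u w * (delta_mx 0 i : 'rV[R]_k) 0 j).
    exact: measurable_funM.
  by apply/funext => w; rewrite mxE.
by exists M; apply: filterS uM => w; apply: le_trans; exact: norm_axis.
Qed.

Lemma ess_bounded_lin a u u' : ess_bounded u -> ess_bounded u' ->
  ess_bounded (fun w => a * u w + u' w).
Proof.
move=> [mu [M uM]] [mu' [M' uM']]; split.
  by apply: measurable_funD => //; exact: measurable_funM.
exists (`|a| * M + M'); apply: filterS2 uM uM' => w uM uM'.
by apply: le_trans (ler_normD _ _) _; rewrite lerD// normrM ler_wpM2l.
Qed.

Lemma ess_bounded_indic A : measurable A -> ess_bounded (\1_A : Omega -> R).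
Proof.
move=> mA; split => //; exists 1; apply: nearW => w.
by rewrite indicE; case: (w \in A); rewrite ?normr1 ?normr0.
Qed.

Lemma ess_bounded_cst c : ess_bounded (fun=> c).
Proof. by split => //; exists `|c|; exact: nearW. Qed.

Lemma ess_bounded_sum (n : nat) (f : nat -> Omega -> R) :
  (forall i, ess_bounded (f i)) -> ess_bounded (fun w => \sum_(i < n) f i w).
Proof.
move=> bf; elim: n => [|n ih].
  rewrite (_ : (fun w => _) = fun=> 0); first exact: ess_bounded_cst.
  by apply/funext => w; rewrite big_ord0.
rewrite (_ : (fun w => _) = fun w => 1 * f n w + \sum_(i < n) f i w).
  exact: ess_bounded_lin.
by apply/funext => w; rewrite big_ord_recr /= mul1r addrC.
Qed.

Section step_functional.
Variables (L : (Omega -> R) -> R) (K eta : R).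
Hypothesis Llin : forall a u u', ess_bounded u -> ess_bounded u' ->
  L (fun w => a * u w + u' w) = a * L u + L u'.
Hypothesis LK : forall u M, ess_bounded u ->
  (\forall w \ae P, `|u w| <= M) -> `|L u| <= K * M.
Hypothesis Leta : forall A, measurable A -> `|L \1_A| <= eta.

Let Lzero : L (fun=> 0) = 0.
Proof.
apply/eqP; rewrite -normr_le0 -[leRHS](mulr0 K); apply: LK;
  first exact: ess_bounded_cst.
by apply: nearW => w; rewrite normr0.
Qed.

Let Lsum (n : nat) (f : nat -> Omega -> R) : (forall i, ess_bounded (f i)) ->
  L (fun w => \sum_(i < n) f i w) = \sum_(i < n) L (f i).
Proof.
move=> bf; elim: n => [|n ih].
  by rewrite big_ord0 -[RHS]Lzero; congr L; apply/funext => w; rewrite big_ord0.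
rewrite (_ : (fun w => _) = fun w => 1 * f n w + \sum_(i < n) f i w).
  by rewrite Llin ?mul1r ?ih ?big_ord_recr /= 1?addrC//; exact: ess_bounded_sum.
by apply/funext => w; rewrite big_ord_recr /= mul1r addrC.
Qed.

(** In a fine step approximation of [u] the constant [- M] contributes [eta * M], and the steps, of
    total height about [2 * M], contribute [2 * eta * M]: hence the factor 3. The bound [K] controls
    the vanishing remainder and leaves no trace. *)
Lemma step_functional_bound u M : ess_bounded u ->
  (\forall w \ae P, `|u w| <= M) -> `|L u| <= 3 * eta * M.
Proof.
move=> bu uM; have [mu _] := bu.
have M0 : 0 <= M.
  have : \forall w \ae P, `|(fun w => const_mx (u w) : 'rV[R]_1) w| <= M.
    apply: filterS uM => w uM; apply/rV_norm_leP; first exact: le_trans uM.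
    by move=> i; rewrite mxE.
  exact: ae_bound_ge0.
have eta0 : 0 <= eta := le_trans (normr_ge0 _) (Leta measurableT).
(* The mesh [e / Q] enters the error with the factors [K] and [eta]; with this [Q] the total error
   is at most [e]. *)
pose Q := `|K| + eta + 1; have Q0 : 0 < Q by rewrite /Q ltr_wpDl// addr_ge0.
apply/ler_addgt0Pr => e e0; have eQ : 0 < e / Q by exact: divr_gt0.
have [m [A [mA em us]]] := uniform_step_approximation mu M0 eQ.
pose s w := (e / Q) * (\sum_(i < m) \1_(A i) w) + (- M).
have bA i : ess_bounded (\1_(A i) : Omega -> R) by exact: ess_bounded_indic.
have bsum : ess_bounded (fun w => \sum_(i < m) \1_(A i) w).
  exact: (@ess_bounded_sum m (fun i => \1_(A i))).
have bM : ess_bounded (fun=> - M) by exact: ess_bounded_cst.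
have bs : ess_bounded s by exact: ess_bounded_lin.
have LM : L (fun=> - M) = - M * L \1_setT.
  rewrite -[RHS]addr0 -Lzero -Llin; [|exact: ess_bounded_indic|exact: ess_bounded_cst].
  by congr L; apply/funext => w; rewrite indicT mulr1 addr0.
have Ls : `|L s| <= 3 * eta * M + e / Q * eta.
  rewrite Llin// LM (@Lsum m (fun i => \1_(A i)))//.
  apply: le_trans (ler_normD _ _) _.
  rewrite (normrM (e / Q)) (normrM (- M)) normrN (ger0_norm M0) (gtr0_norm eQ).
  have h1 : `|\sum_(i < m) L \1_(A i)| <= m%:R * eta.
    apply: le_trans (ler_norm_sum _ _ _) _.
    apply: (@le_trans _ _ (\sum_(i < m) eta)); first by apply: ler_sum => i _;
      exact: Leta.
    by rewrite sumr_const card_ord mulr_natl.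
  have h2 : `|L \1_setT| <= eta by exact: Leta.
  have h3 : e / Q * `|\sum_(i < m) L \1_(A i)| <= (2 * M + e / Q) * eta.
    apply: le_trans (ler_wpM2l (ltW eQ) h1) _.
    by rewrite mulrA ler_wpM2r.
  have h4 : M * `|L \1_setT| <= M * eta by rewrite ler_wpM2l.
  by nra.
have Lus : `|L (fun w => - 1 * s w + u w)| <= K * (e / Q).
  apply: LK; first exact: ess_bounded_lin.
  apply: filterS uM => w /us; rewrite /s mulN1r [- _ + u w]addrC.
  by rewrite [_ + - M]addrC.
have LE : L u = L (fun w => - 1 * s w + u w) + L s.
  by rewrite Llin// mulN1r addrAC addNr add0r.
rewrite LE; apply: le_trans (ler_normD _ _) _.
have KK : K * (e / Q) <= `|K| * (e / Q) by apply: ler_wpM2r;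
  [exact: ltW|exact: ler_norm].
have QE : e / Q * Q = e by rewrite divfK// gt_eqF.
have : e / Q * (`|K| + eta) <= e 
  by rewrite -[leRHS]QE; apply: ler_wpM2l; [exact: ltW|rewrite /Q; lra].
by rewrite mulrDr; lra.
Qed.

End step_functional.

Variable l : (Omega -> 'rV[R]_k) -> R.
Hypothesis lb : bounded_functional P l.

Lemma bf_sum (I : Type) (s : seq I) (x : I -> Omega -> 'rV[R]_k) :
  (forall i, Linfty P k (x i)) -> l (\sum_(i <- s) x i) = \sum_(i <- s) l (x i).
Proof.
move=> xi; elim: s => [|i s ih]; first by rewrite !big_nil (bf0 lb).
rewrite !big_cons (bfD lb)// ?ih//.
by elim: s {ih} => [|j s ih]; rewrite ?big_nil ?big_cons;
  [exact: Linfty0|exact: LinftyD].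
Qed.

Lemma fin_additive_functional i : fin_additive P (fun A => l (axis i \1_A)).
Proof.
split=> [A B mA mB AB0|A mA PA0].
  rewrite -(bfD lb); [|exact/Linfty_axis/ess_bounded_indic|exact/Linfty_axis/ess_bounded_indic]
    .
  congr l; apply/funext => w; rewrite /axis !fctE -scalerDl; congr (_ *: _).
  rewrite !indicE in_setU -natrD; congr (_%:R).
  have [/set_mem Aw|] := boolP (w \in A); have [/set_mem Bw|] := boolP (w \in B) => //.
  by have : (A `&` B) w by []; rewrite AB0.
rewrite -(bf0 lb); apply: (bf_eq_ae lb).
- exact/Linfty_axis/ess_bounded_indic.
- exact: Linfty0.
exists A; split => // w /=; rewrite /axis indicE.
by have [/set_mem//|_] := boolP (w \in A); rewrite scale0r.
Qed.

(** Singularity of [l - E(.v)] is expressed quantitatively: on a set of nearly full measure its norm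
    is at most [e]. The decomposition of set functions controls indicators in each coordinate, and
    [step_functional_bound] turns this into a norm bound. *)
Theorem yosida_hewitt : exists2 v : Omega -> 'rV[R]_k, intg_vec P v &
  forall e, 0 < e -> exists B, [/\ measurable B, fine (P (~` B)) <= e &
    forall z M, Linfty P k z -> (\forall w \ae P, `|z w| <= M) ->
      `|l (restr B z) - EE (fun w => dotmul (restr B z w) (v w))| <= e * M].
Proof.
have [K K0 lK] := lb.2.
have nuK i A : measurable A -> `|l (axis i \1_A)| <= K.
  move=> mA; rewrite -[K]mulr1; apply: lK.
    exact/Linfty_axis/ess_bounded_indic.
  apply: nearW => w; apply: le_trans (norm_axis _ _ _) _.
  by rewrite indicE; case: (w \in A); rewrite ?normr1 ?normr0.
have /choice[v vP] i : exists v, intg v /\ forall e, 0 < e ->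
    exists B, [/\ measurable B, fine (P (~` B)) <= e &
      forall C, measurable C -> C `<=` B ->
        `|l (axis i \1_C) - EE (fun w => \1_C w * v w)| <= e].
  by have [v vi vB] := fin_additive_decomposition (fin_additive_functional i) (nuK
    i); exists v.
have vi i : intg (v i) by have [] := vP i.
exists (fun w => \row_i v i w).
  by move=> i; apply: eq_integrable (vi i) => // w _ /=; rewrite mxE.
(* The [k] coordinates cost [3 * e'] each in norm and [e'] each in measure; the added 1 covers
   [k = 0]. *)
move=> e e0; pose e' := e / (3 * k%:R + 1).
have k0 : 0 < 3 * k%:R + 1 :> R by rewrite ltr_wpDl// mulr_ge0.
have e'0 : 0 < e' by rewrite divr_gt0.
have ke' : (3 * k%:R + 1) * e' = e by rewrite mulrC divfK// gt_eqF.
have /choice[B BP] i := (vP i).2 _ e'0.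
have mB i : measurable (B i) by have [] := BP i.
pose C := \bigcap_(i in [set: 'I_k]) B i.
have mC : measurable C by exact: fin_bigcap_measurable.
have CB i : C `<=` B i by move=> w; apply.
exists C; split => //.
  apply: (@le_trans _ _ (\sum_(i < k) e')); last first.
    rewrite sumr_const card_ord -mulr_natl -ke'.
    apply: ler_wpM2r; first exact: ltW.
    by rewrite -[leLHS]mul1r -[leLHS]addr0 lerD ?ler01// ler_wpM2r//; lra.
  apply: (@le_trans _ _ (\sum_(i < k) EE \1_(~` B i))); last first.
    apply: ler_sum => i _; rewrite EE_indic_cst; last exact: measurableC.
    by have [] := BP i.
  have ib i : intg (\1_(~` B i) : Omega -> R).
    by apply: (integrable_indic P); exact: measurableC.
  rewrite -EE_sum// -EE_indic_cst; last exact: measurableC.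
  apply: EE_le_ae; [apply: (integrable_indic P); exact: measurableC|exact: intg_sum|].
  apply: nearW => w; rewrite indicE; have [/set_mem Cw|_] := boolP (w \in ~` C).
    have [i Bi] : exists i, ~ B i w.
      by apply/existsNP => Bw; apply: Cw => i _; exact: Bw.
    by rewrite (bigD1 i)//= indicE mem_set// lerDl sumr_ge0.
  exact: sumr_ge0.
move=> z M zi zM; have [mz _] := (LinftyP P z).1 zi.
have zb i : \forall w \ae P, `|z w ord0 i| <= M.
  by apply: filterS zM => w; apply: le_trans; exact: rV_coord_le_norm.
have bz i : ess_bounded (fun w => z w ord0 i) by split => //; exists M.
pose L i u := l (axis i (fun w => \1_C w * u w)) - EE (fun w => \1_C w * u w * v i w).
have bC u : ess_bounded u -> ess_bounded (fun w => \1_C w * u w).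
  move=> [mu [N uN]]; split; first exact: measurable_funM.
  exists N; apply: filterS uN => w; apply: le_trans.
  by rewrite normrM ler_piMl// indicE; case: (w \in C); rewrite ?normr1 ?normr0.
have ibv i u : ess_bounded u -> intg (fun w => u w * v i w).
  by move=> [mu [N uN]]; exact: intgM_bounded uN (vi i).
have zE : restr C z = \sum_i axis i (fun w => \1_C w * z w ord0 i).
  apply/funext => w; rewrite fct_sumE; apply/rowP => j.
  rewrite !mxE summxE (bigD1 j)//= !mxE !eqxx mulr1 big1 ?addr0// => i ij.
  by rewrite !mxE eqxx /= (negbTE (_ : j != i)) ?mulr0// eq_sym.
rewrite {1}zE bf_sum; last by move=> i; exact/Linfty_axis/bC.
have -> : EE (fun w => dotmul (restr C z w) (\row_i v i w)) =
    \sum_i EE (fun w => \1_C w * z w ord0 i * v i w).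
  rewrite -EE_sum; last by move=> i; apply: ibv; exact: bC.
  by apply: eq_Rintegral => w _; apply: eq_bigr => i _; rewrite !mxE.
rewrite -sumrB; apply: le_trans (ler_norm_sum _ _ _) _.
have M0 := ae_bound_ge0 zM.
apply: (@le_trans _ _ (\sum_(i < k) 3 * e' * M)); last first.
  rewrite sumr_const card_ord -[leLHS]mulr_natl -ke'.
  by have := mulr_ge0 (ltW e'0) M0; lra.
apply: ler_sum => i _; rewrite -/(L i (fun w => z w ord0 i)).
have iav : intg (fun w => `|v i w|) by exact: integrable_norm (vi i).
(* The crude bound [K + E|v i|] serves the passage to the limit; the estimate obtained depends on
   [e'] alone. *)
apply: (@step_functional_bound (L i) (K + EE (fun w => `|v i w|)) e') => //.
- move=> a u u' bu bu'; rewrite /L.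
  have -> : (fun w => \1_C w * (a * u w + u' w)) =
      (fun w => a * (\1_C w * u w) + \1_C w * u' w).
    by apply/funext => w; rewrite mulrDr mulrCA.
  rewrite axis_lin lb.1; [|exact/Linfty_axis/bC|exact/Linfty_axis/bC].
  have -> : EE (fun w => \1_C w * (a * u w + u' w) * v i w) =
      a * EE (fun w => \1_C w * u w * v i w) + EE (fun w => \1_C w * u' w * v i w).
    rewrite -EEZ; last by apply: ibv; exact: bC.
    rewrite -EED; [|by apply: intgZ; apply: ibv; exact: bC|by apply: ibv; exact: bC].
    by apply: eq_Rintegral => w _; ring.
  by ring.
- move=> u N bu uN; rewrite /L.
  have cN : \forall w \ae P, `|\1_C w * u w| <= N.
    apply: filterS uN => w; apply: le_trans.
    by rewrite normrM ler_piMl// indicE; case: (w \in C); rewrite ?normr1 ?normr0.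
  have il := ibv i _ (bC _ bu).
  apply: le_trans (ler_normB _ _) _; rewrite mulrDl lerD//.
    apply: lK; first exact/Linfty_axis/bC.
    by apply: filterS cN => w; apply: le_trans; exact: norm_axis.
  apply: le_trans (EE_norm_le il) _; rewrite mulrC -EEZ//.
  apply: EE_le_ae; [exact: integrable_norm il|exact: intgZ|].
  by apply: filterS cN => w cN; rewrite normrM ler_wpM2r.
- move=> A mA; rewrite /L; have [_ _ Bi] := BP i.
  have -> : (fun w => \1_C w * \1_A w) = \1_(C `&` A) :> (Omega -> R).
    by apply/funext => w; rewrite indicI.
  have -> : EE (fun w => \1_C w * \1_A w * v i w) =
    EE (fun w => \1_(C `&` A) w * v i w).
    by apply: eq_Rintegral => w _; rewrite indicI.
  apply: Bi; first exact: measurableI.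
  by move=> w [Cw _]; exact: CB.
Qed.

End yosida_hewitt.

(** * Affine hulls *)

Section affine_hull.
Context (R : realType) (V : lmodType R) (S : set V).

Lemma subset_aff : S `<=` aff S.
Proof.
move=> v Sv; exists 1%N, (fun=> 1), (fun=> v).
by split => //; rewrite big_ord1// scale1r.
Qed.

Lemma aff_sub_subspace (W : set V) : W 0 -> (forall x y, W x -> W y -> W (x + y)) ->
  (forall a x, W x -> W (a *: x)) -> S `<=` W -> aff S `<=` W.
Proof.
move=> W0 WD WZ SW _ [m [b [y [Sy _ ->]]]].
by elim/big_ind: _ => // i _; apply: WZ; exact: SW.
Qed.

Lemma aff_line a u v : aff S u -> aff S v -> aff S (a *: u + (1 - a) *: v).
Proof.
move=> [m [b [y [Sy b1 ->]]]] [n [c [z [Sz c1 ->]]]].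
pose coef (i : 'I_(m + n)) :=
  match fintype.split i with inl j => a * b j | inr j => (1 - a) * c j end.
pose pt (i : 'I_(m + n)) := match fintype.split i with inl j => y j | inr j => z j end.
have lE j : fintype.split (lshift n j) = inl j := unsplitK (inl j : 'I_m + 'I_n).
have rE j : fintype.split (rshift m j) = inr j := unsplitK (inr j : 'I_m + 'I_n).
exists (m + n)%N, coef, pt; split.
- by move=> i; rewrite /pt; case: fintype.split.
- rewrite big_split_ord /= /coef.
  under eq_bigr do rewrite lE; under [X in _ + X]eq_bigr do rewrite rE.
  by rewrite -!mulr_sumr b1 c1; ring.
rewrite big_split_ord /= /coef /pt !scaler_sumr.
by congr (_ + _); apply: eq_bigr => i _; rewrite ?lE ?rE scalerA.
Qed.

(** Two lines suffice: the point [q = (u + t v) / (1 + t)] lies on the line through [u] and [v], and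
    [(1 + t) q - t w] on the one through [q] and [w]. *)
Lemma aff_translate t u v w : 0 < t -> aff S u -> aff S v -> aff S w ->
  aff S (u + t *: (v - w)).
Proof.
move=> t0 Su Sv Sw; have t1 : 1 + t != 0 by rewrite gt_eqF// addr_gt0.
have := aff_line (1 + t) (aff_line (1 + t)^-1 Su Sv) Sw.
congr (aff S _); rewrite scalerDr !scalerA mulfV// scale1r -addrA; congr (_ + _).
rewrite mulrBr mulr1 mulfV// scalerBr; congr (_ *: _ + _); first by ring.
by rewrite -scaleNr; congr (_ *: _); ring.
Qed.

End affine_hull.

(** * Lower bound modulo N^oo and the dual functional *)

Section dual_functional.
Context (R : realType) (d : measure_display) (Omega : measurableType d).
Variables (P : probability Omega R) (k : nat).
Variable h : 'rV[R]_k -> Omega -> \bar R.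
Hypothesis hh : convex_normal_integrand h.
Hypothesis h_proper : proper_on (Eint P h) (Linfty P k).

Local Notation intg f := (P.-integrable [set: Omega] (EFin \o f)).
Local Notation EE f := (\int[P]_w (f w)).
Local Notation V := (Omega -> 'rV[R]_k).
Local Notation D := (domE P h `&` Linfty P k).
Local Notation f z := (EE (hr h z)).

(** [N] stands for N^oo. Below, [f_bounded] is drawn from (3) with [M = f xbar + 1], and [N_approx]
    from (2) with [C = 2 |rho|]. *)
Variables (N : set V) (xbar : V) (c M eps C : R).
Hypothesis N_lin : forall a x y, N x -> N y -> N (a *: x + y).
Hypothesis N_infty : N `<=` Linfty P k.
Hypothesis c_le : forall x, N x -> D x -> c <= f x.
Hypotheses (N_xbar : N xbar) (D_xbar : D xbar) (eps0 : 0 < eps) (C0 : 0 <= C).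
Hypothesis f_bounded : forall y, aff D y ->
  (\forall w \ae P, `|(y - xbar) w| <= eps) -> D y /\ f y <= M.
Hypothesis N_approx : forall z x r, D z -> N x ->
  (\forall w \ae P, `|(z + x) w| <= r) ->
  exists x1, [/\ N x1, aff D x1 & \forall w \ae P, `|(x1 - z) w| <= C * r].

(** Rate at which [f] may fall below [c] off [N]: a point of the domain within [r] of [N] satisfies
    [f z >= c - K * r]. *)
Let K := C * (M - c) / eps.

Let N0 : N 0.
Proof.
have := N_lin (-1) N_xbar N_xbar.
by rewrite scaleN1r addNr.
Qed.

Let NZ a x : N x -> N (a *: x).
Proof. by move=> Nx; rewrite -[_ *: _]addr0; exact: N_lin. Qed.

Let Mc : 0 <= M - c.
Proof.
have [_ fM] := @f_bounded xbar (subset_aff D_xbar) ltac:(by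
  apply: nearW => w; rewrite subrr normr0 ltW).
by have := c_le N_xbar D_xbar; lra.
Qed.

Let K0 : 0 <= K.
Proof. by apply: divr_ge0; [exact: mulr_ge0|exact: ltW]. Qed.

(* With [y := xbar + t (x1 - z)] a suitable convex combination of [z] and [y]
   equals one of [x1] and [xbar] and hence lies in [N], where [f >= c]; the bound
   [f y <= M] then bounds [f z] from below. *)
Lemma lower_bound_distance s z x r : 0 <= s -> D z -> N x ->
  (\forall w \ae P, `|(s *: (z - xbar) + x) w| <= r) ->
  0 <= s * (f z - c) + K * r.
Proof.
move=> s0 Dz Nx sr; have r0 := ae_bound_ge0 sr.
move: s0; rewrite le_eqVlt => /predU1P[<-|s0].
  by rewrite mul0r add0r mulr_ge0.
have Nx' : N (s^-1 *: x + - xbar).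
  by rewrite -scaleN1r; apply: N_lin => //; exact: NZ.
have [|x1 [Nx1 Ax1 x1z]] := N_approx (r := s^-1 * r) Dz Nx'.
  apply: filterS sr => w sr; rewrite -ler_pdivrMl ?invr_gt0// invrK.
  rewrite -[X in X * _](gtr0_norm s0) -normrZ.
  rewrite (_ : s *: _ = (s *: (z - xbar) + x) w)//.
  rewrite !fctE; apply/rowP => i; rewrite !mxE.
  by field; rewrite gt_eqF.
set del := C * _ in x1z; have del0 : 0 <= del := ae_bound_ge0 x1z.
suff fzc : - (del * (M - c) / eps) <= f z - c.
  have : s * - (del * (M - c) / eps) <= s * (f z - c) by rewrite ler_wpM2l ?(ltW s0).
  have -> : s * - (del * (M - c) / eps) = - (K * r).
    by rewrite /del /K; field; rewrite !gt_eqF.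
  by lra.
rewrite lerNl; apply/ler_addgt0Pr => e e0.
(* A slack that keeps [del + eta] positive even if [z] is almost surely equal to [x1], and costs at
   most [e] in the end. *)
pose eta := e * eps / (M - c + 1).
have Mc1 : 0 < M - c + 1 by rewrite ltr_wpDl.
have eta0 : 0 < eta by rewrite !(divr_gt0, mulr_gt0).
have de0 : 0 < del + eta by rewrite ltr_wpDl.
(* As [x1 - z] is bounded by [del], this step keeps [y] within [eps] of [xbar]. *)
pose t := eps / (del + eta); have t0 : 0 < t by rewrite divr_gt0.
pose y := xbar + t *: (x1 - z).
have Ay : aff D y by apply: aff_translate => //; exact: subset_aff.
have [|Dy fy] := f_bounded Ay.
  apply: filterS x1z => w x1z.
  rewrite (_ : (y - xbar) w = t *: (x1 - z) w); last first.
    by rewrite /y addrAC subrr add0r.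
  rewrite normrZ (gtr0_norm t0) /t mulrAC ler_pdivrMr//.
  apply: ler_wpM2l; first exact: ltW.
  by apply: le_trans x1z _; rewrite lerDl ltW.
(* The weight for which [z] cancels in [lam z + (1 - lam) y]. *)
pose lam := t / (1 + t); have t1 : 0 < 1 + t by rewrite addr_gt0.
have lam01 : 0 <= lam <= 1.
  rewrite /lam divr_ge0 ?(ltW t0) ?(ltW t1)//= ler_pdivrMr// mul1r.
  by rewrite lerDr.
have [] := D_convex hh h_proper Dz Dy lam01.
have -> : lam *: z + (1 - lam) *: y = lam *: x1 + (1 - lam) *: xbar.
  apply/funext => w; rewrite /y !fctE; apply/rowP => i; rewrite !mxE /lam.
  by field; rewrite gt_eqF.
move=> Dq fq.
have cq : c <= f (lam *: x1 + (1 - lam) *: xbar).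
  by apply: c_le => //; apply: N_lin => //; exact: NZ.
have {}fq : c <= lam * f z + (1 - lam) * M.
  apply: le_trans cq (le_trans fq _); rewrite lerD2l ler_wpM2l//.
  by case/andP: lam01; lra.
have {fq} tfz : c - M <= t * (f z - c).
  have : (1 + t) * c <= (1 + t) * (lam * f z + (1 - lam) * M).
    by rewrite ler_wpM2l ?(ltW t1).
  have -> : (1 + t) * (lam * f z + (1 - lam) * M) = t * f z + M.
    by rewrite /lam; field; rewrite gt_eqF.
  by lra.
have : (del + eta) / eps * (c - M) <= f z - c.
  rewrite -(ler_pM2l t0); apply: le_trans tfz.
  rewrite le_eqVlt; apply/orP; left; apply/eqP.
  by rewrite /t; field; rewrite !gt_eqF.
have -> : (del + eta) / eps * (c - M) = - (del * (M - c) / eps) - eta * (M - c) / eps.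
  by field; rewrite gt_eqF.
have : eta * (M - c) / eps <= e.
  rewrite ler_pdivrMr// /eta mulrAC ler_pdivrMr//.
  by rewrite ler_wpM2l ?mulr_ge0 ?(ltW e0) ?(ltW eps0)//; lra.
by lra.
Qed.

(* The infimum of [vals u] is the sublinear hull of the infimal convolution of
   [f (xbar + _) - c], the indicator of [N] and [K] times the norm. *)
Let vals (u : V) : set R := [set q | exists s z x r,
  [/\ 0 <= s, D z, N x, \forall w \ae P, `|(u - s *: (z - xbar) - x) w| <= r &
   q = s * (f z - c) + K * r]].

Let p u := inf (vals u).

(** [s (z - xbar) + x] is within [r] of [u], hence bounded by [m + r]; [lower_bound_distance] then
    keeps the infimum defining [p] finite. *)
Let vals_lb u m s z x r : (\forall w \ae P, `|u w| <= m) -> 0 <= s -> D z -> N x ->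
  (\forall w \ae P, `|(u - s *: (z - xbar) - x) w| <= r) ->
  - (K * m) <= s * (f z - c) + K * r.
Proof.
move=> um s0 Dz Nx ur.
have : 0 <= s * (f z - c) + K * (m + r); last by rewrite mulrDr; lra.
apply: (lower_bound_distance s0 Dz Nx); apply: filterS2 um ur => w um ur.
rewrite (_ : (_ + x) w = u w - (u - s *: (z - xbar) - x) w); last first.
  by rewrite !fctE; apply/rowP => i; rewrite !mxE; ring.
by apply: le_trans (ler_normB _ _) _; rewrite lerD.
Qed.

Let vals_inf u : Linfty P k u -> has_inf (vals u).
Proof.
move=> /LinftyP[_ [m um]]; split.
  exists (0 * (f xbar - c) + K * m), 0, xbar, 0, m; split => //.
  by apply: filterS um => w; rewrite scale0r !subr0.
by exists (- (K * m)) => _ [s [z [x [r [s0 Dz Nx ur ->]]]]]; exact: vals_lb um _ _ _ ur.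
Qed.

Let p_le u s z x r : Linfty P k u -> 0 <= s -> D z -> N x ->
  (\forall w \ae P, `|(u - s *: (z - xbar) - x) w| <= r) ->
  p u <= s * (f z - c) + K * r.
Proof.
move=> ui s0 Dz Nx ur; apply: ge_inf; first by have [] := vals_inf ui.
by exists s, z, x, r.
Qed.

Let le_p u b : Linfty P k u -> (forall s z x r, 0 <= s -> D z -> N x ->
  (\forall w \ae P, `|(u - s *: (z - xbar) - x) w| <= r) ->
  b <= s * (f z - c) + K * r) -> b <= p u.
Proof.
move=> ui H; apply: lb_le_inf; first by have [] := vals_inf ui.
by move=> _ [s [z [x [r [s0 Dz Nx ur ->]]]]]; exact: H ur.
Qed.

Let sublinear_p : sublinear_on (Linfty P k) p.
Proof.
split=> [a u a0 ui|u u' ui u'i].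
  rewrite -ler_pdivrMl//; apply: (le_p ui) => s z x r s0 Dz Nx ur.
  rewrite ler_pdivrMl//.
  have -> : a * (s * (f z - c) + K * r) = (a * s) * (f z - c) + K * (a * r) by ring.
  apply: (p_le (LinftyZ _ ui) _ Dz (NZ a Nx)); first by rewrite mulr_ge0 ?(ltW a0).
  apply: filterS ur => w ur.
  rewrite (_ : (_ - _) w = a *: (u - s *: (z - xbar) - x) w); last first.
    by rewrite !fctE; apply/rowP => i; rewrite !mxE; ring.
  by rewrite normrZ (gtr0_norm a0) ler_wpM2l ?(ltW a0).
rewrite -lerBlDr; apply: (le_p ui) => s z x r s0 Dz Nx ur.
rewrite lerBlDr -lerBlDl; apply: (le_p u'i) => s' z' x' r' s'0 Dz' Nx' ur'.
rewrite lerBlDl.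
have Nxx' : N (x + x') by rewrite -[x]scale1r; exact: N_lin.
have rr' v : v = (u - s *: (z - xbar) - x) + (u' - s' *: (z' - xbar) - x') ->
    \forall w \ae P, `|v w| <= r + r'.
  move=> ->; apply: filterS2 ur ur' => w ur ur'.
  by apply: le_trans (ler_normD _ _) _; rewrite lerD.
have uu'i := LinftyD ui u'i.
have : 0 <= s + s' by rewrite addr_ge0.
rewrite le_eqVlt => /predU1P[/esym ss'|ss'].
  have sE : s = 0 by lra.
  have s'E : s' = 0 by lra.
  have -> : s * (f z - c) + K * r + (s' * (f z' - c) + K * r') =
      0 * (f z - c) + K * (r + r') by rewrite sE s'E; ring.
  apply: (p_le uu'i _ Dz Nxx') => //; apply: rr'.
  rewrite sE s'E !scale0r !subr0; apply/funext => w; rewrite !fctE.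
  by apply/rowP => i; rewrite !mxE; ring.
(* By convexity the two points of the domain merge into one point [q] carrying the weight [s + s'],
   whence the separate case of weight 0. *)
pose a := s / (s + s').
have a01 : 0 <= a <= 1.
  by rewrite /a divr_ge0 ?(ltW ss')//= ler_pdivrMr// mul1r lerDl.
have [Dq fq] := D_convex hh h_proper Dz Dz' a01.
set q := _ + _ in Dq fq.
apply: (@le_trans _ _ ((s + s') * (f q - c) + K * (r + r'))).
  apply: (p_le uu'i (ltW ss') Dq Nxx'); apply: rr'.
  apply/funext => w; rewrite /q !fctE; apply/rowP => i; rewrite !mxE /a.
  by field; rewrite gt_eqF.
have : (s + s') * f q <= (s + s') * (a * f z + (1 - a) * f z').
  by rewrite ler_wpM2l ?(ltW ss').
have -> : (s + s') * (a * f z + (1 - a) * f z') = s * f z + s' * f z'.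
  by rewrite /a; field; rewrite gt_eqF.
by lra.
Qed.

(** Three choices in the infimum [p] give the three properties of [l <= p]: [s = 0, x = 0] yields
    [p u <= K |u|]; [s = 0, x = u] yields [p <= 0] on the linear set [N]; [s = 1, x = 0] yields
    [p (z - xbar) <= f z - c]. *)
Lemma exists_dual_functional : exists l, [/\ bounded_functional P l,
  forall x, N x -> l x = 0 & forall z, D z -> c + l z <= f z].
Proof.
have [l ll lp] := hahn_banach_sublinear (@LinftyD _ _ _ P k) (@LinftyZ _ _ _ P k)
  sublinear_p.
have lle u m : Linfty P k u -> (\forall w \ae P, `|u w| <= m) -> l u <= K * m.
  move=> ui um; apply: le_trans (lp _ ui) _.
  have -> : K * m = 0 * (f xbar - c) + K * m by ring.
  apply: (p_le ui _ D_xbar N0) => //.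
  by apply: filterS um => w; rewrite scale0r !subr0.
have lN u : Linfty P k u -> l (- u) = - l u.
  move=> ui; have l0 : l 0 = 0.
    by have := ll 1 _ _ (Linfty0 P k) (Linfty0 P k); rewrite scaler0 addr0; lra.
  by have := ll (-1) _ _ ui (Linfty0 P k); rewrite addr0 scaleN1r l0; lra.
have lb : bounded_functional P l.
  split => //; exists K => // z m zi zm; rewrite ler_norml lle// andbT.
  rewrite lerNl -lN//; apply: lle; first by rewrite -scaleN1r; exact: LinftyZ.
  by apply: filterS zm => w; rewrite !fctE normrN.
have lNx x : N x -> l x <= 0.
  move=> Nx; have xi := N_infty Nx; apply: le_trans (lp _ xi) _.
  have -> : 0 = 0 * (f xbar - c) + K * 0 by ring.
  apply: (p_le xi _ D_xbar Nx) => //.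
  by apply: nearW => w; rewrite scale0r subr0 subrr normr0.
have lN0 x : N x -> l x = 0.
  move=> Nx; apply/eqP; rewrite eq_le lNx//=.
  by have := lNx _ (NZ (-1) Nx); rewrite scaleN1r lN ?oppr_le0//; exact: N_infty.
exists l; split => // z Dz.
have zxi : Linfty P k (z - xbar) by apply: LinftyB Dz.2 (N_infty N_xbar).
have -> : l z = l (z - xbar)
  by rewrite (bfB lb Dz.2 (N_infty N_xbar)) (lN0 _ N_xbar) subr0.
have := lp _ zxi; have : p (z - xbar) <= 1 * (f z - c) + K * 0.
  apply: (p_le zxi _ Dz N0) => //.
  by apply: nearW => w; rewrite scale1r subrr subr0 normr0.
by lra.
Qed.

End dual_functional.

(** * Selection of coordinates and vector conditional expectation *)

Section coordinate_selection.
Context (R : realType) (d : measure_display) (Omega : measurableType d).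
Variables (P : probability Omega R) (k : nat).
Implicit Types (x y z v : Omega -> 'rV[R]_k) (Q : pred 'I_k) (B : set Omega) (M : R).

Local Notation intg f := (P.-integrable [set: Omega] (EFin \o f)).
Local Notation EE f := (\int[P]_w (f w)).

(** Coordinates outside [Q] are set to 0 rather than removed, so that functionals on L^oo still
    apply. *)
Definition selv Q (a : 'rV[R]_k) : 'rV[R]_k := \row_i (if Q i then a ord0 i else 0).
Definition sel Q z : Omega -> 'rV[R]_k := fun w => selv Q (z w).

Lemma sel_lin Q a x y : sel Q (a *: x + y) = a *: sel Q x + sel Q y.
Proof.
apply/funext => w; rewrite /sel !fctE; apply/rowP => i; rewrite !mxE.
by case: (Q i); rewrite // mulr0 addr0.
Qed.

Lemma sel_predC Q z : sel Q z + sel (predC Q) z = z.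
Proof.
apply/funext => w; rewrite /sel !fctE; apply/rowP => i; rewrite !mxE /=.
by case: (Q i); rewrite ?addr0 ?add0r.
Qed.

Lemma restr_sel Q B z : restr B (sel Q z) = sel Q (restr B z).
Proof.
apply/funext => w; rewrite /restr /sel; apply/rowP => i; rewrite !mxE.
by case: (Q i); rewrite ?mulr0.
Qed.

Lemma norm_sel_le Q z w : `|sel Q z w| <= `|z w|.
Proof.
apply/rV_norm_leP => // i; rewrite mxE.
by case: (Q i); rewrite ?normr0// rV_coord_le_norm.
Qed.

Lemma Linfty_sel Q z : Linfty P k z -> Linfty P k (sel Q z).
Proof.
move=> /LinftyP[mz [M zM]]; apply/LinftyP; split.
  move=> i; rewrite (_ : (fun w => _) = fun w => if Q i then z w ord0 i else 0).
    by case: (Q i).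
  by apply/funext => w; rewrite mxE.
by exists M; apply: filterS zM => w; apply: le_trans; exact: norm_sel_le.
Qed.

Lemma bounded_functional_sel Q l : bounded_functional P l ->
  bounded_functional P (fun z => l (sel Q z)).
Proof.
move=> [ll [K K0 lK]]; split.
  by move=> a x y xi yi; rewrite sel_lin ll//; exact: Linfty_sel.
exists K => // z M zi zM; apply: lK; first exact: Linfty_sel.
by apply: filterS zM => w; apply: le_trans; exact: norm_sel_le.
Qed.

Lemma ae_rowP x y :
  (forall i, \forall w \ae P, x w ord0 i = y w ord0 i) -> \forall w \ae P, x w = y w.
Proof.
move=> xy; have : \forall w \ae P, forall i, x w ord0 i =
  y w ord0 i by exact: filter_forall.
by apply: filterS => w xyw; apply/rowP.
Qed.

Lemma ae_norm_rowP x M : 0 <= M ->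
  (forall i, \forall w \ae P, `|x w ord0 i| <= M) -> \forall w \ae P, `|x w| <= M.
Proof.
move=> M0 xM; have : \forall w \ae P, forall i, `|x w ord0 i| <= M
  by exact: filter_forall.
by apply: filterS => w xMw; apply/rV_norm_leP.
Qed.

Lemma Linfty_coord_intg z i : Linfty P k z -> intg (fun w => z w ord0 i).
Proof.
move=> /LinftyP[mz [M zM]]; apply: intg_le_ae (intg_cst P M) => //.
by apply: filterS zM => w; apply: le_trans; exact: rV_coord_le_norm.
Qed.

Section vector_cond_exp.
Variable G : set (set Omega).
Hypothesis sG : sigma_algebra [set: Omega] G.
Hypothesis Gm : G `<=` measurable.

Lemma vcond_exp_bounded z M : Linfty P k z -> (\forall w \ae P, `|z w| <= M) ->
  \forall w \ae P, `|vcond_exp P G z w| <= M.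
Proof.
move=> zi zM; apply: ae_norm_rowP; first exact: ae_bound_ge0 zM.
move=> i; have zMi : \forall w \ae P, `|z w ord0 i| <= M.
  by apply: filterS zM => w; apply: le_trans; exact: rV_coord_le_norm.
have := cond_exp_bounded sG Gm (Linfty_coord_intg i zi) zMi.
by apply: filterS => w; rewrite mxE.
Qed.

Lemma Linfty_vcond_exp z : Linfty P k z -> Linfty P k (vcond_exp P G z).
Proof.
move=> zi; have [_ [M zM]] := (LinftyP P z).1 zi; apply/LinftyP; split.
  move=> i; rewrite (_ : (fun w => _) = cond_exp P G (fun w => z w ord0 i)).
    apply: (Gmeasurable_measurable sG Gm); apply: cond_exp_Gmeas => //.
    exact: Linfty_coord_intg.
  by apply/funext => w; rewrite mxE.
by exists M; exact: vcond_exp_bounded.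
Qed.

Lemma vcond_exp_lin a x y : Linfty P k x -> Linfty P k y ->
  \forall w \ae P, vcond_exp P G (a *: x + y) w =
    (a *: vcond_exp P G x + vcond_exp P G y) w.
Proof.
move=> xi yi; apply: ae_rowP => i.
have := cond_exp_lin sG Gm a (Linfty_coord_intg i xi) (Linfty_coord_intg i yi).
apply: filterS => w; rewrite !fctE !mxE => <-; congr (cond_exp _ _ _ _).
by apply/funext => w'; rewrite ?fctE !mxE.
Qed.

(** With arbitrarily chosen versions, conditional expectation is linear almost surely; [l] does not
    see the difference. *)
Lemma bounded_functional_vcond_exp l : bounded_functional P l ->
  bounded_functional P (fun z => l (vcond_exp P G z)).
Proof.
move=> lb; have [ll [K K0 lK]] := lb; split.
  move=> a x y xi yi; rewrite -ll; [|exact: Linfty_vcond_exp|exact: Linfty_vcond_exp].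
  apply: (bf_eq_ae lb).
  - by apply: Linfty_vcond_exp; exact: Linfty_lin.
  - by apply: Linfty_lin; exact: Linfty_vcond_exp.
  - exact: vcond_exp_lin.
exists K => // z M zi zM; apply: lK; first exact: Linfty_vcond_exp.
exact: vcond_exp_bounded.
Qed.

End vector_cond_exp.
End coordinate_selection.

(** * Backward elimination of the singular parts *)

Section singular_part_elimination.
Context (R : realType) (d : measure_display) (Omega : measurableType d).
Variables (P : probability Omega R) (T : nat) (F : 'I_T.+1 -> set (set Omega)).
Hypothesis HF : filtration F.
Variables (k : nat) (tau : 'I_k -> 'I_T.+1).
Variable h : 'rV[R]_k -> Omega -> \bar R.
Hypothesis hh : convex_normal_integrand h.
Hypothesis h_proper : proper_on (Eint P h) (Linfty P k).

Local Notation intg f := (P.-integrable [set: Omega] (EFin \o f)).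
Local Notation EE f := (\int[P]_w (f w)).
Local Notation V := (Omega -> 'rV[R]_k).
Local Notation D := (domE P h `&` Linfty P k).
Local Notation f z := (EE (hr h z)).
Local Notation dotE z v := (EE (fun w => dotmul (z w) (v w))).

(** Adaptedness in flat coordinates, [tau i] being the stage of coordinate [i]; this keeps dependent
    blocks out of the argument. *)
Definition coord_adapted : set V := [set x | forall i,
  measurable_fun [set: g_sigma_algebraType (F (tau i))] (fun w => x w ord0 i)].
Local Notation Ninf := (coord_adapted `&` Linfty P k).

Variable c : R.
Hypothesis D_cond : forall z, D z -> forall t : 'I_T.+1, exists2 zhat, D zhat &
  forall i, (tau i <= t)%N ->
    \forall w \ae P, cond_exp P (F t) (fun w => z w ord0 i) w = zhat w ord0 i.

(** [H] is computed pointwise, so pasting alters it only off [B], a set that will be small. *)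
Lemma hr_selE (Q : pred 'I_k) (v v' : V) B z z' w :
  let H z w := hr h z w - dotmul (sel (predC Q) z w) (v w) - dotmul (sel Q z w) (v'
    w) in
  H (mix B z z') w = H z w - \1_(~` B) w * (H z w - H z' w).
Proof.
move=> H; rewrite /H /hr /sel /mix !fctE /restr !indicE in_setC.
case: (w \in B) => /=; rewrite ?scale1r ?scale0r ?addr0 ?add0r ?mul0r ?mul1r ?subr0//.
by ring.
Qed.

(* On the sets [B] of the Yosida-Hewitt decomposition the singular part of [l]
   vanishes up to [e], while their complements are negligible for the integrals.
   Testing [l] with [z] on [B] and [z'] off [B] therefore decouples the argument
   [z'] of the singular part from [z]. *)
Lemma eliminate_singular_part (Q : pred 'I_k) (l : V -> R) (v v' : V) :
  bounded_functional P l -> (forall z, D z -> c + l z <= f z) ->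
  intg_vec P v -> intg_vec P v' ->
  (forall z, Linfty P k z -> l (sel (predC Q) z) = dotE (sel (predC Q) z) v) ->
  (forall e, 0 < e -> exists B, [/\ measurable B, fine (P (~` B)) <= e &
    forall z M, Linfty P k z -> (\forall w \ae P, `|z w| <= M) ->
      `|l (restr B z) - dotE (restr B z) v'| <= e * M]) ->
  forall z z', D z -> D z' ->
  c + dotE (sel (predC Q) z) v + dotE (sel Q z) v' +
    (l (sel Q z') - dotE (sel Q z') v') <= f z.
Proof.
move=> lb lf vi v'i lhigh yh z z' Dz Dz'.
pose ls y := l y - dotE y v'.
have lsb : bounded_functional P ls.
  apply: bounded_functional_add lb _; apply: bounded_functional_opp.
  exact: EE_dotmul_bounded.
rewrite -/(ls (sel Q z')).
have zi := Dz.2; have z'i := Dz'.2.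
have [_ [M zM]] := (LinftyP P z).1 zi; have [_ [M' z'M]] := (LinftyP P z').1 z'i.
have M0 := ae_bound_ge0 zM; have M'0 := ae_bound_ge0 z'M.
pose H z w := hr h z w - dotmul (sel (predC Q) z w) (v w) - dotmul (sel Q z w) (v' w).
have Hi y : D y -> intg (H y).
  move=> Dy; have yi := Dy.2; apply: intgB; last by apply: intg_dotmul => //;
    exact: Linfty_sel.
  apply: intgB; first exact: D_intg.
  by apply: intg_dotmul => //; exact: Linfty_sel.
have EH y : D y -> EE (H y) = f y - dotE (sel (predC Q) y) v - dotE (sel Q y) v'.
  move=> Dy; have yi := Dy.2.
  have i1 : intg (fun w => dotmul (sel (predC Q) y w) (v w)).
    by apply: intg_dotmul => //; exact: Linfty_sel.
  have i2 : intg (fun w => dotmul (sel Q y w) (v' w)).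
    by apply: intg_dotmul => //; exact: Linfty_sel.
  by rewrite EEB ?EEB//; [exact: D_intg|apply: intgB => //; exact: D_intg].
pose G w := H z w - H z' w.
have Gi : intg G by apply: intgB; exact: Hi.
apply/ler_addgt0Pr => e e0; have e2 : 0 < e / 2 by lra.
have [r r0 rG] := EE_abs_continuous Gi e2.
have MM : 0 < 2 * (M + M' + 1) by lra.
(* [r] makes the integral of [G] off [B] at most [e / 2]; the other term makes [e1 * (M + M')] at
   most [e / 2], the added 1 keeping its denominator positive. *)
pose e1 := Num.min r (e / (2 * (M + M' + 1))).
have e10 : 0 < e1 by rewrite lt_min r0 divr_gt0.
have [B [mB PB Bls]] := yh _ e10.
have [Dy _] := D_mix hh h_proper mB Dz Dz'.
set y := mix B z z' in Dy; have yi := Dy.2.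
have fy := lf _ Dy.
have lyE : l y = dotE (sel (predC Q) y) v + dotE (sel Q y) v' + ls (sel Q y).
  rewrite -{1}(sel_predC Q y) (bfD lb); [|exact: Linfty_sel|exact: Linfty_sel].
  by rewrite lhigh// /ls; ring.
(* The singular part of the pasted point is that of [z'], up to two terms supported in [B], where
   [ls] is small. *)
have lsyE : ls (sel Q y) =
  ls (restr B (sel Q z)) + ls (sel Q z') - ls (restr B (sel Q z')).
  have sz' := Linfty_sel Q z'i; have sz := Linfty_sel Q zi.
  have mC := measurableC mB.
  have -> : sel Q y = restr B (sel Q z) + restr (~` B) (sel Q z').
    by rewrite !restr_sel /y /mix -[in LHS](scale1r (restr B z)) sel_lin scale1r.
  rewrite (bfD lsb); [|exact: Linfty_restr|exact: Linfty_restr].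
  have := restr_setC B (sel Q z') => /(congr1 ls).
  rewrite (bfD lsb); [|exact: Linfty_restr|exact: Linfty_restr].
  by lra.
have EHy : EE (H y) = EE (H z) - EE (fun w => \1_(~` B) w * G w).
  rewrite -EEB; [|exact: Hi|by apply: intg_indic => //; exact: measurableC].
  by apply: eq_Rintegral => w _; rewrite /H hr_selE.
have b1 : `|ls (restr B (sel Q z))| <= e1 * M.
  apply: Bls; first exact: Linfty_sel.
  by apply: filterS zM => w; apply: le_trans; exact: norm_sel_le.
have b2 : `|ls (restr B (sel Q z'))| <= e1 * M'.
  apply: Bls; first exact: Linfty_sel.
  by apply: filterS z'M => w; apply: le_trans; exact: norm_sel_le.
have b3 : `|EE (fun w => \1_(~` B) w * G w)| <= e / 2.
  by apply: rG; [exact: measurableC|rewrite (le_trans PB)// ge_min lexx].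
have b4 : e1 * (M + M') <= e / 2.
  apply: (@le_trans _ _ (e / (2 * (M + M' + 1)) * (M + M' + 1))); last first.
    rewrite le_eqVlt; apply/orP; left; apply/eqP.
    by field; rewrite gt_eqF//; lra.
  apply: ler_pM => //; [exact: ltW|lra| |lra].
  by rewrite ge_min lexx orbT.
have := EH _ Dz; have := EH _ Dy.
move: b1 b2 b3; rewrite !ler_norml => /andP[b1 _] /andP[_ b2] /andP[b3 _].
by lra.
Qed.

(* Only the components of [l] of stages before [j] may have a singular part. *)
Definition price_state (j : nat) := exists (l : V -> R) (v : V),
  [/\ bounded_functional P l, forall x, Ninf x -> l x = 0,
      forall z, D z -> c + l z <= f z, intg_vec P v &
      forall z, Linfty P k z -> (forall i w, (tau i < j)%N -> z w ord0 i = 0) ->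
        l z = dotE z v].

Let sF t : sigma_algebra [set: Omega] (F t).
Proof. by have [] := HF. Qed.

Let Fm t : F t `<=` measurable.
Proof. by have [_ Fm _] := HF; exact: Fm. Qed.

Lemma measurable_fun_filtration (s t : 'I_T.+1) (g : Omega -> R) : (s <= t)%N ->
  measurable_fun [set: g_sigma_algebraType (F s)] g ->
  measurable_fun [set: g_sigma_algebraType (F t)] g.
Proof.
move=> st mg _ B mB; rewrite setTI; apply: sub_sigma_algebra.
have [_ _ Fst] := HF; apply: (Fst s t st); apply: Gmeasurable_set => //.
by have := mg measurableT B mB; rewrite setTI.
Qed.

(** The new functional [l'] lets the singular part act on the stages up to [t] through [E_t]. It is
    still a minorant, because (1) provides an admissible [z'] for [eliminate_singular_part], and
    still vanishes on N^oo, because [E_t] fixes adapted components up to [t]. If [z] vanishes before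
    stage [t], the singular part sees the stage-[t] vector [y = E_t z_t] alone; [y] is adapted, so
    [l y = 0], and self-adjointness moves [E_t] onto the density. *)
Lemma price_state_step (t : 'I_T.+1) : price_state t.+1 -> price_state t.
Proof.
move=> [l [v [lb lN lf vi lv]]].
have [v' v'i yh] := yosida_hewitt lb.
pose Q : pred 'I_k := fun i => (tau i <= t)%N.
have lhigh z : Linfty P k z -> l (sel (predC Q) z) = dotE (sel (predC Q) z) v.
  move=> zi; apply: lv; first exact: Linfty_sel.
  by move=> i w; rewrite mxE /= /Q ltnS => ->.
pose ls y := l y - dotE y v'.
have lsb : bounded_functional P ls.
  apply: bounded_functional_add lb _; apply: bounded_functional_opp.
  exact: EE_dotmul_bounded.
pose ce (z : V) := vcond_exp P (F t) z.
have cei z : Linfty P k z -> Linfty P k (ce z) by move=> zi; exact: Linfty_vcond_exp.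
pose l' z := (dotE (sel (predC Q) z) v + dotE (sel Q z) v') + ls (sel Q (ce z)).
have zb i (z : V) : Linfty P k z -> exists M : R, \forall w \ae P, `|z w ord0 i| <= M.
  move=> /LinftyP[_ [M zM]]; exists M.
  by apply: filterS zM => w; apply: le_trans; exact: rV_coord_le_norm.
(* Stage [t] gets [v'_t - E_t v'_t] and later stages keep [v]; the representation tests [v'']
   against [z] vanishing before stage [t]. *)
pose v'' : V := fun w => \row_i ((if Q i then v' w ord0 i else v w ord0 i) -
  (if tau i == t then cond_exp P (F t) (fun w => v' w ord0 i) w else 0)).
have icv i : intg (cond_exp P (F t) (fun w => v' w ord0 i)).
  by apply: cond_exp_intg => //; exact: v'i.
exists l', v''; split.
- apply: bounded_functional_add.
    by apply: bounded_functional_add;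
      apply: (bounded_functional_sel _ (EE_dotmul_bounded _)).
  exact: (bounded_functional_vcond_exp (sF t) (@Fm t) (bounded_functional_sel Q lsb)).
- move=> x [Nx xi].
  have lsE : ls (sel Q (ce x)) = ls (sel Q x).
    apply: (bf_eq_ae lsb); [exact/Linfty_sel/cei|exact: Linfty_sel|].
    apply: ae_rowP => i.
    have [Qi|NQi] := boolP (Q i); last first.
      by apply: nearW => w; rewrite !mxE (negbTE NQi).
    have := cond_exp_id (sF t) (@Fm t) (measurable_fun_filtration Qi (Nx i))
      (Linfty_coord_intg i xi).
    by apply: filterS => w; rewrite !mxE Qi.
  rewrite /l' lsE -(lN x)// -[in RHS](sel_predC Q x).
  rewrite (bfD lb); [|exact: Linfty_sel|exact: Linfty_sel].
  by rewrite lhigh// /ls; ring.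
- move=> z Dz; have [zhat Dzhat zE] := D_cond Dz t.
  have lsE : ls (sel Q (ce z)) = ls (sel Q zhat).
    apply: (bf_eq_ae lsb); [exact/Linfty_sel/cei/Dz.2|exact: Linfty_sel Dzhat.2|].
    apply: ae_rowP => i.
    have [Qi|NQi] := boolP (Q i); last first.
      by apply: nearW => w; rewrite !mxE (negbTE NQi).
    by apply: filterS (zE i Qi) => w; rewrite !mxE Qi.
  have := eliminate_singular_part lb lf vi v'i lhigh yh Dz Dzhat.
  by rewrite /l' lsE /ls; lra.
- move=> i; apply: eq_integrable (_ : intg (fun w => (if Q i then v' w ord0 i else
  v w ord0 i) -
    (if tau i == t then cond_exp P (F t) (fun w => v' w ord0 i) w else 0))) => //.
    by move=> w _ /=; rewrite mxE.
  apply: intgB; first by case: (Q i); [exact: v'i|exact: vi].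
  by case: (tau i == t); [exact: icv|exact: intg_cst].
move=> z zi z0.
pose E : pred 'I_k := fun i => tau i == t.
pose y := sel E (ce z).
have yi : Linfty P k y by exact/Linfty_sel/cei.
have lsE : ls (sel Q (ce z)) = ls y.
  apply: (bf_eq_ae lsb) => //; first exact/Linfty_sel/cei.
  apply: ae_rowP => i; rewrite /y.
  have [it|ti|it] := ltngtP (tau i) t.
  - have zi0 : (fun w => z w ord0 i) = fun=> 0 by apply/funext => w; rewrite z0.
    have m0 : measurable_fun [set: g_sigma_algebraType (F t)] (fun=> 0 : R).
      exact: measurable_cst.
    have := cond_exp_id (sF t) (@Fm t) m0 (intg_cst P 0).
    apply: filterS => w ce0; rewrite !mxE zi0 (_ : Q i = true); last exact: ltnW.
    by rewrite (_ : E i = false) ?ce0// /E -val_eqE ltn_eqF.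
  - apply: nearW => w; rewrite !mxE (_ : Q i = false); last by rewrite /Q leqNgt ti.
    by rewrite (_ : E i = false)// /E -val_eqE gtn_eqF.
  - apply: nearW => w; rewrite !mxE (_ : Q i = true); last by rewrite /Q it leqnn.
    by rewrite (_ : E i = true)//; apply/eqP/val_inj.
have ly : l y = 0.
  apply: lN; split => // i.
  rewrite (_ : (fun w => _) =
    fun w => if E i then cond_exp P (F t) (fun w => z w ord0 i) w else 0).
    have [/eqP ->|_] := boolP (E i); last exact: measurable_cst.
    by apply: cond_exp_Gmeas => //; exact: Linfty_coord_intg.
  by apply/funext => w; rewrite !mxE.
have dy : dotE y v' = EE (fun w => \sum_i (if E i then z w ord0 i *
    cond_exp P (F t) (fun w => v' w ord0 i) w else 0)).
  have i1 i : intg (fun w => y w ord0 i * v' w ord0 i).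
    have [M yM] := zb i _ yi.
    by apply: intgM_bounded yM (v'i i); have [my _] := (LinftyP P y).1 yi; exact: my.
  have i2 i : intg (fun w => if E i then z w ord0 i *
      cond_exp P (F t) (fun w => v' w ord0 i) w else 0).
    case: (E i); last exact: intg_cst.
    have [M zM] := zb i _ zi; apply: intgM_bounded zM (icv i).
    by have [mz _] := (LinftyP P z).1 zi; exact: mz.
  rewrite !EE_sum//; apply: eq_bigr => i _.
  have [Ei|NEi] := boolP (E i); last first.
    by apply: eq_Rintegral => w _; rewrite !mxE (negbTE NEi) mul0r.
  have [M zM] := zb i _ zi; have [mz _] := (LinftyP P z).1 zi.
  rewrite -(cond_exp_adjoint (sF t) (@Fm t) (mz i) zM (v'i i)).
  by apply: eq_Rintegral => w _; rewrite !mxE Ei.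
rewrite /l' lsE /ls ly sub0r dy.
have j1 : intg (fun w => dotmul (sel (predC Q) z w) (v w)).
  by apply: intg_dotmul => //; exact: Linfty_sel.
have j2 : intg (fun w => dotmul (sel Q z w) (v' w)).
  by apply: intg_dotmul => //; exact: Linfty_sel.
have j3 : intg (fun w => \sum_i (if E i then z w ord0 i *
    cond_exp P (F t) (fun w => v' w ord0 i) w else 0)).
  apply: intg_sum => i; case: (E i); last exact: intg_cst.
  have [M zM] := zb i _ zi; apply: intgM_bounded zM (icv i).
  by have [mz _] := (LinftyP P z).1 zi; exact: mz.
rewrite -EED// -EEB//; last exact: intgD.
apply: eq_Rintegral => w _; rewrite /dotmul -big_split -sumrB /=.
apply: eq_bigr => i _; rewrite !mxE /=.
by case: (Q i) => /=; rewrite /E; case: (tau i == t); ring.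
Qed.

(** At index [T.+1] the representation concerns [z = 0], so the zero density starts the descent; at
    index 0 it concerns all of L^oo. *)
Lemma exists_price (l : V -> R) : bounded_functional P l ->
  (forall x, Ninf x -> l x = 0) -> (forall z, D z -> c + l z <= f z) ->
  exists v, [/\ intg_vec P v, forall x, Ninf x -> dotE x v = 0 &
    forall z, D z -> c + dotE z v <= f z].
Proof.
move=> lb lN lf.
have : price_state 0.
  have : price_state T.+1.
    exists l, (fun=> 0); split => //.
      by move=> i; apply: eq_integrable (intg_cst P 0) => // w _ /=; rewrite mxE.
    move=> z zi z0; have -> : z = 0.
      by apply/funext => w; apply/rowP => i; rewrite z0 ?mxE// ltn_ord.
    rewrite (bf0 lb) -[LHS](EE0 P); apply: eq_Rintegral => w _.
    by rewrite /dotmul big1// => i _; rewrite !mxE mul0r.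
  (* Carried along the descent, so that every index met below [T.+1] is a stage. *)
  have : (T.+1 <= T.+1)%N by [].
  elim: {1 3}T.+1 => // j ih jT st; apply: ih; first exact: ltnW.
  exact: (@price_state_step (Ordinal jT)).
move=> [l0 [v [l0b l0N l0f vi l0v]]]; exists v.
have l0E z : Linfty P k z -> l0 z = dotE z v by move=> zi; exact: l0v.
split => // [x Nx|z Dz].
  by rewrite -l0E ?l0N//; exact: Nx.2.
by rewrite -l0E ?l0f//; exact: Dz.2.
Qed.

End singular_part_elimination.

(** * Orthogonality of the price to unbounded adapted strategies *)

Section unbounded_strategies.
Context (R : realType) (d : measure_display) (Omega : measurableType d).
Variables (P : probability Omega R) (T : nat) (F : 'I_T.+1 -> set (set Omega)).
Hypothesis HF : filtration F.
Variables (k : nat) (tau : 'I_k -> 'I_T.+1).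

Local Notation intg f := (P.-integrable [set: Omega] (EFin \o f)).
Local Notation EE f := (\int[P]_w (f w)).
Local Notation V := (Omega -> 'rV[R]_k).
Local Notation dotE z v := (EE (fun w => dotmul (z w) (v w))).
Local Notation Ad := (coord_adapted F tau).
Local Notation Ninf := (Ad `&` Linfty P k).

Variable v : V.
Hypothesis vi : intg_vec P v.
Hypothesis vN : forall x, Ninf x -> dotE x v = 0.

Let sF t : sigma_algebra [set: Omega] (F t).
Proof. by have [] := HF. Qed.

Let Fm t : F t `<=` measurable.
Proof. by have [_ Fm _] := HF; exact: Fm. Qed.

Lemma adapted_L0 x : Ad x -> L0 R Omega k x.
Proof. by move=> Ax i; apply: (Gmeasurable_measurable (sF (tau i)) (@Fm (tau i)));
  exact: Ax. Qed.

Let FI t A B : F t A -> F t B -> F t (A `&` B).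
Proof.
move=> FA FB; apply: Gmeasurable_set => //.
by apply: measurableI; exact: sub_sigma_algebra.
Qed.

Lemma measurable_dotmul (x : V) : L0 R Omega k x ->
  measurable_fun setT (fun w => dotmul (x w) (v w)).
Proof.
move=> mx; apply: measurable_sum => i; apply: measurable_funM; first exact: mx.
exact: intg_measurable (vi i).
Qed.

Section truncation.
Variables (x : V) (g : Omega -> R).
Hypotheses (Ax : Ad x) (gi : intg g).
Hypothesis xvg : \forall w \ae P, dotmul (x w) (v w) <= g w.

Let before (j : nat) : pred 'I_k := fun i => (tau i < j)%N.

(* The truncations are removed from the last stage to the first; the stage
   being released contributes nothing since its truncation is adapted. *)
Let claim (j : nat) := forall A : set Omega,
  measurable A -> (forall s : 'I_T.+1, (j <= s)%N -> F s A) ->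
  (exists K, forall w i, A w -> (tau i < j)%N -> `|x w ord0 i| <= K) ->
  intg (fun w => \1_A w * dotmul (x w) (v w)) /\
  EE (fun w => \1_A w * dotmul (x w) (v w)) =
  EE (fun w => \1_A w * dotmul (sel (before j) x w) (v w)).

Let Linfty_trunc (Q : pred 'I_k) A K : measurable A ->
  (forall w i, A w -> Q i -> `|x w ord0 i| <= K) -> Linfty P k (restr A (sel Q x)).
Proof.
move=> mA xK; apply/LinftyP; split.
  apply: L0_restr => // i;
    rewrite (_ : (fun w => _) = fun w => if Q i then x w ord0 i else 0).
    by case: (Q i) => //; exact: adapted_L0.
  by apply/funext => w; rewrite mxE.
exists `|K|; apply: nearW => w; apply/rV_norm_leP => // i.
rewrite /restr !mxE indicE; have [/set_mem Aw|_] := boolP (w \in A); last first.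
  by rewrite mul0r normr0.
rewrite mul1r; have [Qi|_] := boolP (Q i); last by rewrite normr0.
by apply: le_trans (ler_norm _); exact: xK.
Qed.

Let intg_trunc (Q : pred 'I_k) A K : measurable A ->
  (forall w i, A w -> Q i -> `|x w ord0 i| <= K) ->
  intg (fun w => \1_A w * dotmul (sel Q x w) (v w)).
Proof.
move=> mA xK; apply: eq_integrable (intg_dotmul (Linfty_trunc mA xK) vi) => // w _ /=.
by rewrite dotmul_restr.
Qed.

Let claim_top : claim T.+1.
Proof.
move=> A mA _ [K xK].
have -> : sel (before T.+1) x = x.
  by apply/funext => w; apply/rowP => i; rewrite mxE /before ltn_ord.
split => //; have := @intg_trunc xpredT A K mA (fun w i Aw _ => xK w i Aw (ltn_ord _)).
have -> : sel xpredT x = x by apply/funext => w; apply/rowP => i; rewrite mxE.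
by [].
Qed.

(** Stage [t] is truncated by the sets [B n] of [F t]. On [A] intersected with [B n] the induction
    hypothesis applies, and the stage-[t] part of [x], bounded and adapted there, is orthogonal to
    [v]. Releasing [n] needs integrability of [q], which is where the majorant [g] enters. *)
Let claim_step (t : 'I_T.+1) : claim t.+1 -> claim t.
Proof.
move=> ih A mA FA [K xK].
pose B (n : nat) := \bigcap_(i in [set i | tau i = t]) [set w | `|x w ord0 i| <= n%:R].
have FB n : F t (B n).
  apply: Gmeasurable_set => //; apply: fin_bigcap_measurable => // i /= <-.
  have mle : measurable_fun [set: g_sigma_algebraType (F (tau i))]
      (fun w => `|x w ord0 i| <= n%:R).
    by apply: measurable_fun_ler => //; apply: measurableT_comp => //; exact: Ax.
  rewrite (_ : [set w | _] =
    setT `&` (fun w => `|x w ord0 i| <= n%:R) @^-1` [set true]).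
    exact: mle.
  by rewrite setTI; apply/seteqP; split.
have mB n : measurable (B n) by apply: Fm (FB n).
have ndB m n : (m <= n)%N -> B m `<=` B n.
  by move=> mn w Bw i it; apply: le_trans (Bw i it) _; rewrite ler_nat.
have exB w : exists n, B n w.
  exists (Num.bound `|x w|) => i _ /=; apply: le_trans (rV_coord_le_norm _ _) _.
  by rewrite ltW// (le_lt_trans _ (archi_boundP _)).
pose q w := \1_A w * dotmul (x w) (v w).
pose a w := \1_A w * dotmul (sel (before t) x w) (v w).
have ai : intg a by exact: intg_trunc xK.
have mq : measurable_fun setT q.
  by apply: measurable_funM => //; apply: measurable_dotmul; exact: adapted_L0.
have IE n w : \1_(A `&` B n) w = \1_(B n) w * \1_A w :> R by rewrite indicI mulrC.
have ihB n : intg (fun w => \1_(B n) w * q w) /\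
    EE (fun w => \1_(B n) w * q w) = EE (fun w => \1_(B n) w * a w).
  have mAB : measurable (A `&` B n) by exact: measurableI.
  have bnd w i : (A `&` B n) w -> (tau i < t.+1)%N -> `|x w ord0 i| <= `|K| + n%:R.
    move=> [Aw Bw]; rewrite ltnS leq_eqVlt => /orP[/eqP/val_inj it|it].
      by apply: le_trans (Bw i it) _; rewrite lerDr.
    by apply: le_trans (xK w i Aw it) _; rewrite (le_trans (ler_norm _))// lerDl.
  have [|||i1 E1] := ih (A `&` B n) => //.
  - move=> s ts; apply: FI; first by apply: FA; exact: ltnW.
    by have [_ _ Fst] := HF; exact: (Fst t s (ltnW ts) _ (FB n)).
  - by exists (`|K| + n%:R).
  split.
    by apply: eq_integrable i1 => // w _ /=; rewrite IE mulrA.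
  transitivity (EE (fun w => \1_(A `&` B n) w * dotmul (x w) (v w))).
    by apply: eq_Rintegral => w _; rewrite IE /q mulrA.
  rewrite E1.
  pose E : pred 'I_k := fun i => tau i == t.
  have bndE w i : (A `&` B n) w -> E i -> `|x w ord0 i| <= `|K| + n%:R.
    by move=> ABw /eqP it; apply: bnd => //; rewrite it.
  have NE : Ninf (restr (A `&` B n) (sel E x)).
    split; last exact: Linfty_trunc bndE.
    move=> i; rewrite (_ : (fun w => _) =
      fun w => \1_(A `&` B n) w * (if E i then x w ord0 i else 0)); last first.
      by apply/funext => w; rewrite /restr !mxE.
    have [/eqP it|_] := boolP (E i); last first.
      by rewrite (_ : (fun w => _) = fun=> 0)//; apply/funext => w; rewrite mulr0.
    apply: measurable_funM; last exact: Ax.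
    by rewrite it; apply: Gmeasurable_indic; apply: FI => //; exact: FA.
  have E0 := vN NE.
  have ie := intg_trunc mAB bndE.
  have ia : intg (fun w => \1_(B n) w * a w) by exact: intg_indic.
  rewrite -[RHS]addr0 -E0.
  have -> : dotE (restr (A `&` B n) (sel E x)) v =
      EE (fun w => \1_(A `&` B n) w * dotmul (sel E x w) (v w)).
    by apply: eq_Rintegral => w _; rewrite dotmul_restr.
  rewrite -EED//; apply: eq_Rintegral => w _.
  rewrite /a mulrA -IE -mulrDr; congr (_ * _).
  rewrite /dotmul -big_split /=; apply: eq_bigr => i _; rewrite !mxE /before /E ltnS.
  rewrite leq_eqVlt -val_eqE /=; case: ltngtP => _ /=; rewrite ?mul0r ?addr0 ?add0r//.
have gni : intg (fun w => `|g w|) by exact: integrable_norm.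
have ani : intg (fun w => `|a w|) by exact: integrable_norm.
have qi : intg q.
  (* From [q <= |g|] follows [|q| <= 2 |g| - q], and on [B n] the integral of [q] is that of [a],
     hence at least [- E|a|]. *)
  apply: (@intg_exhaust _ _ _ P B mB ndB exB q
    (2 * EE (fun w => `|g w|) + EE (fun w => `|a w|)) mq) => n.
    by have [] := ihB n.
  have [i1 E1] := ihB n.
  apply: (@le_trans _ _ (EE (fun w => 2 * `|g w| - \1_(B n) w * q w))).
    apply: EE_le_ae; [|apply: intgB => //; exact: intgZ|].
      have := integrable_norm i1; apply: eq_integrable => // w _ /=.
      by rewrite normrM ger0_norm.
    apply: filterS xvg => w xg; rewrite indicE.
    have [_|_] := boolP (w \in B n); rewrite ?mul1r ?mul0r;
      last by rewrite subr0 mulr_ge0.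
    have qg : q w <= `|g w|.
      rewrite /q indicE; case: (w \in A); rewrite ?mul1r ?mul0r//.
      exact: le_trans xg (ler_norm _).
    by have [q0|q0] := leP 0 (q w); [rewrite ger0_norm|rewrite ltr0_norm];
      have := normr_ge0 (g w); lra.
  rewrite EEB//; last exact: intgZ.
  rewrite EEZ// E1; have := EE_norm_le (intg_indic (mB n) ai).
  have : EE (fun w => `|\1_(B n) w * a w|) <= EE (fun w => `|a w|).
    apply: EE_le_ae => //; first exact/integrable_norm/intg_indic.
    apply: nearW => w; rewrite normrM ler_piMl// indicE.
    by case: (w \in B n); rewrite ?normr1 ?normr0.
  move=> h1 h2; have := le_trans h2 h1; rewrite ler_norml => /andP[h3 _].
  by lra.
split => //.
have c1 := @EE_exhaust _ _ _ P B mB ndB exB _ qi.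
have c2 := @EE_exhaust _ _ _ P B mB ndB exB _ ai.
have c12 : (fun n => EE (fun w => \1_(B n) w * q w)) =
    (fun n => EE (fun w => \1_(B n) w * a w)).
  by apply/funext => n; have [] := ihB n.
rewrite c12 in c1.
by rewrite -(cvg_lim (@Rhausdorff R) c2) (cvg_lim (@Rhausdorff R) c1).
Qed.

(** [claim 0] on the whole space: no stage has to be bounded beforehand, and no coordinate remains
    on the right-hand side. *)
Lemma orthogonal_adapted : intg (fun w => dotmul (x w) (v w)) /\ dotE x v = 0.
Proof.
have : claim 0.
  have := claim_top; have : (T.+1 <= T.+1)%N by [].
  elim: {1 3}T.+1 => // j ih jT st; apply: ih; first exact: ltnW.
  exact: (@claim_step (Ordinal jT)).
move=> /(_ setT measurableT)[||i1 E1].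
- by move=> s _; have [F0 FC _] := sF s; rewrite -(setD0 setT); exact: FC.
- by exists 0.
split; first by apply: eq_integrable i1 => // w _ /=; rewrite indicT mul1r.
transitivity (EE (fun w => \1_setT w * dotmul (x w) (v w))).
  by apply: eq_Rintegral => w _; rewrite indicT mul1r.
rewrite E1 -[RHS](EE0 P); apply: eq_Rintegral => w _.
by rewrite /dotmul big1 ?mulr0// => i _; rewrite mxE mul0r.
Qed.

End truncation.
End unbounded_strategies.

(** * The subgradient inequality at unbounded adapted strategies *)

Section adapted_minorant.
Context (R : realType) (d : measure_display) (Omega : measurableType d).
Variables (P : probability Omega R) (T : nat) (F : 'I_T.+1 -> set (set Omega)).
Hypothesis HF : filtration F.
Variables (k : nat) (tau : 'I_k -> 'I_T.+1).
Variable h : 'rV[R]_k -> Omega -> \bar R.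
Hypothesis hh : convex_normal_integrand h.
Hypothesis h_proper : proper_on (Eint P h) (Linfty P k).

Local Notation intg f := (P.-integrable [set: Omega] (EFin \o f)).
Local Notation EE f := (\int[P]_w (f w)).
Local Notation V := (Omega -> 'rV[R]_k).
Local Notation D := (domE P h `&` Linfty P k).
Local Notation f z := (EE (hr h z)).
Local Notation dotE z v := (EE (fun w => dotmul (z w) (v w))).
Local Notation Ad := (coord_adapted F tau).
Local Notation Ninf := (Ad `&` Linfty P k).

Variables (v : V) (c : R) (xbar : V).
Hypothesis vi : intg_vec P v.
Hypothesis vN : forall x, Ninf x -> dotE x v = 0.
Hypothesis cf : forall z, D z -> c + dotE z v <= f z.
Hypotheses (N_xbar : Ninf xbar) (D_xbar : D xbar).

Lemma hv_mixE B (y : V) w : h (mix B y xbar w) w =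
  if w \in B then h (y w) w else h (xbar w) w.
Proof.
rewrite /mix !fctE /restr !indicE in_setC.
by case: (w \in B) => /=; rewrite ?scale1r ?scale0r ?addr0 ?add0r.
Qed.

(* Evaluating the subgradient inequality at [y] on [B] and at [xbar] off [B]
   bounds [h(y) - h(xbar) - (y - xbar).v] from below on every set where [y]
   is bounded, so that no measurable selection is needed. *)
Lemma adapted_minorant x z : Ad x -> Linfty P k z ->
  ((c + dotE z v)%:E <= Eint P h (x + z)%R)%E.
Proof.
move=> Ax zi; set y := x + z.
have mx := adapted_L0 HF Ax; have [mz _] := (LinftyP P z).1 zi.
have my : L0 R Omega k y by exact: L0D.
have mh := measurable_hv hh my.
rewrite {1}/Eint /Eext; case: ifPn => [pfin|_]; last exact: leey.
pose B (n : nat) := [set w | `|y w| <= n%:R].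
have mB n : measurable (B n).
  have mle : measurable_fun setT (fun w => `|y w| <= n%:R).
    by apply: measurable_fun_ler => //; exact: measurable_rV_norm.
  rewrite (_ : B n = setT `&` (fun w => `|y w| <= n%:R) @^-1` [set true]).
    exact: mle.
  by rewrite setTI; apply/seteqP; split.
have ndB m n : (m <= n)%N -> B m `<=` B n.
  by move=> mn w /= /le_trans; apply; rewrite ler_nat.
have exB w : exists n, B n w.
  by exists (Num.bound `|y w|); rewrite /B/= ltW// (le_lt_trans _ (archi_boundP _)).
have restri n A : measurable A -> A `<=` B n -> Linfty P k (restr A y).
  move=> mA AB; apply/LinftyP; split; first exact: L0_restr.
  exists n%:R; apply: nearW => w; rewrite /restr normrZ indicE.
  have [/set_mem Aw|_] := boolP (w \in A); rewrite ?normr1 ?normr0 ?mul1r ?mul0r//.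
  exact: AB.
have Dmix n : D (mix (B n) y xbar).
  have mixi : Linfty P k (mix (B n) y xbar).
    apply: LinftyD; first exact: (restri n).
    by apply: Linfty_restr D_xbar.2; exact: measurableC.
  split => //; split; first by have [] := (LinftyP P _).1 mixi.
  have mmix : measurable_fun setT (fun w => h (mix (B n) y xbar w) w).
    by apply: (measurable_hv hh); have [] := (LinftyP P _).1 mixi.
  have mxb : measurable_fun setT (fun w => h (xbar w) w).
    by apply: (measurable_hv hh); have [] := (LinftyP P _).1 D_xbar.2.
  rewrite /Eint /Eext.
  have pm : (\int[P]_w (fun w => h (mix (B n) y xbar w) w)^\+ w < +oo)%E.
    apply: (@le_lt_trans _ _ (\int[P]_w ((fun w => h (y w) w)^\+ w + (fun w => h
      (xbar w) w)^\+ w))%E).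
      apply: ge0_le_integral => //; first exact: measurable_funepos.
        by apply: emeasurable_funD; exact: measurable_funepos.
      move=> w _; rewrite !funeposE hv_mixE; case: (w \in B n).
        by rewrite leeDl// le_max lexx orbT.
      by rewrite leeDr// le_max lexx orbT.
    rewrite ge0_integralD//; [|exact: measurable_funepos|exact: measurable_funepos].
    rewrite lte_add_pinfty//; apply: integral_funepos_lt_pinfty => //.
    exact: D_integrable.
  rewrite pm integralE.
  have n0 : (0 <= \int[P]_w (fun w => h (mix (B n) y xbar w) w)^\- w)%E
    by exact: integral_ge0.
  move: pm n0; case: (\int[P]_w _^\+ w)%E => [r| |];
    by case: (\int[P]_w _^\- w)%E => [s| |] //= _ _; rewrite -EFinB ltry.
(* On each [B n] finiteness comes from the pasted point, which lies in the domain; the sets [B n]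
   exhaust the space. *)
have yfin : \forall w \ae P, h (y w) w = (hr h y w)%:E.
  have : \forall w \ae P, forall n, h (mix (B n) y xbar w) w \is a fin_num.
    apply/ae_foralln => n.
    by apply: filterS (D_ae hh h_proper (Dmix n)) => w ->.
  apply: filterS => w; have [n Bw] := exB w => /(_ n).
  by rewrite hv_mixE mem_set// => yf; rewrite /hr fineK.
have myr : measurable_fun setT (hr h y) by exact: measurableT_comp.
have iBn n : intg (fun w => \1_(B n) w * hr h y w).
  have := intg_indic (mB n) (D_intg hh h_proper (Dmix n)).
  apply: eq_integrable => // w _ /=; rewrite /hr hv_mixE indicE.
  by case: (w \in B n) => //=; rewrite !mul0r.
have iA n A : measurable A -> A `<=` B n -> intg (fun w => \1_A w * hr h y w).
  move=> mA AB; have := intg_indic mA (iBn n); apply: eq_integrable => // w _ /=.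
  rewrite !indicE; have [/set_mem Aw|_] := boolP (w \in A); rewrite ?mul1r ?mul0r//.
  by rewrite mem_set ?mul1r//; exact: AB.
pose g w := hr h y w - hr h xbar w - dotmul ((y - xbar) w) (v w).
have xbi := D_xbar.2.
have mxb0 : L0 R Omega k xbar by have [] := (LinftyP P _).1 xbi.
have mg : measurable_fun setT g.
  apply: measurable_funB; last first.
    by apply: (measurable_dotmul vi); rewrite addrC -scaleN1r; exact: L0_lin.
  by apply: measurable_funB => //; apply: intg_measurable; exact: (D_intg hh h_proper).
have ixb := D_intg hh h_proper D_xbar.
have dot0 : dotE xbar v = 0 by exact: vN.
(* The inequality [cf] at the point equal to [y] on [A] and to [xbar] elsewhere, where
   [E(xbar.v) = 0]. *)
have gA n A : measurable A -> A `<=` B n ->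
    intg (fun w => \1_A w * g w) /\ c - f xbar <= EE (fun w => \1_A w * g w).
  move=> mA AB.
  have rAy := restri n A mA AB.
  have [Dm fm] := D_mix_gen hh h_proper mA my D_xbar rAy yfin (iA n A mA AB).
  have rxb : Linfty P k (restr A xbar) by exact: Linfty_restr.
  have i1 := iA n A mA AB; have i2 := intg_indic mA ixb.
  have i3 := intg_dotmul rAy vi; have i4 := intg_dotmul rxb vi.
  have gE : (fun w => \1_A w * g w) =
    fun w => (\1_A w * hr h y w - \1_A w * hr h xbar w) -
      (dotmul (restr A y w) (v w) - dotmul (restr A xbar w) (v w)).
    apply/funext => w; rewrite !dotmul_restr /g.
    have -> : dotmul ((y - xbar) w) (v w) = dotmul (y w) (v w) - dotmul (xbar w) (v w).
      by rewrite /dotmul -sumrB; apply: eq_bigr => i _; rewrite !fctE !mxE mulrBl.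
    by ring.
  split; first by rewrite gE; apply: intgB; exact: intgB.
  have := cf Dm; rewrite fm gE EEB ?EEB//; [|exact: intgB|exact: intgB].
  have -> : dotE (mix A y xbar) v = dotE (restr A y) v + dotE (restr (~` A) xbar) v.
    have := EE_dotmul_lin vi 1 rAy (Linfty_restr (measurableC mA) xbi).
    by rewrite scale1r mul1r.
  have := EE_dotmul_lin vi 1 rxb (Linfty_restr (measurableC mA) xbi).
  rewrite scale1r mul1r restr_setC dot0.
  by rewrite (EE_indic_setC mA ixb); lra.
have gB n := gA n (B n) (mB n) (@subset_refl _ _).
pose gm w := Num.max (- g w) 0.
have mgm : measurable_fun setT gm.
  by apply: measurable_maxr => //; exact: measurable_funN.
have gm0 w : 0 <= gm w by rewrite le_max lexx orbT.
have gmi : intg gm.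
  (* On these sets [gA] bounds the truncated integrals of the negative part of [g] by [f xbar - c],
     uniformly in [n]. *)
  pose A n := B n `&` [set w | g w < 0].
  have mA n : measurable (A n).
    apply: measurableI => //.
    have mlt : measurable_fun setT (fun w => g w < 0) by exact: measurable_fun_ltr.
    rewrite (_ : [set w | _] = setT `&` (fun w => g w < 0) @^-1` [set true]).
      exact: mlt.
    by rewrite setTI; apply/seteqP; split.
  have gmE n : (fun w => \1_(B n) w * gm w) = fun w => - 1 * (\1_(A n) w * g w).
    apply/funext => w; rewrite /A indicI /gm /=.
    have -> : \1_[set w | g w < 0] w = (g w < 0)%R%:R :> R.
      rewrite indicE; congr (_%:R); congr nat_of_bool.
      by apply/idP/idP => [/set_mem//|gw]; exact/mem_set.
    rewrite -mulrA mulN1r -mulrN; congr (_ * _).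
    have [gw|gw] := ltP (g w) 0; first by rewrite mul1r max_l// oppr_ge0 ltW.
    by rewrite mul0r oppr0 max_r// oppr_le0.
  have AB n : A n `<=` B n by move=> w [].
  apply: (@intg_exhaust _ _ _ P B mB ndB exB gm (f xbar - c) mgm) => n.
    by rewrite gmE; apply: intgZ; have [] := gA n _ (mA n) (AB n).
  have [i1 E1] := gA n _ (mA n) (AB n).
  under eq_Rintegral do rewrite (ger0_norm (gm0 _)).
  by rewrite [leLHS](_ : _ = EE (fun w => \1_(B n) w * gm w))// gmE EEZ//; lra.
pose hp w := Num.max (hr h y w) 0.
have hpi : intg hp.
  have mhp : measurable_fun setT hp by exact: measurable_maxr.
  apply/integrableP; split; first exact/measurable_EFinP.
  apply: le_lt_trans pfin; apply: ae_ge0_le_integral => //.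
  - exact/measurableT_comp/measurable_EFinP.
  - exact: measurable_funepos.
  - by apply: filterS yfin => w yw _ /=;
    rewrite funeposE yw ger0_norm ?EFin_max// le_max lexx orbT.
have izx : intg (fun w => dotmul ((z - xbar) w) (v w)).
  by apply: intg_dotmul => //; exact: LinftyB.
have dotD w : dotmul ((y - xbar) w) (v w) =
  dotmul (x w) (v w) + dotmul ((z - xbar) w) (v w).
  rewrite /dotmul -big_split; apply: eq_bigr => i _ /=.
  by rewrite /y !fctE !mxE; ring.
(* Integrable majorant of [x.v]: solve the definition of [g] for [x.v], then bound [h y] by its
   positive part and [- g] by [gm]. *)
pose q w := hp w - hr h xbar w - dotmul ((z - xbar) w) (v w) + gm w.
have qi : intg q by apply: intgD => //; apply: intgB => //; exact: intgB.
have [xvi xv0] : intg (fun w => dotmul (x w) (v w)) /\ dotE x v = 0.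
  apply: (orthogonal_adapted HF vi vN Ax qi); apply: nearW => w.
  have : - g w <= gm w by rewrite le_max lexx.
  have : hr h y w <= hp w by rewrite le_max lexx.
  by rewrite /q /g dotD; lra.
(* Once [x.v] is integrable, [- g <= gm] also bounds [h y] from below by an integrable function. *)
have iy : intg (hr h y).
  pose b w := hp w + (`|hr h xbar w| + `|dotmul ((z - xbar) w) (v w)| + `|dotmul (x
    w) (v w)| + gm w).
  have bi : intg b.
    apply: intgD => //; apply: intgD => //; apply: intgD.
      by apply: intgD; exact: integrable_norm.
    exact: integrable_norm.
  apply: (intg_le_ae myr _ bi); apply: nearW => w.
  have h1 : - g w <= gm w by rewrite le_max lexx.
  have h2 : hr h y w <= hp w by rewrite le_max lexx.
  have h3 : 0 <= hp w by rewrite le_max lexx orbT.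
  have := ler_norm (- hr h xbar w); rewrite normrN => h4.
  have := ler_norm (- dotmul ((z - xbar) w) (v w)); rewrite normrN => h5.
  have := ler_norm (- dotmul (x w) (v w)); rewrite normrN => h6.
  have h7 := normr_ge0 (hr h xbar w); have h8 := normr_ge0 (dotmul (x w) (v w)).
  have h9 := normr_ge0 (dotmul ((z - xbar) w) (v w)); have h10 := gm0 w.
  by move: h1; rewrite /g dotD ler_norml /b => h1; apply/andP; split; lra.
have gi : intg g.
  by apply: intgB; [exact: intgB|apply: eq_integrable (intgD xvi izx) => // w _ /=;
    rewrite dotD].
have Eg : c - f xbar <= EE g.
  have cg := @EE_exhaust _ _ _ P B mB ndB exB _ gi.
  rewrite -(cvg_lim (@Rhausdorff R) cg); apply: limr_ge.
    by apply/cvg_ex; eexists; exact: cg.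
  by apply: nearW => n; have [] := gB n.
have [_ ->] := integral_real_ae mh yfin iy.
rewrite lee_fin.
have : EE g = f y - f xbar - (dotE x v + dotE (z - xbar) v).
  have idy : intg (fun w => dotmul ((y - xbar) w) (v w)).
    by apply: eq_integrable (intgD xvi izx) => // w _ /=; rewrite dotD.
  rewrite EEB//; last exact: intgB.
  rewrite EEB//; congr (_ - _); rewrite -EED//.
  by apply: eq_Rintegral => w _; rewrite dotD.
have -> : dotE (z - xbar) v = dotE z v - dotE xbar v.
  have := EE_dotmul_lin vi (-1) xbi zi.
  by rewrite scaleN1r mulN1r [- _ + z]addrC [- _ + dotE z v]addrC.
by rewrite xv0 dot0; lra.
Qed.

End adapted_minorant.

(** * From blocks of stages to flat coordinates *)

Section blocks.
Context (R : realType) (d : measure_display) (Omega : measurableType d).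
Variables (T : nat) (n_ : 'I_T.+1 -> nat) (F : 'I_T.+1 -> set (set Omega)).
Local Notation V := (Omega -> 'rV[R]_(\sum_(t < T.+1) n_ t)).

(* The stage [t] of which the [i]-th scalar coordinate is a part. *)
Definition block_index (i : 'I_(\sum_(t < T.+1) n_ t)) : 'I_T.+1 := tagnat.sig1 i.

Lemma component_coord (x : V) i w :
  component x (block_index i) w ord0 (tagnat.sig2 i) = x w ord0 i.
Proof. by rewrite /component mxE tagnat.sig2K. Qed.

Lemma adapted_coord (x : V) : adapted R n_ F x <-> coord_adapted F block_index x.
Proof.
split=> [Ax i|Ax t j].
  have := Ax (block_index i) (tagnat.sig2 i).
  by under eq_fun do rewrite component_coord.
have := Ax (tagnat.Rank t j); rewrite /block_index tagnat.Rank1K.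
by apply: eq_measurable_fun => w _; rewrite /component mxE.
Qed.

Lemma adapted_proj_coord (P : probability Omega R) (z : V) w i :
  adapted_proj P F z w ord0 i = cond_exp P (F (block_index i)) (fun w => z w ord0 i) w.
Proof.
rewrite /adapted_proj !mxE; congr (cond_exp _ _ _ _).
by apply/funext => w'; exact: component_coord.
Qed.

End blocks.

(** * Distance from the adapted projection *)

Section distance_to_adapted.
Context (R : realType) (d : measure_display) (Omega : measurableType d).
Variables (P : probability Omega R) (T : nat) (n_ : 'I_T.+1 -> nat).
Variable F : 'I_T.+1 -> set (set Omega).
Hypothesis HF : filtration F.
Local Notation k := (\sum_(t < T.+1) n_ t)%N.
Local Notation V := (Omega -> 'rV[R]_k).

(** The projection is a contraction fixing the adapted [- x], so it moves [z] to within [r] of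
    [- x]; the triangle inequality gives [2 * r]. The right-hand side of (2) is thus controlled by
    the distance from N^oo. *)
Lemma adapted_proj_close (z x : V) (r : R) : Linfty P k z ->
  coord_adapted F (@block_index T n_) x -> Linfty P k x ->
  (\forall w \ae P, `|(z + x) w| <= r) ->
  \forall w \ae P, `|(adapted_proj P F z - z) w| <= 2 * r.
Proof.
move=> zi Ax xi zx; have r0 := ae_bound_ge0 zx.
have Nxi : Linfty P k (- x) by rewrite -scaleN1r; exact: LinftyZ.
suff h1 : \forall w \ae P, `|(adapted_proj P F z + x) w| <= r.
  apply: filterS2 zx h1 => w zx h1.
  rewrite (_ : (_ - z) w = (adapted_proj P F z + x) w - (z + x) w); last first.
    by rewrite !fctE opprD addrACA subrr addr0.
  by apply: le_trans (ler_normB _ _) _; lra.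
apply: ae_norm_rowP => // i; have [sF Fm _] := HF.
have mNx : measurable_fun [set: g_sigma_algebraType (F (block_index i))]
    (fun w => (- x) w ord0 i).
  rewrite (_ : (fun w => _) = fun w => - x w ord0 i); last first.
    by apply/funext => w; rewrite !fctE mxE.
  by apply: measurable_funN; exact: Ax.
have zxi : \forall w \ae P, `|z w ord0 i - (- x) w ord0 i| <= r.
  apply: filterS zx => w; apply: le_trans.
  by apply: le_trans (rV_coord_le_norm _ i); rewrite !fctE !mxE opprK.
have := cond_exp_close (sF (block_index i)) (Fm (block_index i)) (Linfty_coord_intg
  i zi)
  mNx (Linfty_coord_intg i Nxi) zxi.
apply: filterS => w.
rewrite (_ : (adapted_proj P F z + x) w ord0 i =
    cond_exp P (F (block_index i)) (fun w => z w ord0 i) w - (- x) w ord0 i)//.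
by rewrite !fctE [LHS]mxE adapted_proj_coord [(- x w) _ _]mxE opprK.
Qed.

End distance_to_adapted.

(** * Existence of a shadow price from hypotheses (1) to (3) *)

Theorem theorem2 (R : realType) (d : measure_display)
    (Omega : measurableType d) (P : probability Omega R)
    (T : nat) (n_ : 'I_T.+1 -> nat) (F : 'I_T.+1 -> set (set Omega))
    (HF : filtration F)
    (h : 'rV[R]_(\sum_(t < T.+1) n_ t) -> Omega -> \bar R)
    (Hh : convex_normal_integrand h)
    (Hphi0 : value_function P F h 0 \is a fin_num)
    (Hproper : proper_on (Eint P h) (Linfty P _))
    (A : set (Omega -> 'rV[R]_(\sum_(t < T.+1) n_ t)))
    (HA : A = aff (domE P h `&` Linfty P _))
    (H1 : forall z, (domE P h `&` Linfty P _) z -> forall t : 'I_T.+1,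
       exists2 zhat, (domE P h `&` Linfty P _) zhat &
         forall s : 'I_T.+1, (s <= t)%N ->
           \forall w \ae P,
             vcond_exp P (F t) (component z s) w = component zhat s w)
    (H2 : exists rho : R, forall z, A z ->
       exists2 x, (A `&` (adapted R n_ F `&` Linfty P _)) x &
         (Lpnorm P +oo (x - z)%R
            <= rho%:E * Lpnorm P +oo (adapted_proj P F z - z)%R)%E)
    (H3 : exists2 xbar, (A `&` (adapted R n_ F `&` Linfty P _)) xbar &
       Eint P h xbar \is a fin_num /\
       continuous_rel_at P (Eint P h) A xbar) :
  exists v, shadow_price P F h v.
Proof.
pose tau := @block_index T n_.
pose N := coord_adapted F tau `&` Linfty P (\sum_(t < T.+1) n_ t).
pose D := domE P h `&` Linfty P (\sum_(t < T.+1) n_ t).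
pose c := fine (value_function P F h 0).
have cE : value_function P F h 0 = c%:E by rewrite fineK.
have [xbar [Axb [adxb xbi]] [xbfin xbcont]] := H3.
have N_xbar : N xbar by split => //; exact/adapted_coord.
have D_xbar : D xbar.
  split => //; split; first by have [] := (LinftyP P xbar).1 xbi.
  by move: xbfin; rewrite fin_numE => /andP[_]; rewrite -ltey.
have N_lin a x y : N x -> N y -> N (a *: x + y).
  move=> [Ax xi] [Ay yi]; split; last exact: Linfty_lin.
  move=> i; rewrite (_ : (fun w => _) = fun w => a * x w ord0 i + y w ord0 i);
    last first.
    by apply/funext => w; rewrite !fctE !mxE.
  by apply: measurable_funD; [apply: measurable_funM => //; exact: Ax|exact: Ay].
have c_le x : N x -> D x -> c <= \int[P]_w hr h x w.
  move=> [Ax xi] Dx; rewrite -lee_fin -cE -(D_Eint Hh Hproper Dx).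
  apply: ereal_inf_lbound; exists x; first exact/adapted_coord.
  by rewrite addr0.
have [rho H2'] := H2.
have N_approx z x r : D z -> N x -> (\forall w \ae P, `|(z + x) w| <= r) ->
    exists x1, [/\ N x1, aff D x1 &
      \forall w \ae P, `|(x1 - z) w| <= `|rho| * 2 * r].
  move=> Dz [Ax xi] zx.
  have Az : A z by rewrite HA; exact: subset_aff.
  have [x1 [Ax1 [adx1 x1i]] x1z] := H2' z Az.
  exists x1; split; [by split => //; exact/adapted_coord|by rewrite -HA|].
  apply/Lpnorm_infty_leP; apply: le_trans x1z _.
  have pz := (Lpnorm_infty_leP _ _ _).2 (adapted_proj_close HF Dz.2 Ax xi zx).
  (* The sign of [rho] is not prescribed, whereas the multiplier of the distance has to be
     nonnegative. *)
  apply: (@le_trans _ _ (`|rho|%:E * Lpnorm P +oo (adapted_proj P F z - z)%R)%E).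
    by apply: lee_wpmul2r; [exact: Lnorm_ge0|rewrite lee_fin ler_norm].
  rewrite -mulrA EFinM; apply: lee_wpmul2l pz.
  by rewrite lee_fin.
have [eps eps0 f_bounded] : exists2 eps : R, 0 < eps & forall y, aff D y ->
    (\forall w \ae P, `|(y - xbar) w| <= eps) ->
    D y /\ \int[P]_w hr h y w <= \int[P]_w hr h xbar w + 1.
  (* The open half-line below [f xbar + 1] yields at once membership in the domain and the bound
     [M = f xbar + 1]. *)
  have : nbhs (Eint P h xbar) [set u | (u < (\int[P]_w hr h xbar w + 1)%:E)%E].
    rewrite (D_Eint Hh Hproper D_xbar); apply: open_nbhs_nbhs; split.
      exact: open_ereal_lt_ereal.
    by rewrite /= lte_fin ltrDl.
  (* Neighbourhoods ask for a norm strictly below [e], while an almost sure bound may be attained;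
     hence half of [e]. *)
  move=> /xbcont [e /= e0 eP]; exists (e / 2) => [|y Ay ye]; first lra.
  have yi : Linfty P (\sum_(t < T.+1) n_ t) y.
    apply: (aff_sub_subspace _ _ _ _ Ay); [exact: Linfty0|exact: LinftyD|
      exact: LinftyZ|by move=> u []].
  have yfin : (Eint P h y < (\int[P]_w hr h xbar w + 1)%:E)%E.
    apply: eP; last by rewrite HA.
    apply: (@le_lt_trans _ _ (e / 2)%:E); first exact/Lpnorm_infty_leP.
    by rewrite lte_fin; lra.
  have Dy : D y.
    split => //; split; first by have [] := (LinftyP P y).1 yi.
    exact: lt_trans yfin (ltry _).
  by split => //; move: yfin; rewrite (D_Eint Hh Hproper Dy) lte_fin => /ltW.
have rho0 : 0 <= `|rho| * 2 by rewrite mulr_ge0.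
have N_infty : N `<=` Linfty P (\sum_(t < T.+1) n_ t) by move=> x [].
have [l [lb lN lf]] := exists_dual_functional Hh Hproper N_lin N_infty c_le N_xbar
  D_xbar eps0 rho0 f_bounded N_approx.
have D_cond z : D z -> forall t : 'I_T.+1, exists2 zhat, D zhat &
    forall i, (tau i <= t)%N ->
      \forall w \ae P, cond_exp P (F t) (fun w => z w ord0 i) w = zhat w ord0 i.
  move=> Dz t; have [zhat Dzhat zE] := H1 z Dz t; exists zhat => // i it.
  apply: filterS (zE _ it) => w /rowP/(_ (tagnat.sig2 i)).
  rewrite component_coord mxE => <-; congr (cond_exp _ _ _ _).
  by apply/funext => w'; rewrite component_coord.
have [v [vi vN vf]] := exists_price HF Hh Hproper D_cond lb lN lf.
exists v; split; first exact: intg_vec_L1.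
move=> z zi; rewrite cE unlock integral_EFinE; last exact: intg_dotmul.
apply: le_ereal_inf_tmp => _ [x Ax <-]; rewrite -EFinD.
by apply: (adapted_minorant HF Hh Hproper vi vN vf N_xbar D_xbar) => //;
  exact/adapted_coord.
Qed.
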